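(* Suppose the AMP recursion $x_{t+1} = M\eta_t(x_t) - \langle \eta_t'(x_t)\rangle\,\eta_{t-1}(x_{t-1})$ ($t\ge 1$) for the spiked Wigner matrix $M=\lambda v^\star v^{\star\top}+W$ is initialized with some vector $x_0$ obeying $\eta_0(x_0)=0$ and some vector $x_1$ independent of $W$. Assume that each $\eta_t$ is differentiable except at a finite number of points. Then for every $1\le t<n$ the AMP iterates admit the decomposition $$x_{t+1}=\alpha_{t+1}v^\star+\sum_{k=1}^{t}\beta_t^k\phi_k+\xi_t,$$ where (i) $\alpha_{t+1}=\lambda v^{\star\top}\eta_t(x_t)\in\mathbb{R}$; (ii) the random vectors $\{\phi_k\}_{1\le k\le t}$ are independent with $\phi_k\sim\mathcal N(0,\frac1n I_n)$; (iii) the coefficient vector $\beta_t=(\beta_t^1,\dots,\beta_t^t)\in\mathbb{R}^t$ obeys $\|\beta_t\|_2=\|\eta_t(x_t)\|_2$; (iv) $\xi_t\in\mathbb{R}^n$ is a residual vector such that, with probability at least $1-O(n^{-11})$, $$\|\xi_t\|_2=\Big\langle\sum_{k=1}^{t-1}\mu_t^k\phi_k,\ \delta_t\Big\rangle-\langle\delta_t'\rangle\sum_{k=1}^{t-1}\mu_t^k\beta_{t-1}^k+\Delta_t+O\Big(\sqrt{\tfrac{t\log n}{n}}\,\|\beta_t\|_2\Big)$$ holds for some unit vector $\mu_t=[\mu_t^k]_{1\le k\le t-1}\in\mathbb{R}^{t-1}$, where $$v_t=\alpha_t v^\star+\sum_{k=1}^{t-1}\beta_{t-1}^k\phi_k,\qquad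 \delta_t=\eta_t(x_t)-\eta_t(v_t),\qquad \delta_t'=\eta_t'(x_t)-\eta_t'(v_t),$$ $$\Delta_t=\sum_{k=1}^{t-1}\mu_t^k\Big[\langle\phi_k,\eta_t(v_t)\rangle-\langle\eta_t'(v_t)\rangle\beta_{t-1}^k\Big].$$
   Context: Spiked Wigner model: $v^\star\in\mathbb{R}^n$ is a fixed vector with $\|v^\star\|_2=1$, $\lambda>0$, and $W=[W_{ij}]_{1\le i,j\le n}$ is a random symmetric matrix whose entries $W_{ij}$ ($i\ge j$) are independent with $W_{ij}=W_{ji}\sim\mathcal N(0,\frac1n)$ for $i\ne j$ and $W_{ii}\sim\mathcal N(0,\frac2n)$; $M=\lambda v^\star v^{\star\top}+W$. AMP: $\eta_t:\mathbb{R}\to\mathbb{R}$ ($t\ge0$) are scalar denoising functions with derivative $\eta_t'$; applied to a vector they act entrywise. At non-differentiable points the derivative is taken to be $0$. For a single vector $z\in\mathbb{R}^n$, $\langle z\rangle=\frac1n\sum_{i=1}^n z_i$; for two vectors, $\langle a,b\rangle=a^\top b$. The $\phi_k$ may be constructed on an enlarged probability space carrying additional Gaussian random variables independent of $W$ and $x_1$. The vectors $\phi_k$ do not depend on $t$; the coefficients $\beta_t$ may depend on the $\phi_k$. Empty sums are $0$; for $t=1$ one uses $\alpha_1=\lambda v^{\star\top}\eta_0(x_0)=0$, and the displayed formula for $\|\xi_1\|_2$ reduces to its $O(\cdot)$ term. The constants hidden in $O(\cdot)$ do not depend on $n$ or $t$. *)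

(* Defs.v *)
From HB Require Import structures.
From mathcomp Require Import all_boot all_order all_algebra finmap.
From mathcomp Require Import all_classical all_reals all_analysis.

Set Implicit Arguments.
Unset Strict Implicit.
Unset Printing Implicit Defensive.

Import Order.TTheory GRing.Theory Num.Theory.
Import numFieldNormedType.Exports.

Local Open Scope classical_set_scope.
Local Open Scope ring_scope.

(* The library norm on matrices is the sup norm, so the Euclidean norm is
   defined here. *)
Definition dotv (R : realType) (n : nat) (a b : 'cV[R]_n) : R :=
  \sum_(i < n) a i 0 * b i 0.

Definition norm2 (R : realType) (n : nat) (a : 'cV[R]_n) : R :=
  Num.sqrt (\sum_(i < n) a i 0 ^+ 2).

Definition avgv (R : realType) (n : nat) (z : 'cV[R]_n) : R :=
  (\sum_(i < n) z i 0) / n%:R.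

Definition differentiable_but_finitely (R : realType) (f : R -> R) : Prop :=
  finite_set [set y : R | ~ derivable f y 1].

(* Derivative with value 0 at the points of non-differentiability. *)
Definition deriv0 (R : realType) (f : R -> R) (y : R) : R :=
  if `[< derivable f y 1 >] then derive1 f y else 0.

Definition sigma_rv (d : measure_display) (T : measurableType d)
    (R : realType) (X : T -> R) : set (set T) :=
  preimage_set_system setT X measurable.

(* 'M[R]_(p, q) carries no measurable structure in the library: random vectors
   and matrices are handled through their entries. *)
Definition sigma_mx (d : measure_display) (T : measurableType d)
    (R : realType) (p q : nat) (X : T -> 'M[R]_(p, q)) : set (set T) :=
  <<s \bigcup_(ij : 'I_p * 'I_q) sigma_rv (fun w => X w ij.1 ij.2) >>.

Definition random_mx (d : measure_display) (T : measurableType d)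
    (R : realType) (p q : nat) (X : T -> 'M[R]_(p, q)) : Prop :=
  forall i j, measurable_fun setT (fun w => X w i j).

Definition independent2 (T : Type) (R : realType) (mu : set T -> \bar R)
    (F G : set (set T)) : Prop :=
  forall A B, F A -> G B -> mu (A `&` B) = (mu A * mu B)%E.

Definition mutually_independent (T : Type) (R : realType) (K : choiceType)
    (mu : set T -> \bar R) (D : set K) (F : K -> set (set T)) : Prop :=
  forall (J : {fset K}) (A : K -> set T),
    [set` J] `<=` D -> (forall k, [set` J] k -> F k (A k)) ->
    mu (\bigcap_(k in [set` J]) A k) = (\prod_(k <- J) mu (A k))%E.

(* X ~ N(0, v) for v > 0; [normal_prob] is parameterized by the standard
   deviation. *)
Definition centered_normal (d : measure_display) (T : measurableType d)
    (R : realType) (mu : set T -> \bar R) (X : T -> R) (v : R) : Prop :=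
  measurable_fun setT X /\
  forall B : set R, measurable B ->
    mu (X @^-1` B) = normal_prob 0 (Num.sqrt v) B.

Definition independent_normals (d : measure_display) (T : measurableType d)
    (R : realType) (K : choiceType) (mu : set T -> \bar R) (D : set K)
    (X : K -> T -> R) (v : K -> R) : Prop :=
  (forall k, D k -> centered_normal mu (X k) (v k)) /\
  mutually_independent mu D (fun k => sigma_rv (X k)).

(* X ~ N(0, v I_n) for v > 0. *)
Definition isotropic_gaussian (d : measure_display) (T : measurableType d)
    (R : realType) (n : nat) (mu : set T -> \bar R) (X : T -> 'cV[R]_n)
    (v : R) : Prop :=
  independent_normals mu [set: 'I_n] (fun i w => X w i 0) (fun=> v).

Definition wigner (d : measure_display) (T : measurableType d)
    (R : realType) (n : nat) (mu : set T -> \bar R) (W : T -> 'M[R]_n) : Prop :=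
  (forall w, (W w)^T = W w) /\
  independent_normals mu [set ij : 'I_n * 'I_n | (ij.2 <= ij.1)%N]
    (fun ij w => W w ij.1 ij.2)
    (fun ij => if ij.1 == ij.2 then 2 / n%:R else 1 / n%:R).

Definition spiked (R : realType) (n : nat) (lambda : R) (vstar : 'cV[R]_n)
    (W : 'M[R]_n) : 'M[R]_n :=
  lambda *: (vstar *m vstar^T) + W.

Definition amp_recursion (R : realType) (n : nat) (M : 'M[R]_n)
    (eta : nat -> R -> R) (x : nat -> 'cV[R]_n) : Prop :=
  forall t : nat, (1 <= t)%N ->
    x t.+1 = M *m map_mx (eta t) (x t)
             - avgv (map_mx (deriv0 (eta t)) (x t))
                 *: map_mx (eta t.-1) (x t.-1).

(* alpha_t, for t >= 1. *)
Definition amp_alpha (R : realType) (n : nat) (lambda : R) (vstar : 'cV[R]_n)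
    (eta : nat -> R -> R) (x : nat -> 'cV[R]_n) (t : nat) : R :=
  lambda * dotv vstar (map_mx (eta t.-1) (x t.-1)).

(* sum_(1 <= k <= t) c^k phi_k: the family phi is indexed from 1, whereas the
   entry k of the column c is its (k+1)-st coefficient. *)
Definition comb (R : realType) (n t : nat) (c : 'cV[R]_t)
    (phi : nat -> 'cV[R]_n) : 'cV[R]_n :=
  \sum_(k < t) c k 0 *: phi k.+1.

(* v_t, where b stands for beta_(t-1). *)
Definition amp_v (R : realType) (n : nat) (lambda : R) (vstar : 'cV[R]_n)
    (eta : nat -> R -> R) (x phi : nat -> 'cV[R]_n) (t : nat)
    (b : 'cV[R]_t.-1) : 'cV[R]_n :=
  amp_alpha lambda vstar eta x t *: vstar + comb b phi.

Arguments amp_v {R n} lambda vstar eta x phi t b.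

(* Delta_t, where b stands for beta_(t-1), v for v_t and f for eta_t. *)
Definition amp_Delta (R : realType) (n m : nat) (f : R -> R)
    (phi : nat -> 'cV[R]_n) (mu b : 'cV[R]_m) (v : 'cV[R]_n) : R :=
  \sum_(k < m) mu k 0 *
    (dotv (phi k.+1) (map_mx f v) - avgv (map_mx (deriv0 f) v) * b k 0).

(* The right-hand side of the formula for the norm of xi_t, without its O
   term; y stands for x_t, and f, b, v are as above. *)
Definition amp_main_term (R : realType) (n m : nat) (f : R -> R)
    (phi : nat -> 'cV[R]_n) (mu b : 'cV[R]_m) (y v : 'cV[R]_n) : R :=
  dotv (comb mu phi) (map_mx f y - map_mx f v)
  - avgv (map_mx (deriv0 f) y - map_mx (deriv0 f) v) * dotv mu b
  + amp_Delta f phi mu b v.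

(* Main.v *)
Require Import Defs.
From HB Require Import structures.
From mathcomp Require Import all_boot all_order all_algebra finmap.
From mathcomp Require Import all_classical all_reals all_analysis.
From mathcomp Require Import measurable_realfun zify ring lra.

Set Implicit Arguments.
Unset Strict Implicit.
Unset Printing Implicit Defensive.

Import Order.TTheory GRing.Theory Num.Theory.
Import numFieldNormedType.Exports.

Local Open Scope classical_set_scope.
Local Open Scope ring_scope.

(** Write y_t = eta_t(x_t) and W for the noise, and let z_1, z_2, ... be an
    orthonormal family with y_t in the span of z_1, ..., z_t.  The iteration
    sees W only through the vectors W z_k, and at the moment z_k is chosen the
    part of W that is still unseen is Gaussian.  In the basis z, column k of W
    reveals its entries of index i >= k, while those of index i < k are already
    known by symmetry, so W z_k itself is not Gaussian given the past.  Putting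
    fresh noise in place of the known entries and dividing the diagonal entry by
    sqrt 2 gives phi_k.

    To make this rigorous the lower triangle of W and the fresh noise are stored
    in one matrix b with independent N(0,1/n) entries (seed): W_ij below the
    diagonal, W_ii / sqrt 2 on it, and noise above it, read as an antisymmetric
    matrix K.  Since |W|^2 + |K|^2 = 2 |b|^2 for Frobenius norms, conjugating W
    and K by one orthogonal matrix Z is a linear isometry of b (rot), and so is
    lift_rot Z b = Z (rot Z b), whose column k is phi_k as soon as the first k
    columns of Z are z_1, ..., z_k.

    Law of the phi_k.  A Gaussian matrix is invariant under a fixed linear
    isometry (isometry_preserving): Givens rotations reduce this to rotations of
    the plane, which are products of three shears.  By Fubini it is also
    invariant under c |-> V c c when the isometry V c depends only on a block of
    entries of c and fixes that block (adaptive_isometry_preserving).  Start with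
    Z = 1 and bring in z_1, z_2, ... one at a time by Householder reflections.
    Passing from z_1, ..., z_k to z_1, ..., z_{k+1} changes lift_rot by a map of
    this kind, the block being the first k columns: they do not change
    (lift_rot_stable) and they suffice to rebuild z_1, ..., z_{k+1}
    (rebuilt_basisE).  So the matrix of the phi_k has independent N(0,1/n)
    entries for each value of x_1 (amp_phi_law), hence also on the probability
    space, where x_1 and b are independent (seed_preserving).

    Residual.  Let beta be the coordinates of y_t in the basis z.  Comparing W y_t
    with the sum of the beta^k phi_k, the coordinates of xi_t are those of a
    vector A plus N beta, where A_i = <phi_i, y_t> - <eta_t'(x_t)> beta_{t-1}^i
    for i < t, and N is a t x t matrix whose entries are, up to factors of
    modulus at most 1, the numbers <z_i, phi_k> with i <= k (residual_coords).
    In the main term of the statement v_t cancels and <mu, A> is left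
    (amp_main_termE), so with mu along A the claim reads
    | |A + N beta| - |A| | <= O(sqrt(t log n / n)) |beta|.  The numbers
    <z_i, phi_k>, i <= k, are again entries of a matrix of independent N(0,1/n)
    variables, by one more sequence of adaptive isometries (amp_coord_law).  A
    union bound over pairs of points of a grid with n^O(t) points therefore
    bounds the operator norm of N (gaussian_concentration). *)

(** * Lebesgue measure and the normal law under affine maps *)

Lemma measurable_preimage d d' (T : measurableType d) (U : measurableType d')
    (f : T -> U) (B : set U) :
  measurable_fun setT f -> measurable B -> measurable (f @^-1` B).
Proof. by move=> mf mB; rewrite -[X in measurable X]setTI; exact: mf. Qed.

Section Lebesgue.
Context {R : realType}.
Notation mu := (@lebesgue_measure R).
Local Open Scope ereal_scope.

Let addr_fun (r x : measurableTypeR R) : measurableTypeR R := (x + r)%R.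

Lemma lebesgue_measure_addr (r : R) (A : set R) : measurable A ->
  pushforward mu (addr_fun r) A = mu A.
Proof.
move=> mA.
have mf : measurable_fun [set: measurableTypeR R] (addr_fun r) by exact: measurable_funD.
apply/esym.
pose f : {mfun measurableTypeR R >-> measurableTypeR R} :=
  HB.pack (addr_fun r) (isMeasurableFun.Build _ _ _ _ _ mf).
apply: (lebesgue_measure_unique (mu := pushforward mu f)) => //= _ [[a b]] _ <-.
rewrite /pushforward/=.
rewrite (_ : _ @^-1` _ = `](a-r)%R, (b-r)%R]%classic); last first.
  by apply/seteqP; split => x /=; rewrite /addr_fun/= !in_itv/=; lra.
rewrite !lebesgue_measure_itv/= !lte_fin ltrD2r.
by case: ifP => // _; rewrite -!EFinB; congr EFin; ring.
Qed.

Lemma integral_addr (f : R -> \bar R) (r : R) : measurable_fun setT f ->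
  (forall x, 0 <= f x) -> \int[mu]_x f (x + r)%R = \int[mu]_x f x.
Proof.
move=> mf f0.
have ma : measurable_fun [set: measurableTypeR R] (addr_fun r) by exact: measurable_funD.
rewrite -[LHS](@ge0_integral_pushforward _ _ (measurableTypeR R) (measurableTypeR R) R _ ma mu setT)//.
by apply: eq_measure_integral => //= A mA _; exact: lebesgue_measure_addr.
Qed.

Let mulr_fun (c x : measurableTypeR R) : measurableTypeR R := (c * x)%R.

Lemma lebesgue_measure_mulr (c : R) (A : set R) : (0 < c)%R -> measurable A ->
  c%:E * pushforward mu (mulr_fun c) A = mu A.
Proof.
move=> c0 mA.
have mf : measurable_fun [set: measurableTypeR R] (mulr_fun c) by exact: measurable_funM.
apply/esym.
pose f : {mfun measurableTypeR R >-> measurableTypeR R} :=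
  HB.pack (mulr_fun c) (isMeasurableFun.Build _ _ _ _ _ mf).
pose k : {nonneg R} := NngNum (ltW c0).
apply: (lebesgue_measure_unique (mu := mscale k (pushforward mu f))) => //= _ [[a b]] _ <-.
rewrite /mscale/= /pushforward/=.
rewrite (_ : _ @^-1` _ = `](a / c)%R, (b / c)%R]%classic); last first.
  apply/seteqP; split => x /=; rewrite /mulr_fun/= !in_itv/=.
    by rewrite ltr_pdivrMr// ler_pdivlMr// ![(_ * c)%R]mulrC.
  by rewrite ltr_pdivrMr// ler_pdivlMr// ![(_ * c)%R]mulrC.
rewrite !lebesgue_measure_itv/= !lte_fin ltr_pM2r ?invr_gt0//.
case: ifP => // _; last by rewrite mule0.
by rewrite -!EFinB -EFinM; congr EFin; field; rewrite gt_eqF.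
Qed.

Lemma integral_mulr (f : R -> \bar R) (c : R) : (0 < c)%R ->
  measurable_fun setT f -> (forall x, 0 <= f x) ->
  c%:E * (\int[mu]_x f (c * x)%R) = \int[mu]_x f x.
Proof.
move=> c0 mf f0.
have ma : measurable_fun [set: measurableTypeR R] (mulr_fun c) by exact: measurable_funM.
rewrite -[X in _ * X](@ge0_integral_pushforward _ _ (measurableTypeR R) (measurableTypeR R) R _ ma mu setT)//.
pose g : {mfun measurableTypeR R >-> measurableTypeR R} :=
  HB.pack (mulr_fun c) (isMeasurableFun.Build _ _ _ _ _ ma).
pose k : {nonneg R} := NngNum (ltW c0).
rewrite -[in LHS](_ : pushforward mu g = pushforward mu (mulr_fun c))//.
rewrite -(ge0_integral_mscale _ measurableT k)//.
by apply: eq_measure_integral => //= A mA _; exact: lebesgue_measure_mulr.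
Qed.

Lemma integral_oppr (f : R -> \bar R) : measurable_fun setT f ->
  (forall x, 0 <= f x) -> \int[mu]_x f (- x)%R = \int[mu]_x f x.
Proof.
move=> mf f0.
have ma : measurable_fun [set: measurableTypeR R]
    (-%R : measurableTypeR R -> measurableTypeR R) by exact: oppr_measurable.
rewrite -[LHS](@ge0_integral_pushforward _ _ (measurableTypeR R) (measurableTypeR R) R _ ma mu setT)//.
by apply: eq_measure_integral => //= A mA _; exact: lebesgue_measureN.
Qed.

End Lebesgue.

Section Normal.
Context {R : realType}.
Notation mu := (@lebesgue_measure R).
Local Open Scope ereal_scope.

Lemma normal_probE m s (B : set R) : measurable B ->
  normal_prob m s B = \int[mu]_x ((normal_pdf m s x)%:E * (\1_B x)%:E).
Proof.
move=> mB; rewrite /normal_prob integral_mkcond; apply: eq_integral => x _.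
by rewrite epatch_indic.
Qed.

Lemma normal_pdf0E (s x : R) : s != 0%R ->
  normal_pdf 0 s x = (normal_peak s * expR (- x ^+ 2 / (s ^+ 2 *+ 2)))%R.
Proof. by move=> s0; rewrite normal_pdfE// /normal_fun subr0. Qed.

(** Normal variables of different variances are compared by scaling: the entries
    of W on and off the diagonal, and the standard normal noise, all become
    N(0,1/n) entries of one matrix. *)
Lemma normal_prob_scale (c s : R) (B : set R) : (0 < c)%R -> (0 < s)%R ->
  measurable B ->
  normal_prob 0 s [set x | B (c * x)%R] = normal_prob 0 (c * s) B.
Proof.
move=> c0 s0 mB.
have mB' : measurable [set x | B (c * x)%R].
  by apply: (measurable_preimage (f := *%R c)) => //; exact: mulrl_measurable.
rewrite !normal_probE// -[RHS](@integral_mulr _ _ c)//; first last.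
- by move=> x; rewrite -EFinM lee_fin mulr_ge0 ?normal_pdf_ge0.
- apply: emeasurable_funM; apply/measurable_EFinP => //.
    exact: measurable_normal_pdf.
rewrite -ge0_integralZl_EFin//; first last.
- exact: ltW.
- apply: emeasurable_funM; apply/measurable_EFinP => //.
    apply: (measurableT_comp (measurable_normal_pdf _ _)) => //.
  have m1 : measurable_fun setT (\1_B : R -> R) by exact: measurable_indic.
  have m2 : measurable_fun setT ( *%R c) := @mulrl_measurable R setT c.
  exact: (measurableT_comp m1 m2).
- by move=> x; rewrite -EFinM lee_fin mulr_ge0 ?normal_pdf_ge0.
apply: eq_integral => x _; rewrite muleA; congr (_ * _); rewrite -EFinM; congr EFin.
rewrite !normal_pdf0E ?mulf_neq0 ?gt_eqF// mulrA; congr (_ * _)%R.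
  rewrite /normal_peak.
  have -> : Num.sqrt ((c * s) ^+ 2 * pi *+ 2) = (c * Num.sqrt (s ^+ 2 * pi *+ 2))%R.
    rewrite -[in RHS](gtr0_norm c0) -sqrtr_sqr -sqrtrM ?sqr_ge0//.
    by congr Num.sqrt; ring.
  by rewrite invfM mulrA divff ?mul1r// gt_eqF.
by congr expR; field; rewrite !gt_eqF.
Qed.

Lemma integral_normal_prob (s : R) (f : R -> \bar R) : measurable_fun setT f ->
  (\int[normal_prob 0 s]_x `|f x| < +oo) ->
  \int[normal_prob 0 s]_x f x = \int[mu]_x (f x * (normal_pdf 0 s x)%:E).
Proof.
move=> mf finf.
rewrite -(Radon_Nikodym_change_of_variables (normal_prob_dominates 0 s))//=; last first.
  by apply/integrableP; split.
apply: ae_eq_integral => //.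
- apply: emeasurable_funM => //; apply: (measurable_int mu).
  by apply: Radon_Nikodym_integrable; exact: normal_prob_dominates.
- apply: emeasurable_funM => //=; apply/measurable_EFinP.
  exact: measurable_normal_pdf.
- apply: ae_eqe_mul2l => /=.
  rewrite Radon_NikodymE//=; first exact: normal_prob_dominates.
  move=> abmu.
  case: cid => /= h [h1 h2 h3].
  apply: integral_ae_eq => //=.
  + by apply/measurable_EFinP; exact: measurable_normal_pdf.
  + by move=> E E01 mE; rewrite -h3.
Qed.
End Normal.

(** * Rotation invariance of the planar normal law *)

Section Rotation.
Context {R : realType}.
Notation mu := (@lebesgue_measure R).
Local Open Scope ereal_scope.

Let iint (h : R * R -> \bar R) := \int[mu]_x \int[mu]_y h (x, y).

Let shearY (r : R) (p : R * R) : R * R := (p.1, (p.2 + r * p.1)%R).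
Let shearX (r : R) (p : R * R) : R * R := ((p.1 + r * p.2)%R, p.2).

Let measurable_shearY r : measurable_fun setT (shearY r).
Proof.
apply: measurable_fun_pair => //; apply: measurable_funD => //.
by apply: measurable_funM.
Qed.

Let measurable_shearX r : measurable_fun setT (shearX r).
Proof.
apply: measurable_fun_pair => //; apply: measurable_funD => //.
by apply: measurable_funM.
Qed.

Let iint_shearY h r : measurable_fun setT h -> (forall p, 0 <= h p) ->
  iint (h \o shearY r) = iint h.
Proof.
move=> mh h0; apply: eq_integral => x _ /=.
rewrite -[RHS](integral_addr (r * x)%R)//.
by apply: (measurableT_comp mh); exact: measurable_fun_pair.
Qed.

Let iint_swap h : measurable_fun setT h -> (forall p, 0 <= h p) ->
  iint h = iint (h \o @unstable.swap R R).
Proof. by move=> mh h0; rewrite /iint fubini_tonelli. Qed.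

Let iint_shearX h r : measurable_fun setT h -> (forall p, 0 <= h p) ->
  iint (h \o shearX r) = iint h.
Proof.
move=> mh h0.
rewrite (iint_swap (measurableT_comp mh (measurable_shearX r)) (fun p => h0 _)).
have ms := measurableT_comp mh (@measurable_swap _ _ R R).
rewrite -[LHS]/(iint ((h \o @unstable.swap R R) \o shearY r)).
by rewrite (iint_shearY _ ms (fun p => h0 _)) -iint_swap.
Qed.

Definition rot2 (a b : R) (p : R * R) : R * R :=
  ((a * p.1 - b * p.2)%R, (b * p.1 + a * p.2)%R).

Lemma measurable_rot2 a b : measurable_fun setT (rot2 a b).
Proof.
apply: measurable_fun_pair.
  by apply: measurable_funB; apply: measurable_funM.
by apply: measurable_funD; apply: measurable_funM.
Qed.

Let iint_rot2 h a b : (a ^+ 2 + b ^+ 2 = 1)%R -> b != 0%R ->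
  measurable_fun setT h -> (forall p, 0 <= h p) ->
  iint (h \o rot2 a b) = iint h.
Proof.
move=> ab b0 mh h0; pose t := ((a - 1) / b)%R.
have -> : rot2 a b = shearX t \o (shearY b \o shearX t).
  apply/funext => -[x y]; rewrite /rot2 /shearX /shearY /t/=; congr pair.
    have e : ((a - 1) / b * (a + 1) = - b)%R.
      apply: (mulIf b0); rewrite mulrAC divfK// mulNr -expr2.
      by rewrite (_ : (_ * _ = a ^+ 2 - 1)%R); [rewrite -ab|]; ring.
    by rewrite -mulNr -e; field.
  by field.
rewrite -[h \o _]/(((h \o shearX t) \o shearY b) \o shearX t).
have m1 := measurableT_comp mh (measurable_shearX t).
have m2 := measurableT_comp m1 (measurable_shearY b).
by rewrite (iint_shearX _ m2 (fun p => h0 _)) (iint_shearY _ m1 (fun p => h0 _)) iint_shearX.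
Qed.

Variable s : R.
Hypothesis s0 : s != 0%R.
Notation N := (normal_prob 0 s).

Let dens (p : R * R) := (normal_pdf 0 s p.1 * normal_pdf 0 s p.2)%R.

Let measurable_dens : measurable_fun setT dens.
Proof.
by apply: measurable_funM;
  apply: (measurableT_comp (measurable_normal_pdf _ _)).
Qed.

Let normal2E (E : set (R * R)) : measurable E ->
  (N \x N) E = iint (fun p => (dens p)%:E * (\1_E p)%:E).
Proof.
move=> mE; rewrite /product_measure1/= integral_normal_prob; first last.
- apply: (@le_lt_trans _ _ (\int[N]_x cst 1 x)).
    apply: ge0_le_integral => //=.
    - apply: measurableT_comp => //; exact: measurable_fun_xsection.
    - by move=> x _; rewrite gee0_abs// probability_le1//; exact: measurable_xsection.
  by rewrite integral_cst//= mul1e -ge0_fin_numE//; apply: fin_num_measure.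
- exact: measurable_fun_xsection.
apply: eq_integral => x _ /=.
have mx := measurable_xsection x mE.
rewrite normal_probE// muleC -ge0_integralZl_EFin//; first last.
- exact: normal_pdf_ge0.
- apply: emeasurable_funM; apply/measurable_EFinP => //.
  exact: measurable_normal_pdf.
- by move=> y _; rewrite -EFinM lee_fin mulr_ge0 ?normal_pdf_ge0.
apply: eq_integral => y _; by rewrite muleA -EFinM /dens/= !indicE mem_xsection.
Qed.

(** The density depends on x^2 + y^2 only, and a rotation is a product of three
    shears, each of which preserves Lebesgue measure by translation invariance on
    lines.  The slope (a - 1) / b of two of the shears is where b != 0 is used. *)
Lemma normal2_rot2 (a b : R) (E : set (R * R)) :
  (a ^+ 2 + b ^+ 2 = 1)%R -> b != 0%R -> measurable E ->
  (N \x N) (rot2 a b @^-1` E) = (N \x N) E.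
Proof.
move=> ab b0 mE.
have mE' := measurable_preimage (measurable_rot2 a b) mE.
rewrite (normal2E mE) (normal2E mE') -[RHS](iint_rot2 ab b0); first last.
- by move=> p; rewrite -EFinM lee_fin mulr_ge0// mulr_ge0 ?normal_pdf_ge0.
- by apply: emeasurable_funM; apply/measurable_EFinP.
congr iint; apply/funext => -[x y] /=; congr (_%:E * _%:E).
rewrite /dens/= !normal_pdf0E// mulrACA [RHS]mulrACA -!expRD; congr (_ * expR _)%R.
rewrite -!mulrDl; congr (_ / _)%R.
transitivity (- ((a ^+ 2 + b ^+ 2) * (x ^+ 2 + y ^+ 2)))%R; last by ring.
by rewrite ab; ring.
Qed.

End Rotation.

Section Reflection.
Context {R : realType}.
Local Open Scope ereal_scope.

Lemma normal_prob_oppr (s : R) (B : set R) : s != 0%R -> measurable B ->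
  normal_prob 0 s (-%R @^-1` B) = normal_prob 0 s B.
Proof.
move=> s0 mB.
have mB' : measurable (-%R @^-1` B).
  by apply: measurable_preimage => //; exact: oppr_measurable.
rewrite (normal_probE _ _ mB) (normal_probE _ _ mB') -[RHS]integral_oppr; first last.
- by move=> x; rewrite -EFinM lee_fin mulr_ge0 ?normal_pdf_ge0.
- apply: emeasurable_funM; apply/measurable_EFinP; first exact: measurable_normal_pdf.
  exact: measurable_indic.
by apply: eq_integral => x _; rewrite !normal_pdf0E// sqrrN.
Qed.

End Reflection.

(** * Random matrices with independent normal entries *)

Section MatrixMeasurable.
Context {R : realType} (p q : nat).

Definition mx_box (B : 'I_p -> 'I_q -> set R) : set 'M[R]_(p, q) :=
  [set M | forall i j, B i j (M i j)].

(** Products of measurable sets form a pi-system, so taking them as generators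
    makes equality of measures a matter of boxes (mx_measure_unique). *)
Definition mx_boxes : set (set 'M[R]_(p, q)) :=
  [set mx_box B | B in [set B | forall i j, measurable (B i j)]].

Let mx_measurable := <<s mx_boxes >>.

Let mx_measurable0 : mx_measurable set0.
Proof. exact: sigma_algebra0. Qed.

Let mx_measurableC A : mx_measurable A -> mx_measurable (~` A).
Proof. exact: sigma_algebraC. Qed.

Let mx_measurable_bigcup (F : (set 'M[R]_(p, q))^nat) :
  (forall i, mx_measurable (F i)) -> mx_measurable (\bigcup_i (F i)).
Proof. exact: sigma_algebra_bigcup. Qed.

HB.instance Definition _ := @isMeasurable.Build default_measure_display
  'M[R]_(p, q) mx_measurable mx_measurable0 mx_measurableC mx_measurable_bigcup.

End MatrixMeasurable.

Section MatrixMeasurableTheory.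
Context {R : realType} (p q : nat).
Implicit Type B : 'I_p -> 'I_q -> set R.

Lemma measurable_mx_box B :
  (forall i j, measurable (B i j)) -> measurable (mx_box B).
Proof. by move=> mB; apply: sub_sigma_algebra; exists B. Qed.

Lemma measurable_mx_entry (i : 'I_p) (j : 'I_q) :
  measurable_fun setT (fun M : 'M[R]_(p, q) => M i j).
Proof.
move=> _ Y mY; rewrite setTI.
pose B i' j' : set R := if (i' == i) && (j' == j) then Y else setT.
rewrite (_ : _ @^-1` _ = mx_box B).
  by apply: measurable_mx_box => i' j'; rewrite /B; case: ifP.
apply/seteqP; split => [M MY i' j'|M /(_ i j)]; rewrite /B.
  by case: ifP => // /andP[/eqP-> /eqP->].
by rewrite !eqxx.
Qed.

Lemma measurable_forall_fin d (T : measurableType d) (I : finType)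
    (A : I -> set T) : (forall i, measurable (A i)) ->
  measurable [set x | forall i, A i x].
Proof.
move=> mA; rewrite (_ : [set x | _] = \bigcap_(i in [set: I]) A i).
  by apply: fin_bigcap_measurable => //; exact: finite_finset.
by apply/seteqP; split => [x Ax i _|x Ax i]; apply: Ax.
Qed.

Lemma measurable_mxP d (T : measurableType d) (f : T -> 'M[R]_(p, q)) :
  (forall i j, measurable_fun setT (fun x => f x i j)) <->
  measurable_fun setT f.
Proof.
split=> [mf|mf i j]; last first.
  exact: (measurableT_comp (measurable_mx_entry i j) mf).
apply: (measurability (@mx_boxes R p q)) => //=.
move=> _ [_ [B mB <-] <-]; rewrite setTI.
rewrite (_ : _ @^-1` _ = [set x | forall ij : 'I_p * 'I_q, B ij.1 ij.2 (f x ij.1 ij.2)]).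
  apply: measurable_forall_fin => -[i j] /=.
  exact: (measurable_preimage (mf i j)).
by apply/seteqP; split => [x Ax [i j]|x Ax i j]; [exact: Ax|exact: (Ax (i, j))].
Qed.

Lemma mx_boxI B B' :
  mx_box B `&` mx_box B' = mx_box (fun i j => B i j `&` B' i j).
Proof.
by apply/seteqP; split => [M [b b'] i j|M b]; [split|split => i j; case: (b i j)].
Qed.

Lemma mx_boxT : mx_box (fun (i : 'I_p) (j : 'I_q) => [set: R]) = setT.
Proof. by apply/seteqP; split. Qed.

Lemma mx_measure_unique (m1 m2 : {measure set 'M[R]_(p, q) -> \bar R}) :
  (m1 setT < +oo)%E ->
  (forall B, (forall i j, measurable (B i j)) -> m1 (mx_box B) = m2 (mx_box B)) ->
  forall A, measurable A -> m1 A = m2 A.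
Proof.
move=> m1oo m12 A mA.
apply: (measure_unique (@mx_boxes R p q) (fun=> setT)) => //.
- move=> _ _ [B mB <-] [B' mB' <-]; rewrite mx_boxI.
  by exists (fun i j => B i j `&` B' i j) => // i j; apply: measurableI.
- move=> _; exists (fun _ _ => setT); last exact: mx_boxT.
  by move=> i j; exact: measurableT.
- by rewrite bigcup_const//; exists 0%N.
- by move=> _ [B mB <-]; exact: m12.
Qed.

End MatrixMeasurableTheory.

Section GaussianMatrix.
Context {R : realType} (s : R).
Local Open Scope ereal_scope.
Let N : probability (measurableTypeR R) R := normal_prob 0 s.


Let cons_tuple n (p : measurableTypeR R * n.-tuple R) : n.+1.-tuple R := [tuple of p.1 :: p.2].

Let measurable_cons_tuple n : measurable_fun setT (@cons_tuple n).
Proof. exact: measurable_cons. Qed.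

HB.instance Definition _ n := isMeasurableFun.Build _ _ _ _ _ (@measurable_cons_tuple n).

Fixpoint gaussian_tuple n : probability (n.-tuple R) R :=
  match n return probability (n.-tuple R) R with
  | 0%N => dirac [tuple] : probability _ _
  | m.+1 => distribution (N \x gaussian_tuple m) (@cons_tuple m)
  end.

Lemma gaussian_tuple_box n (B : 'I_n -> set R) : (forall i, measurable (B i)) ->
  gaussian_tuple n [set g | forall i, B i (tnth g i)] = \prod_(i < n) N (B i).
Proof.
elim: n B => [|n IH] B mB /=.
  rewrite big_ord0 diracE mem_set//; by case.
rewrite /distribution /pushforward/=.
rewrite (_ : _ @^-1` _ = B ord0 `*` [set g | forall i, B (lift ord0 i) (tnth g i)]).
  have m1 : measurable [set g : n.-tuple R | forall i, B (lift ord0 i) (tnth g i)].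
    apply: measurable_forall_fin => i.
    exact: (measurable_preimage (measurable_tnth i)).
  rewrite product_measure1E; [|exact: mB|exact: m1].
  rewrite big_ord_recl; congr (_ * _).
  by apply: (IH (fun i => B (lift ord0 i))) => i; exact: mB.
apply/seteqP; split => [[x g] /= h|[x g] /= [h0 h1] i].
  by split; [exact: (h ord0)|move=> i; have := h (lift ord0 i); rewrite tnthS].
by case: (unliftP ord0 i) => [j ->|->]; rewrite ?tnthS//; exact: h1.
Qed.

Variables p q : nat.

Let mx_of_tuple (g : (p * q).-tuple R) : 'M[R]_(p, q) :=
  \matrix_(i, j) tnth g (mxvec_index i j).

Let measurable_mx_of_tuple : measurable_fun setT mx_of_tuple.
Proof.
apply/measurable_mxP => i j.
rewrite (_ : (fun _ => _) = (fun g : (p * q).-tuple R => tnth g (mxvec_index i j))).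
  exact: measurable_tnth.
by apply/funext => g; rewrite mxE.
Qed.

HB.instance Definition _ := isMeasurableFun.Build _ _ _ _ _ measurable_mx_of_tuple.

Definition gaussian_mx : probability 'M[R]_(p, q) R :=
  distribution (gaussian_tuple (p * q)) mx_of_tuple.

Lemma gaussian_mx_box (B : 'I_p -> 'I_q -> set R) :
  (forall i j, measurable (B i j)) ->
  gaussian_mx (mx_box B) = \prod_(ij : 'I_p * 'I_q) N (B ij.1 ij.2).
Proof.
move=> mB; rewrite /gaussian_mx /distribution /pushforward/=.
have [f fK Kf] := curry_mxvec_bij p q.
transitivity (gaussian_tuple (p * q)
    [set g | forall k, B (f k).1 (f k).2 (tnth g k)]).
  congr (gaussian_tuple _ _); apply/seteqP; split => [g /= h k|g /= h i j].
    have := h (f k).1 (f k).2; rewrite mxE.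
    by rewrite -[mxvec_index _ _]/(uncurry (@mxvec_index p q) ((f k).1, (f k).2))
      -surjective_pairing Kf.
  by rewrite mxE; have := h (mxvec_index i j); rewrite (fK (i, j))//.
rewrite (@gaussian_tuple_box _ (fun k => B (f k).1 (f k).2))// (reindex (uncurry (@mxvec_index p q))) /=; last first.
  by exists f => x _; rewrite ?fK ?Kf.
by apply: eq_bigr => -[i j] _ /=; rewrite (fK (i, j))//.
Qed.

End GaussianMatrix.

(** * Linear isometries of matrix spaces *)

Section LinearIsometry.
Context {R : realType} {p q : nat}.
Implicit Types (u v : 'M[R]_(p, q)) (f g : 'M[R]_(p, q) -> 'M[R]_(p, q)).

(** The Frobenius inner product; for columns, the Euclidean one. *)
Definition mxdot u v : R := \sum_i \sum_j u i j * v i j.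

Definition linear_isometry f := linear f /\ forall v, mxdot (f v) (f v) = mxdot v v.

Lemma mxdotC u v : mxdot u v = mxdot v u.
Proof. by apply: eq_bigr => i _; apply: eq_bigr => j _; rewrite mulrC. Qed.

Lemma mxdotDl u u' v : mxdot (u + u') v = mxdot u v + mxdot u' v.
Proof.
rewrite -big_split; apply: eq_bigr => i _; rewrite -big_split; apply: eq_bigr => j _.
by rewrite mxE mulrDl.
Qed.

Lemma mxdotDr u v v' : mxdot u (v + v') = mxdot u v + mxdot u v'.
Proof. by rewrite mxdotC mxdotDl !(mxdotC u). Qed.

Lemma mxdot_delta u i j : mxdot u (delta_mx i j) = u i j.
Proof.
rewrite /mxdot (bigD1 i)//= (bigD1 j)//= mxE !eqxx mulr1 !big1 ?addr0//.
  by move=> i' /negbTE i'i; rewrite big1// => j' _; rewrite mxE i'i mulr0.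
by move=> j' /negbTE j'j; rewrite mxE j'j andbF mulr0.
Qed.

Lemma mxdot_ge0 u : 0 <= mxdot u u.
Proof. by apply: sumr_ge0 => i _; apply: sumr_ge0 => j _; rewrite -expr2 sqr_ge0. Qed.

Lemma mxdot_eq0 u : mxdot u u = 0 -> u = 0.
Proof.
move=> /eqP; rewrite psumr_eq0; last first.
  by move=> i _; apply: sumr_ge0 => j _; rewrite -expr2 sqr_ge0.
move=> /allP h; apply/matrixP => i j; have := h i (mem_index_enum i).
rewrite /= psumr_eq0; last by move=> j' _; rewrite -expr2 sqr_ge0.
move=> /allP /(_ j (mem_index_enum j)); rewrite /= -expr2 sqrf_eq0 => /eqP ->.
by rewrite mxE.
Qed.

Lemma linear_mapD f u v : linear f -> f (u + v) = f u + f v.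
Proof. by move=> lf; have := lf 1 u v; rewrite !scale1r. Qed.

Lemma linear_map0 f : linear f -> f 0 = 0.
Proof. by move=> lf; have := lf (-1) 0 0; rewrite !scaleN1r !addNr. Qed.

Lemma linear_mapZ f a u : linear f -> f (a *: u) = a *: f u.
Proof. by move=> lf; have := lf a u 0; rewrite (linear_map0 lf) !addr0. Qed.

Lemma linear_map_sum f (I : Type) (r : seq I) (F : I -> 'M[R]_(p, q)) :
  linear f -> f (\sum_(i <- r) F i) = \sum_(i <- r) f (F i).
Proof.
move=> lf; elim: r => [|i r IH]; first by rewrite !big_nil linear_map0.
by rewrite !big_cons linear_mapD// IH.
Qed.

Lemma linear_isometry_dot f u v : linear_isometry f ->
  mxdot (f u) (f v) = mxdot u v.
Proof.
move=> [lf nf]; have := nf (u + v).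
rewrite linear_mapD// !(mxdotDl, mxdotDr) !nf.
by rewrite (mxdotC v u) (mxdotC (f v) (f u)); lra.
Qed.

Lemma linear_isometry_comp f g :
  linear_isometry f -> linear_isometry g -> linear_isometry (f \o g).
Proof.
move=> [lf nf] [lg ng]; split; first by move=> a u v /=; rewrite lg lf.
by move=> v /=; rewrite nf ng.
Qed.

Lemma linear_map_measurable f : linear f -> measurable_fun setT f.
Proof.
move=> lf; apply/measurable_mxP => i j.
rewrite (_ : (fun _ => _) =
    (fun v => \sum_i' \sum_j' v i' j' * f (delta_mx i' j') i j)).
  apply: measurable_sum => i'; apply: measurable_sum => j'.
  by apply: measurable_funM => //; exact: measurable_mx_entry.
apply/funext => v; rewrite {1}(matrix_sum_delta v) linear_map_sum// summxE.
apply: eq_bigr => i' _; rewrite linear_map_sum// summxE.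
by apply: eq_bigr => j' _; rewrite linear_mapZ// mxE.
Qed.

End LinearIsometry.

Section Preserve.
Context {R : realType} (s : R) {p q : nat}.
Notation gauss := (gaussian_mx s p q).
Implicit Types (f g : 'M[R]_(p, q) -> 'M[R]_(p, q)).

Definition gaussian_preserving f :=
  forall E, measurable E -> gauss (f @^-1` E) = gauss E.

Lemma gaussian_preserving_comp f g : measurable_fun setT f ->
  gaussian_preserving f -> gaussian_preserving g -> gaussian_preserving (f \o g).
Proof.
move=> mf pf pg E mE; rewrite comp_preimage pg ?pf//.
exact: measurable_preimage.
Qed.

(** Lets an isometry be simplified by composing it with Givens rotations: it
    suffices to treat the simplified map, as the rotations can be undone. *)
Lemma gaussian_preserving_cancel f g g' : measurable_fun setT g' ->
  cancel g g' -> gaussian_preserving (g \o f) -> gaussian_preserving g' ->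
  gaussian_preserving f.
Proof.
move=> mg' gK pgf pg' E mE.
rewrite (_ : f = g' \o (g \o f)); last by apply/funext => v /=; rewrite gK.
by rewrite comp_preimage pgf ?pg'//; exact: measurable_preimage.
Qed.

End Preserve.

Section Merge.
Context {R : realType} (s : R) {p q : nat}.
Notation gauss := (gaussian_mx s p q).
Local Open Scope ereal_scope.

(** Resampling the entries outside A from an independent copy. *)
Definition merge (A : 'I_p -> 'I_q -> bool) (c : 'M[R]_(p, q) * 'M[R]_(p, q)) :=
  \matrix_(i, j) (if A i j then c.1 i j else c.2 i j).

Lemma measurable_merge A : measurable_fun setT (merge A).
Proof.
apply/measurable_mxP => i j; rewrite /merge.
under eq_fun do rewrite mxE.
by case: (A i j);
  apply: (measurableT_comp (measurable_mx_entry i j)).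
Qed.

(** Entries inside A come from one copy, those outside from the other, and all
    are independent with the same law; this splits a Gaussian matrix into two
    independent blocks without naming the blocks as separate spaces. *)
Lemma gaussian_merge A E : measurable E ->
  (gauss \x gauss) (merge A @^-1` E) = gauss E.
Proof.
move=> mE.
pose f : {mfun ('M[R]_(p, q) * 'M[R]_(p, q))%type >-> 'M[R]_(p, q)} :=
  HB.pack (merge A) (isMeasurableFun.Build _ _ _ _ _ (measurable_merge A)).
apply: (mx_measure_unique (m1 := distribution (gauss \x gauss) f)) => //.
  by apply: le_lt_trans (ltry 1); rewrite probability_le1.
move=> B mB; rewrite /distribution /pushforward/=.
pose B1 i j := if A i j then B i j else setT.
pose B2 i j := if A i j then setT else B i j.
have mB1 i j : measurable (B1 i j) by rewrite /B1; case: ifP.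
have mB2 i j : measurable (B2 i j) by rewrite /B2; case: ifP.
transitivity ((gauss \x gauss) (mx_box B1 `*` mx_box B2)).
  congr (_ _).
  apply/seteqP; split => [[c c'] /= h|[c c'] [/= h h'] i j].
    by split=> i j; have := h i j; rewrite mxE/= /B1 /B2; case: ifP.
  by have := h i j; have := h' i j; rewrite mxE/= /B1 /B2; case: ifP.
transitivity (gauss (mx_box B1) * gauss (mx_box B2)).
  by apply: product_measure1E; exact: measurable_mx_box.
rewrite (gaussian_mx_box s mB) (gaussian_mx_box s mB1) (gaussian_mx_box s mB2).
rewrite -big_split/=; apply: eq_bigr => -[i j] _ /=.
by rewrite /B1 /B2; case: ifP => _; rewrite probability_setT ?mule1 ?mul1e.
Qed.

End Merge.

(** * Invariance of the Gaussian law under linear isometries *)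

Lemma product_probabilityE d1 d2 (T1 : measurableType d1) (T2 : measurableType d2)
    (R : realType) (P1 : probability T1 R) (P2 : probability T2 R) A B :
  measurable A -> measurable B -> (P1 \x P2)%E (A `*` B) = (P1 A * P2 B)%E.
Proof. by move=> mA mB; rewrite product_measure1E. Qed.

Section Givens.
Context {R : realType} (s : R) (s0 : s != 0) (N : nat).
Notation gauss := (gaussian_mx s 1 N).
Local Open Scope ereal_scope.

Let row_box (B : 'I_N -> set R) : set 'rV[R]_N := mx_box (fun=> B).

Let gaussian_row_box (B : 'I_N -> set R) : (forall j, measurable (B j)) ->
  gauss (row_box B) = \prod_(j < N) normal_prob 0 s (B j).
Proof.
move=> mB; rewrite gaussian_mx_box// -(pair_big xpredT xpredT
  (fun (i : 'I_1) j => normal_prob 0 s (B j)))/=.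
by rewrite big_ord1.
Qed.

Definition givens (i k : 'I_N) (a b : R) (v : 'rV[R]_N) : 'rV[R]_N :=
  \row_j (if j == i then a * v 0 i - b * v 0 k
          else if j == k then b * v 0 i + a * v 0 k else v 0 j)%R.

Definition flip (k : 'I_N) (v : 'rV[R]_N) : 'rV[R]_N :=
  \row_j (if j == k then - v 0 k else v 0 j)%R.

(** Overwrites the coordinates i and k, so that a Givens rotation becomes a plane
    rotation of an independent pair. *)
Let ins2 (i k : 'I_N) (c : 'rV[R]_N * (measurableTypeR R * measurableTypeR R)) : 'rV[R]_N :=
  \row_j (if j == i then c.2.1 else if j == k then c.2.2 else c.1 0 j)%R.

Let measurable_ins2 i k : measurable_fun setT (ins2 i k).
Proof.
apply/measurable_mxP => i' j; rewrite /ins2.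
under eq_fun do rewrite mxE.
case: eqP => _; first exact: (measurableT_comp measurable_fst measurable_snd).
case: eqP => _; first exact: (measurableT_comp measurable_snd measurable_snd).
exact: (measurableT_comp (measurable_mx_entry 0%R j) measurable_fst).
Qed.

Let N1 : probability (measurableTypeR R) R := normal_prob 0 s.
Let N2 : probability (measurableTypeR R * measurableTypeR R)%type R := N1 \x N1.

Let gaussian_ins2 i k E : i != k -> measurable E ->
  (gauss \x N2) (ins2 i k @^-1` E) = gauss E.
Proof.
move=> ik mE.
pose f : {mfun ('rV[R]_N * (measurableTypeR R * measurableTypeR R))%type >-> 'rV[R]_N} :=
  HB.pack (ins2 i k) (isMeasurableFun.Build _ _ _ _ _ (measurable_ins2 i k)).
apply: (mx_measure_unique (m1 := distribution (gauss \x N2) f)) => //.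
  by apply: le_lt_trans (ltry 1); rewrite probability_le1.
move=> B mB; rewrite /distribution /pushforward/=.
pose B1 j := if (j == i) || (j == k) then setT else B 0%R j.
have mB1 j : measurable (B1 j) by rewrite /B1; case: ifP.
transitivity ((gauss \x N2) (row_box B1 `*` (B 0%R i `*` B 0%R k))).
  congr (_ _); apply/seteqP; split => [[c [x y]] /= h|[c [x y]] [/= h [hx hy]] i' j].
    split; last first.
      by split; [have := h 0%R i | have := h 0%R k]; rewrite mxE/= ?eqxx// eq_sym (negbTE ik).
    move=> i' j; have := h 0%R j; rewrite mxE/= /B1 (ord1 i').
    by case: (j == i) => //; case: (j == k).
  have := h i' j; rewrite mxE/= /B1 (ord1 i').
  by case: eqP => [->//|_]; case: eqP => [->//|_].
transitivity (gauss (row_box B1) * N2 (B 0%R i `*` B 0%R k)).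
  apply: product_probabilityE; first by apply: measurable_mx_box.
  by apply: measurableX; exact: mB.
rewrite (_ : N2 _ = N1 (B 0%R i) * N1 (B 0%R k)); last first.
  by apply: product_probabilityE; exact: mB.
rewrite gaussian_row_box//.
rewrite (_ : mx_box B = row_box (B 0%R)); last first.
  by apply/seteqP; split => [M h i' j|M h i' j]; have := h i' j; rewrite (ord1 i').
rewrite gaussian_row_box//.
rewrite (bigD1 i)//= (bigD1 k)/=; last by rewrite eq_sym.
rewrite [in RHS](bigD1 i)//= [in RHS](bigD1 k)/=; last by rewrite eq_sym.
rewrite {1}/B1 eqxx/= {1}/B1 eqxx orbT/= !probability_setT !mul1e muleC muleA.
congr (_ * _); apply: eq_bigr => j /andP[/negbTE ji /negbTE jk].
by rewrite /B1 ji jk.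
Qed.

Lemma givens_preserving i k (a b : R) : i != k -> b != 0%R ->
  (a ^+ 2 + b ^+ 2 = 1)%R -> gaussian_preserving s (givens i k a b).
Proof.
move=> ik b0 ab E mE.
have mI := measurable_preimage (measurable_ins2 i k) mE.
have lg : linear (givens i k a b).
  move=> c u v; apply/rowP => j; rewrite !mxE.
  by case: eqP => _; last (case: eqP => _ //); ring.
have mE' := measurable_preimage (linear_map_measurable lg) mE.
rewrite -(gaussian_ins2 ik mE) -(gaussian_ins2 ik mE').
apply: eq_integral => c _ /=.
rewrite -[in RHS](normal2_rot2 s0 ab b0); last exact: measurable_xsection.
congr (_ _); apply/seteqP; split => [[x y]|[x y]]; rewrite /xsection/= !inE/=.
  congr E; apply/rowP => j; rewrite !mxE/= eqxx (eq_sym k i) (negbTE ik) eqxx.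
  by case: eqP => // _; case: eqP.
congr E; apply/rowP => j; rewrite !mxE/= eqxx (eq_sym k i) (negbTE ik) eqxx.
by case: eqP => // _; case: eqP.
Qed.

Let ins1 (k : 'I_N) (c : 'rV[R]_N * measurableTypeR R) : 'rV[R]_N :=
  \row_j (if j == k then c.2 else c.1 0 j)%R.

Let measurable_ins1 k : measurable_fun setT (ins1 k).
Proof.
apply/measurable_mxP => i' j; rewrite /ins1.
under eq_fun do rewrite mxE.
case: eqP => _; first exact: measurable_snd.
exact: (measurableT_comp (measurable_mx_entry 0%R j) measurable_fst).
Qed.

Let gaussian_ins1 k E : measurable E ->
  (gauss \x N1) (ins1 k @^-1` E) = gauss E.
Proof.
move=> mE.
pose f : {mfun ('rV[R]_N * measurableTypeR R)%type >-> 'rV[R]_N} :=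
  HB.pack (ins1 k) (isMeasurableFun.Build _ _ _ _ _ (measurable_ins1 k)).
apply: (mx_measure_unique (m1 := distribution (gauss \x N1) f)) => //.
  by apply: le_lt_trans (ltry 1); rewrite probability_le1.
move=> B mB; rewrite /distribution /pushforward/=.
pose B1 j := if (j == k) then setT else B 0%R j.
have mB1 j : measurable (B1 j) by rewrite /B1; case: ifP.
transitivity ((gauss \x N1) (row_box B1 `*` B 0%R k)).
  congr (_ _); apply/seteqP; split => [[c x] /= h|[c x] [/= h hx] i' j].
    split; last by have := h 0%R k; rewrite mxE/= eqxx.
    move=> i' j; have := h 0%R j; rewrite mxE/= /B1 (ord1 i').
    by case: (j == k).
  have := h i' j; rewrite mxE/= /B1 (ord1 i').
  by case: eqP => [->//|_].
transitivity (gauss (row_box B1) * normal_prob 0 s (B 0%R k)).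
  by apply: product_measure1E; [by apply: measurable_mx_box|exact: mB].
rewrite gaussian_row_box//.
rewrite (_ : mx_box B = row_box (B 0%R)); last first.
  by apply/seteqP; split => [M h i' j|M h i' j]; have := h i' j; rewrite (ord1 i').
rewrite gaussian_row_box//.
rewrite (bigD1 k)//= [in RHS](bigD1 k)//=.
rewrite {1}/B1 eqxx/= !probability_setT !mul1e muleC.
congr (_ * _); apply: eq_bigr => j /negbTE jk.
by rewrite /B1 jk.
Qed.

Lemma flip_preserving k : gaussian_preserving s (flip k).
Proof.
move=> E mE.
have mI := measurable_preimage (measurable_ins1 k) mE.
have lg : linear (flip k).
  by move=> c u v; apply/rowP => j; rewrite !mxE; case: eqP => _ //; ring.
have mE' := measurable_preimage (linear_map_measurable lg) mE.
rewrite -(gaussian_ins1 k mE) -(gaussian_ins1 k mE').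
apply: eq_integral => c _ /=.
rewrite -[in RHS](normal_prob_oppr s0); last exact: measurable_xsection.
congr (_ _); apply/seteqP; split => x; rewrite /xsection/= !inE/=.
  by congr E; apply/rowP => j; rewrite !mxE/= eqxx; case: eqP.
by congr E; apply/rowP => j; rewrite !mxE/= eqxx; case: eqP.
Qed.

End Givens.

Section RowIsometry.
Context {R : realType} (s : R) (s0 : s != 0) (N : nat).
Implicit Type f : 'rV[R]_N -> 'rV[R]_N.
Notation e j := (delta_mx 0 j : 'rV[R]_N).

Lemma mxdot_row (u v : 'rV[R]_N) : mxdot u v = \sum_j u 0 j * v 0 j.
Proof. by rewrite /mxdot big_ord1. Qed.

Lemma givens_linear i k (a b : R) : linear (@givens R N i k a b).
Proof.
move=> c u v; apply/rowP => j; rewrite !mxE.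
by case: eqP => _; last (case: eqP => _ //); ring.
Qed.

Lemma givens_isometry i k (a b : R) : i != k -> a ^+ 2 + b ^+ 2 = 1 ->
  linear_isometry (@givens R N i k a b).
Proof.
move=> ik ab; split; first exact: givens_linear.
move=> v; rewrite !mxdot_row (bigD1 i)//= (bigD1 k)/=; last by rewrite eq_sym.
rewrite [RHS](bigD1 i)//= [in RHS](bigD1 k)/=; last by rewrite eq_sym.
rewrite !addrA; congr (_ + _).
  rewrite !mxE eqxx (eq_sym k i) (negbTE ik) eqxx.
  transitivity ((a ^+ 2 + b ^+ 2) * (v 0 i * v 0 i + v 0 k * v 0 k)); first by ring.
  by rewrite ab mul1r.
by apply: eq_bigr => j /andP[/negbTE ji /negbTE jk]; rewrite !mxE ji jk.
Qed.

Lemma givensK i k (a b : R) : i != k -> a ^+ 2 + b ^+ 2 = 1 ->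
  cancel (@givens R N i k a b) (givens i k a (- b)).
Proof.
move=> ik ab v; apply/rowP => j; rewrite !mxE !eqxx (eq_sym k i) (negbTE ik).
case: eqP => [->|_].
  transitivity ((a ^+ 2 + b ^+ 2) * v 0 i); first by ring.
  by rewrite ab mul1r.
case: eqP => [->|_//].
transitivity ((a ^+ 2 + b ^+ 2) * v 0 k); first by ring.
by rewrite ab mul1r.
Qed.

Lemma flip_linear k : linear (@flip R N k).
Proof. by move=> c u v; apply/rowP => j; rewrite !mxE; case: eqP => _ //; ring. Qed.

Lemma flip_isometry k : linear_isometry (@flip R N k).
Proof.
split; first exact: flip_linear.
move=> v; rewrite !mxdot_row; apply: eq_bigr => j _; rewrite !mxE.
by case: eqP => [->|//]; rewrite mulrNN.
Qed.

Lemma flipK k : cancel (@flip R N k) (flip k).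
Proof. by move=> v; apply/rowP => j; rewrite !mxE eqxx; case: eqP => [->|//]; rewrite opprK. Qed.

Let fixes f (k : nat) := forall j : 'I_N, (k <= j)%N -> f (e j) = e j.

(** Induction on m, the number of coordinates of f (e k) below k that may be
    nonzero: a Givens rotation in the plane (m, k) kills coordinate m.  When none
    is left f (e k) is e k up to sign, and f fixes one more basis vector. *)
Let step (k : 'I_N) : 
  (forall f, linear_isometry f -> fixes f k -> gaussian_preserving s f) ->
  forall m f, linear_isometry f -> fixes f k.+1 ->
  (forall i : 'I_N, (m <= i < k)%N -> f (e k) 0 i = 0) -> gaussian_preserving s f.
Proof.
move=> IH; elim=> [|m IHm] f isof fixf fk0.
  have fkE (j : 'I_N) : j != k -> f (e k) 0 j = 0.
    rewrite -val_eqE neq_ltn => /orP[jk|kj]; first exact: fk0.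
    rewrite -[LHS]mxdot_delta -(fixf _ kj) linear_isometry_dot// mxdot_delta mxE.
    by rewrite (_ : (j == k) = false) ?andbF// -val_eqE/= gtn_eqF.
  have fk : f (e k) = f (e k) 0 k *: e k.
    apply/rowP => j; rewrite !mxE eqxx/=.
    by case: eqP => [->|/eqP jk]; rewrite ?mulr1// fkE// mulr0.
  have /eqP : f (e k) 0 k ^+ 2 = 1.
    transitivity (mxdot (f (e k)) (f (e k))).
      by rewrite mxdot_row (bigD1 k)//= big1 ?addr0// => j jk; rewrite fkE// mulr0.
    by rewrite isof.2 mxdot_delta mxE !eqxx.
  rewrite sqrf_eq1 => /orP[/eqP fk1|/eqP fk1]; rewrite {}fk1 in fk.
    apply: IH => // j; rewrite leq_eqVlt => /orP[/eqP kj|]; last exact: fixf.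
    by rewrite (_ : j = k) ?fk ?scale1r//; exact/val_inj.
  (* f (e k) = - e k: one reflection of the axis reduces to the previous case. *)
  apply: (gaussian_preserving_cancel _ (@flipK k)); last exact: flip_preserving.
    exact: (linear_map_measurable (@flip_linear k)).
  apply: IH; first exact: linear_isometry_comp (flip_isometry k) isof.
  move=> j; rewrite leq_eqVlt => /orP[/eqP kj|kj] /=.
    rewrite (_ : j = k) ?fk//; last exact/val_inj.
    by apply/rowP => i; rewrite !mxE eqxx/=; case: eqP => _; rewrite ?eqxx ?mulN1r ?opprK ?oppr0.
  rewrite fixf//; apply/rowP => i; rewrite !mxE eqxx/=.
  by case: eqP => // ->; rewrite -val_eqE/= ltn_eqF// ?oppr0.
have [mk|km] := ltnP m k; last first.
  apply: IHm => // i /andP[mi ik].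
  by have := leq_ltn_trans mi ik; rewrite ltnNge km.
pose M := Ordinal (ltn_trans mk (ltn_ord k)).
have [um0|um0] := eqVneq (f (e k) 0 M) 0.
  apply: IHm => // i /andP[]; rewrite leq_eqVlt => /orP[/eqP mi _|mi ik].
    by rewrite -um0; congr (f (e k) 0 _); exact/val_inj.
  by apply: fk0; rewrite mi.
set um := f (e k) 0 M in um0; set uk := f (e k) 0 k.
pose r := Num.sqrt (um ^+ 2 + uk ^+ 2).
have r2 : r ^+ 2 = um ^+ 2 + uk ^+ 2 by rewrite sqr_sqrtr// addr_ge0 ?sqr_ge0.
have r0 : r != 0.
  by rewrite -sqrf_eq0 r2 paddr_eq0 ?sqr_ge0// sqrf_eq0 (negbTE um0).
have Mk : M != k by rewrite -val_eqE/= ltn_eqF.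
pose a := uk / r; pose b := um / r.
have b0 : b != 0 by rewrite mulf_neq0// invr_neq0.
have ab : a ^+ 2 + b ^+ 2 = 1.
  by rewrite !expr_div_n -mulrDl addrC -r2 divff// expf_neq0.
apply: (gaussian_preserving_cancel _ (givensK Mk ab)).
- exact: (linear_map_measurable (@givens_linear _ _ _ _)).
- apply: IHm.
  + exact: linear_isometry_comp (givens_isometry Mk ab) isof.
  + move=> j kj /=; rewrite fixf//; apply/rowP => i; rewrite !mxE/=.
    have kj' : k == j = false by rewrite -val_eqE/= ltn_eqF.
    have Mj' : M == j = false by rewrite -val_eqE/= ltn_eqF// (ltn_trans mk).
    rewrite kj' Mj' !mulr0 subrr addr0.
    by case: eqP => [->|_]; rewrite ?Mj'//; case: eqP => [->|_]; rewrite ?kj'.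
  + move=> i /andP[mi ik] /=; rewrite mxE -/um -/uk.
    case: eqP => [_|/eqP iM]; first by rewrite /a /b; ring.
    have -> : i == k = false by rewrite -val_eqE/= ltn_eqF.
    apply: fk0; rewrite ik andbT ltn_neqAle mi andbT eq_sym.
    by rewrite -val_eqE in iM.
- by apply: givens_preserving; rewrite ?oppr_eq0// sqrrN.
Qed.

(** Downward on the number of basis vectors that f fixes; an isometry that fixes
    all of them is the identity. *)
Lemma row_isometry_preserving f : linear_isometry f -> gaussian_preserving s f.
Proof.
move=> isof.
suff P k f' : (k <= N)%N -> linear_isometry f' -> fixes f' k -> gaussian_preserving s f'.
  by apply: (P N) => // j; rewrite leqNgt ltn_ord.
elim: k f' => [|k IH] f' kN isof' fixf'.
  rewrite (_ : f' = id) => [E mE //|]; apply/funext => v.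
  rewrite {1}(row_sum_delta v) (linear_map_sum _ _ isof'.1) [RHS]row_sum_delta.
  by apply: eq_bigr => j _; rewrite (linear_mapZ _ _ isof'.1) fixf'.
apply: (@step (Ordinal kN) _ k) => //=; first by move=> g isog fixg; apply: IH => //; exact: ltnW.
by move=> i /andP[ki ik]; move: (leq_ltn_trans ki ik); rewrite ltnn.
Qed.

End RowIsometry.

Section MatrixIsometry.
Context {R : realType} (s : R) (s0 : s != 0) (p q : nat).
Implicit Type f : 'M[R]_(p, q) -> 'M[R]_(p, q).

Let measurable_vec_mx : measurable_fun setT (@vec_mx R p q).
Proof.
by apply/measurable_mxP => i j; under eq_fun do rewrite mxE;
  exact: measurable_mx_entry.
Qed.

Lemma gaussian_vec_mx E : measurable E ->
  gaussian_mx s 1 (p * q) (@vec_mx R p q @^-1` E) = gaussian_mx s p q E.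
Proof.
pose h : {mfun 'rV[R]_(p * q) >-> 'M[R]_(p, q)} :=
  HB.pack (@vec_mx R p q) (isMeasurableFun.Build _ _ _ _ _ measurable_vec_mx).
apply: (mx_measure_unique (m1 := distribution (gaussian_mx s 1 (p * q)) h)) => //.
  by apply: le_lt_trans (ltry 1); rewrite probability_le1.
move=> B mB; rewrite /distribution /pushforward/=.
have [g gK Kg] := curry_mxvec_bij p q.
pose B1 (i : 'I_1) k := B (g k).1 (g k).2.
have mB1 i k : measurable (B1 i k) by exact: mB.
transitivity (gaussian_mx s 1 (p * q) (mx_box B1)).
  congr (_ _); apply/seteqP; split => [v h' i k|v h' i j].
    have := h' (g k).1 (g k).2; rewrite mxE (ord1 i).
    by rewrite -[mxvec_index _ _]/(uncurry (@mxvec_index p q) ((g k).1, (g k).2))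
      -surjective_pairing Kg.
  by rewrite mxE; have := h' 0 (mxvec_index i j); rewrite /B1 (gK (i, j)).
rewrite !gaussian_mx_box// -(pair_big xpredT xpredT
  (fun (i : 'I_1) k => normal_prob 0 s (B1 i k)))/= big_ord1.
rewrite (reindex (uncurry (@mxvec_index p q))) /=; last first.
  by exists g => x _; rewrite ?gK ?Kg.
by apply: eq_bigr => -[i j] _ /=; rewrite /B1 (gK (i, j)).
Qed.

Lemma mxdot_mxvec (u v : 'M[R]_(p, q)) : mxdot (mxvec u) (mxvec v) = mxdot u v.
Proof.
rewrite mxdot_row (reindex (uncurry (@mxvec_index p q)))/=; last first.
  exact: curry_mxvec_bij.
rewrite /mxdot pair_big; apply: eq_bigr => -[i j] _ /=.
by rewrite !mxvecE.
Qed.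

(** Rotational invariance of the standard normal law, read on matrices by
    flattening them into rows. *)
Theorem isometry_preserving f : linear_isometry f -> gaussian_preserving s f.
Proof.
move=> [lf nf] E mE.
have iso : linear_isometry (mxvec \o f \o @vec_mx R p q).
  split; first by move=> a u v /=; rewrite linearP lf linearP.
  by move=> v /=; rewrite mxdot_mxvec nf -mxdot_mxvec vec_mxK.
have mf := linear_map_measurable lf.
rewrite -gaussian_vec_mx//; last exact: measurable_preimage.
rewrite -[RHS]gaussian_vec_mx// -[RHS](row_isometry_preserving s0 iso).
  by congr (_ _); apply/seteqP; split=> v /=; rewrite mxvecK.
exact: measurable_preimage.
Qed.

End MatrixIsometry.

Section AdaptiveIsometry.
Context {R : realType} (s : R) (s0 : s != 0) (p q : nat).
Notation gauss := (gaussian_mx s p q).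
Implicit Type c : 'M[R]_(p, q).

(** Conditionally on the entries in A the isometry is fixed, and it acts on the
    remaining entries only: being an isometry that fixes the A-coordinates of
    every vector, it cannot mix the two blocks (VA, Vmerge).  So Fubini reduces
    the claim to a fixed isometry applied to an independent copy. *)
Theorem adaptive_isometry_preserving (A : 'I_p -> 'I_q -> bool)
    (V : 'M[R]_(p, q) -> 'M[R]_(p, q) -> 'M[R]_(p, q)) :
  (forall c, linear_isometry (V c)) ->
  (forall c c', (forall i j, A i j -> c i j = c' i j) -> V c = V c') ->
  (forall c c' i j, A i j -> V c c' i j = c' i j) ->
  measurable_fun setT (fun c => V c c) ->
  gaussian_preserving s (fun c => V c c).
Proof.
move=> isoV depV fixV mV E mE.
have mT := measurable_preimage mV mE.
have VA c (a : 'M[R]_(p, q)) : (forall i j, ~~ A i j -> a i j = 0) -> V c a = a.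
  move=> a0; apply/eqP; rewrite -subr_eq0; apply/eqP/mxdot_eq0.
  have h : mxdot (V c a) a = mxdot a a.
    apply: eq_bigr => i _; apply: eq_bigr => j _.
    by have [Aij|/a0->] := boolP (A i j); [rewrite fixV|rewrite !mulr0].
  rewrite -scaleN1r mxdotDl !mxdotDr (isoV c).2.
  have mxdotN u v : mxdot u (-1 *: v : 'M[R]_(p, q)) = - mxdot u v.
    rewrite /mxdot -sumrN; apply: eq_bigr => i _; rewrite -sumrN.
    by apply: eq_bigr => j _; rewrite mxE; ring.
  have mxdotNl u v : mxdot (-1 *: v : 'M[R]_(p, q)) u = - mxdot v u.
    by rewrite mxdotC mxdotN mxdotC.
  by rewrite !mxdotNl !mxdotN (mxdotC a (V c a)) h; ring.
have Vmerge a c : V a (merge A (a, c)) = merge A (a, V a c).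
  pose z (u : 'M[R]_(p, q)) := merge A (u, 0).
  have Vz u : V a (z u) = z u by apply: VA => i j /negbTE Aij; rewrite mxE Aij mxE.
  rewrite (_ : merge A (a, c) = z a + (c + -1 *: z c)); last first.
    by apply/matrixP => i j; rewrite !mxE/=; case: ifP => _; rewrite ?mxE; ring.
  have [lV _] := isoV a.
  rewrite !(linear_mapD _ _ lV) (linear_mapZ _ _ lV) !Vz.
  apply/matrixP => i j; rewrite !mxE/=; case: ifP => Aij; rewrite ?mxE; last by ring.
  by rewrite fixV//; ring.
rewrite -(gaussian_merge s A mE) -(gaussian_merge s A mT).
apply: eq_integral => a _ /=.
have mm := measurable_preimage (measurable_merge A) mE.
rewrite -[in RHS](isometry_preserving s0 (isoV a)); last exact: measurable_xsection.
have Vm c : V (merge A (a, c)) = V a.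
  by apply: depV => i j Aij; rewrite mxE/= Aij.
by congr (_ _); apply/seteqP; split => c; rewrite /xsection/= !inE/= Vm Vmerge.
Qed.

End AdaptiveIsometry.

(** * Gaussian tails *)

Lemma measurable_sqr_gt {R : realType} (r : R) :
  measurable [set x : R | r ^+ 2 < x ^+ 2].
Proof.
rewrite (_ : [set x | _] = (fun x => x ^+ 2) @^-1` `](r ^+ 2), +oo[%classic).
  apply: (measurable_preimage (f := fun x : R => x ^+ 2)); last exact: measurable_itv.
  exact: (@exprn_measurable R setT 2).
by apply/seteqP; split => x /=; rewrite in_itv/= andbT.
Qed.

Section NormalTail.
Context {R : realType} (s : R) (s0 : 0 < s).
Local Open Scope ereal_scope.

(** On the event, exp(-x^2 / (2 s^2)) is at most exp(-3 r^2 / (8 s^2)) times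
    exp(-x^2 / (8 s^2)), the exponential of a normal density of scale 2 s; the
    normalizing constants differ by the factor 2. *)
Lemma normal_tail (r : R) : (0 <= r)%R ->
  normal_prob 0 s [set x | r ^+ 2 < x ^+ 2]%R
    <= (2 * expR (- (3 * r ^+ 2) / (8 * s ^+ 2)))%:E.
Proof.
move=> r0; set K := (2 * expR _)%R.
have sn0 : s != 0%R by rewrite gt_eqF.
have s2n0 : (2 * s)%R != 0%R by rewrite mulf_neq0.
have mS := measurable_sqr_gt r.
have K0 : (0 <= K)%R by rewrite mulr_ge0// expR_ge0.
apply: (@le_trans _ _ (\int[lebesgue_measure]_(x in [set x | r ^+ 2 < x ^+ 2]%R)
   (K%:E * (normal_pdf 0 (2 * s) x)%:E))).
  apply: ge0_le_integral => //=.
  - by move=> x _; rewrite lee_fin normal_pdf_ge0.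
  - apply/measurable_EFinP; apply: measurable_funTS; exact: measurable_normal_pdf.
  - apply: emeasurable_funM => //; apply/measurable_EFinP; apply: measurable_funTS.
    exact: measurable_normal_pdf.
  move=> x /= rx; rewrite -EFinM lee_fin !normal_pdf0E//.
  have -> : normal_peak s = (2 * normal_peak (2 * s))%R.
    rewrite /normal_peak.
    have -> : Num.sqrt ((2 * s) ^+ 2 * pi *+ 2) = (2 * Num.sqrt (s ^+ 2 * pi *+ 2))%R.
      rewrite -[in RHS](@gtr0_norm _ (2 : R))// -sqrtr_sqr -sqrtrM ?sqr_ge0//.
      by congr Num.sqrt; ring.
    by rewrite invfM mulrA divff ?mul1r.
  rewrite /K -!mulrA ler_pM2l// [leRHS]mulrCA ler_wpM2l//.
    exact: normal_peak_ge0.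
  rewrite -expRD ler_expR.
  have s20 : (0 < s ^+ 2)%R by rewrite exprn_gt0.
  rewrite -subr_ge0.
  have -> : (- (3 * r ^+ 2) / (8 * s ^+ 2) + - x ^+ 2 / ((2 * s) ^+ 2 *+ 2)
      - - x ^+ 2 / (s ^+ 2 *+ 2) = 3 * (x ^+ 2 - r ^+ 2) / (8 * s ^+ 2))%R.
    by field.
  by rewrite divr_ge0// mulr_ge0// ?subr_ge0 1?ltW.
rewrite ge0_integralZl_EFin//; first last.
- apply/measurable_EFinP; apply: measurable_funTS; exact: measurable_normal_pdf.
- by move=> x _; rewrite lee_fin normal_pdf_ge0.
rewrite -[leRHS]mule1 lee_wpmul2l ?lee_fin//.
exact: (@probability_le1 _ _ _ (normal_prob 0 (2 * s)) _ mS).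
Qed.

End NormalTail.

Section Reflection.
Context {R : realType} {p q : nat}.
Implicit Types u v w : 'M[R]_(p, q).

(** With w = 0 the quotient is 0 and the reflection is the identity, which is
    what reflection_send needs when u = v. *)
Definition reflection w v := v - (2 * mxdot w v / mxdot w w) *: w.

Lemma mxdotZr a u v : mxdot u (a *: v) = a * mxdot u v.
Proof.
rewrite /mxdot mulr_sumr; apply: eq_bigr => i _; rewrite mulr_sumr.
by apply: eq_bigr => j _; rewrite mxE; ring.
Qed.

Lemma mxdotZl a u v : mxdot (a *: u) v = a * mxdot u v.
Proof. by rewrite mxdotC mxdotZr mxdotC. Qed.

Lemma mxdotNr u v : mxdot u (- v) = - mxdot u v.
Proof. by rewrite -scaleN1r mxdotZr mulN1r. Qed.

Lemma mxdotNl u v : mxdot (- u) v = - mxdot u v.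
Proof. by rewrite -scaleN1r mxdotZl mulN1r. Qed.

Definition mxdotE := (@mxdotDl R p q, @mxdotDr R p q, mxdotNr, mxdotNl, mxdotZr, mxdotZl).

Lemma reflection_isometry w : linear_isometry (reflection w).
Proof.
split=> [a u v|v]; rewrite /reflection.
  by apply/matrixP => i j; rewrite !mxE mxdotDr mxdotZr; ring.
have [w0|w0] := eqVneq (mxdot w w) 0.
  by rewrite w0 invr0 mulr0 scale0r subr0.
rewrite !mxdotE (mxdotC v w); move: w0; set a := mxdot w w; set b := mxdot w v.
by move=> w0; field.
Qed.

Lemma reflection_send u v : mxdot u u = mxdot v v -> reflection (u - v) u = v.
Proof.
move=> uv; rewrite /reflection.
have [w0|w0] := eqVneq (mxdot (u - v) (u - v)) 0.
  have /subr0_eq -> := mxdot_eq0 w0.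
  by rewrite subrr scaler0 subr0.
have -> : 2 * mxdot (u - v) u = mxdot (u - v) (u - v).
  by rewrite !mxdotE -uv (mxdotC v u); ring.
by rewrite divff// scale1r subKr.
Qed.

End Reflection.

Section GaussianTail.
Context {R : realType} (s : R) (s0 : 0 < s) (p q : nat).
Notation gauss := (gaussian_mx s p q).

Lemma gaussian_entry i j (B : set R) : measurable B ->
  gauss [set c | B (c i j)] = normal_prob 0 s B.
Proof.
move=> mB; pose B1 i' j' := if (i' == i) && (j' == j) then B else setT.
have mB1 i' j' : measurable (B1 i' j') by rewrite /B1; case: ifP.
rewrite [X in _ X = _](_ : _ = mx_box B1); last first.
  apply/seteqP; split => [M MY i' j'|M /(_ i j)]; rewrite /B1.
    by case: ifP => // /andP[/eqP-> /eqP->].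
  by rewrite !eqxx.
rewrite gaussian_mx_box// (bigD1 (i, j))//= {1}/B1 !eqxx/= big1 ?mule1//.
move=> [i' j'] /=; rewrite xpair_eqE => /negbTE h.
by rewrite /B1 h probability_setT.
Qed.

(** A linear form of a Gaussian matrix is |a| times one entry in law: a reflection
    sends a to a multiple of a coordinate vector. *)
Lemma gaussian_tail (a : 'M[R]_(p, q)) (r : R) : 0 <= r ->
  (gauss [set c | r ^+ 2 * mxdot a a < mxdot a c ^+ 2]%R
   <= (2 * expR (- (3 * r ^+ 2) / (8 * s ^+ 2)))%:E)%E.
Proof.
move=> r0.
have [a0|a0] := eqVneq a 0.
  rewrite [X in (_ X <= _)%E](_ : _ = set0) ?measure0 ?lee_fin ?mulr_ge0 ?expR_ge0//.
  apply/seteqP; split => c //=; rewrite a0 -(scale0r 0) !(mxdotZl, mxdotZr) !mul0r.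
  by rewrite mulr0 expr0n/= ltxx.
have [i [j aij]] : exists i j, a i j != 0.
  apply/not_existsP => h; move/eqP: a0; apply; apply/matrixP => i j; rewrite mxE.
  by apply/eqP/negPn/negP => aij; apply: (h i); exists j.
have d0 : 0 < mxdot a a.
  by rewrite lt_neqAle mxdot_ge0 andbT eq_sym; apply: contra a0 => /eqP/mxdot_eq0 ->.
(* The entry (i, j) only has to exist, hence the case a = 0 apart. *)
pose b := Num.sqrt (mxdot a a) *: delta_mx i j : 'M[R]_(p, q).
have bb : mxdot a a = mxdot b b.
  by rewrite mxdotZl mxdotZr mxdot_delta mxE !eqxx mulr1 -expr2 sqr_sqrtr// ltW.
pose f := reflection (a - b).
have isof : linear_isometry f by exact: reflection_isometry.
rewrite [X in (_ X <= _)%E](_ : _ = f @^-1` [set c | [set x | r ^+ 2 < x ^+ 2] (c i j)]).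
  have mS := measurable_sqr_gt r.
  rewrite isometry_preserving ?gt_eqF//.
    by rewrite gaussian_entry// normal_tail.
  exact: (measurable_preimage (measurable_mx_entry i j)).
apply/seteqP; split => c /=;
  rewrite -(linear_isometry_dot a c isof) /f reflection_send// -/f mxdotC;
  by rewrite mxdotZr mxdot_delta exprMn sqr_sqrtr ?ltW// mulrC ltr_pM2l.
Qed.

End GaussianTail.

(** * Symmetric and antisymmetric parts of a noise matrix *)

Section SymmetricSplitting.
Context {R : realType} {n : nat}.
Implicit Types b c S K Z H M : 'M[R]_n.

(** symm and asym read one matrix b as a pair: a symmetric matrix S from the lower
    triangle, with diagonal enlarged by sqrt 2, and an antisymmetric matrix K from
    the upper triangle.  mix is the inverse map.  If b has independent entries
    N(0,1/n) then S has the law of W and K is independent of S. *)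
Definition symm b : 'M[R]_n := \matrix_(i, j)
  (if (j < i)%N then b i j else if (i < j)%N then b j i else Num.sqrt 2 * b i i).

Definition asym b : 'M[R]_n := \matrix_(i, j)
  (if (j < i)%N then - b j i else if (i < j)%N then b i j else 0).

Definition mix S K : 'M[R]_n := \matrix_(i, j)
  (if (j < i)%N then S i j else if (i < j)%N then K i j else S i i / Num.sqrt 2).

Lemma symm_sym b : (symm b)^T = symm b.
Proof.
apply/matrixP => i j; rewrite !mxE.
have [ij|ji|ij] := ltngtP i j => //.
by rewrite (val_inj ij).
Qed.

Lemma asym_anti b : (asym b)^T = - asym b.
Proof.
apply/matrixP => i j; rewrite !mxE.
by have [ij|ji|ij] := ltngtP i j; rewrite ?opprK// oppr0.
Qed.

Lemma mixK b : mix (symm b) (asym b) = b.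
Proof.
apply/matrixP => i j; rewrite !mxE ltnn.
have [ij|ji|ij] := ltngtP i j => //.
by rewrite (val_inj ij) mulrAC divff// mul1r.
Qed.

Lemma symm_mix S K : S^T = S -> symm (mix S K) = S.
Proof.
move=> ST; apply/matrixP => i j; rewrite !mxE ltnn.
have [ij|ji|ij] := ltngtP i j => //; first by rewrite -{1}ST mxE.
by rewrite (val_inj ij) mulrC divfK.
Qed.

Lemma asym_mix S K : K^T = - K -> asym (mix S K) = K.
Proof.
move=> KT; have KTE i j : K j i = - K i j.
  by have /matrixP/(_ i j) := KT; rewrite !mxE.
apply/matrixP => i j; rewrite !mxE.
have [ij|ji|ij] := ltngtP i j => //.
rewrite (val_inj ij); have := KTE j j => /eqP; rewrite -addr_eq0 -mulr2n mulrn_eq0/=.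
by move=> /eqP ->.
Qed.

Lemma mix_conj_sym b Z : (Z^T *m symm b *m Z)^T = Z^T *m symm b *m Z.
Proof. by rewrite !trmx_mul trmxK symm_sym mulmxA. Qed.

Lemma mix_conj_anti b Z : (Z^T *m asym b *m Z)^T = - (Z^T *m asym b *m Z).
Proof. by rewrite !trmx_mul trmxK asym_anti mulNmx mulmxN mulmxA. Qed.

(** Changes the orthonormal basis to the columns of Z in both parts at once. *)
Definition rot Z b := mix (Z^T *m symm b *m Z) (Z^T *m asym b *m Z).

Lemma rot_symm Z b : symm (rot Z b) = Z^T *m symm b *m Z.
Proof. by rewrite symm_mix// mix_conj_sym. Qed.

Lemma rot_asym Z b : asym (rot Z b) = Z^T *m asym b *m Z.
Proof. by rewrite asym_mix// mix_conj_anti. Qed.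

Lemma rot_comp Z Z' b : rot Z' (rot Z b) = rot (Z *m Z') b.
Proof. by rewrite /rot rot_symm rot_asym !trmx_mul !mulmxA. Qed.

Lemma rot1 b : rot 1%:M b = b.
Proof. by rewrite /rot trmx1 !mul1mx !mulmx1 mixK. Qed.

(** Column j of lift_rot Z b is the vector whose coordinates in the basis z given
    by Z are <z_i, S z_j> for i > j, <z_j, S z_j> / sqrt 2 for i = j, and
    <z_i, K z_j> for i < j. *)
Definition lift_rot Z b := Z *m rot Z b.
Definition unlift_rot Z c := rot Z^T (Z^T *m c).

Definition orthogonal_mx Z := Z^T *m Z = 1%:M.

Lemma orthogonal_mxC Z : orthogonal_mx Z -> Z *m Z^T = 1%:M.
Proof. exact: mulmx1C. Qed.

Lemma orthogonal_mx_tr Z : orthogonal_mx Z -> orthogonal_mx Z^T.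
Proof. by move=> oZ; rewrite /orthogonal_mx trmxK orthogonal_mxC. Qed.

Lemma orthogonal_mxM Z Z' : orthogonal_mx Z -> orthogonal_mx Z' ->
  orthogonal_mx (Z *m Z').
Proof.
by move=> oZ oZ'; rewrite /orthogonal_mx trmx_mul mulmxA -(mulmxA Z'^T) oZ mulmx1.
Qed.

Lemma lift_rotK Z : orthogonal_mx Z -> cancel (lift_rot Z) (unlift_rot Z).
Proof.
move=> oZ b; rewrite /unlift_rot /lift_rot mulmxA oZ mul1mx rot_comp.
by rewrite orthogonal_mxC// rot1.
Qed.

Lemma unlift_rotK Z : orthogonal_mx Z -> cancel (unlift_rot Z) (lift_rot Z).
Proof.
move=> oZ b; rewrite /unlift_rot /lift_rot rot_comp oZ rot1 mulmxA.
by rewrite orthogonal_mxC// mul1mx.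
Qed.

Lemma mxdot_tr (p q : nat) (u v : 'M[R]_(p, q)) : mxdot u v = \tr (u^T *m v).
Proof.
rewrite /mxdot exchange_big; apply: eq_bigr => j _; rewrite mxE.
by apply: eq_bigr => i _; rewrite mxE.
Qed.

Lemma mxdot_mull (q : nat) Z (u v : 'M[R]_(n, q)) : orthogonal_mx Z ->
  mxdot (Z *m u) (Z *m v) = mxdot u v.
Proof. by move=> oZ; rewrite !mxdot_tr trmx_mul mulmxA -(mulmxA u^T) oZ mulmx1. Qed.

Lemma mxdot_conj Z M : orthogonal_mx Z ->
  mxdot (Z^T *m M *m Z) (Z^T *m M *m Z) = mxdot M M.
Proof.
move=> oZ; rewrite -mulmxA mxdot_mull; last exact: orthogonal_mx_tr.
by rewrite !mxdot_tr trmx_mul !mulmxA mxtrace_mulC !mulmxA orthogonal_mxC// mul1mx.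
Qed.

(** Entry by entry: the (i, j) entries of symm b and asym b have squares adding up
    to b_ij^2 + b_ji^2, on the diagonal thanks to the factor sqrt 2. *)
Lemma mxdot_symm_asym b :
  mxdot (symm b) (symm b) + mxdot (asym b) (asym b) = 2 * mxdot b b.
Proof.
have E : mxdot b b = \sum_i \sum_j b j i * b j i by rewrite /mxdot exchange_big.
rewrite mulrDl mul1r {2}E /mxdot -!big_split/=.
apply: eq_bigr => i _; rewrite -!big_split/=; apply: eq_bigr => j _; rewrite !mxE.
have [ij|ji|ij] := ltngtP i j; [ring|ring|].
rewrite (val_inj ij) mul0r addr0 mulrACA -expr2 sqr_sqrtr//; ring.
Qed.

Lemma mxdot_rot Z b : orthogonal_mx Z -> mxdot (rot Z b) (rot Z b) = mxdot b b.
Proof.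
move=> oZ; apply: (@mulfI _ 2) => //.
by rewrite -!mxdot_symm_asym rot_symm rot_asym !mxdot_conj.
Qed.

Lemma symm_linear : linear symm.
Proof.
move=> a u v; apply/matrixP => i j; rewrite !mxE.
by case: ifP => _; last case: ifP => _; ring.
Qed.

Lemma asym_linear : linear asym.
Proof.
move=> a u v; apply/matrixP => i j; rewrite !mxE.
by case: ifP => _; last case: ifP => _; ring.
Qed.

Lemma mix_linear a S K S' K' :
  mix (a *: S + S') (a *: K + K') = a *: mix S K + mix S' K'.
Proof.
apply/matrixP => i j; rewrite !mxE.
by case: ifP => _; last case: ifP => _; ring.
Qed.

Lemma rot_linear Z : linear (rot Z).
Proof.
move=> a u v; rewrite /rot symm_linear asym_linear -mix_linear.
by rewrite !mulmxDr !mulmxDl -!scalemxAr -!scalemxAl.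
Qed.

Lemma rot_isometry Z : orthogonal_mx Z -> linear_isometry (rot Z).
Proof. by move=> oZ; split=> [|v]; [exact: rot_linear|exact: mxdot_rot]. Qed.

Lemma mull_isometry q Z : orthogonal_mx Z ->
  linear_isometry (fun u : 'M[R]_(n, q) => Z *m u).
Proof.
move=> oZ; split=> [a u v|v]; last exact: mxdot_mull.
by rewrite mulmxDr -scalemxAr.
Qed.

Lemma lift_rot_isometry Z : orthogonal_mx Z -> linear_isometry (lift_rot Z).
Proof. by move=> oZ; exact: linear_isometry_comp (mull_isometry _ oZ) (rot_isometry oZ). Qed.

Lemma unlift_rot_isometry Z : orthogonal_mx Z -> linear_isometry (unlift_rot Z).
Proof.
move=> oZ; have oZT := orthogonal_mx_tr oZ.
exact: linear_isometry_comp (rot_isometry oZT) (mull_isometry _ oZT).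
Qed.

(** Block diagonal with an identity block of size k. *)
Definition trivial_below (k : nat) H :=
  forall i l : 'I_n, (i < k)%N || (l < k)%N -> H i l = (i == l)%:R.

Lemma trivial_below_mull k H (q : nat) (M : 'M[R]_(n, q)) (i : 'I_n) j :
  trivial_below k H -> (i < k)%N -> (H *m M) i j = M i j.
Proof.
move=> tH ik; rewrite mxE (bigD1 i)//= tH ?ik// eqxx mul1r big1 ?addr0// => l li.
by rewrite tH ?ik// eq_sym (negbTE li) mul0r.
Qed.

Lemma trivial_below_mulr k H (q : nat) (M : 'M[R]_(q, n)) i (j : 'I_n) :
  trivial_below k H -> (j < k)%N -> (M *m H) i j = M i j.
Proof.
move=> tH ik; rewrite mxE (bigD1 j)//= tH ?ik ?orbT// eqxx mulr1 big1 ?addr0// => l li.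
by rewrite tH ?ik ?orbT// (negbTE li) mulr0.
Qed.

Lemma trivial_below_tr k H : trivial_below k H -> trivial_below k H^T.
Proof. by move=> tH i l il; rewrite mxE tH 1?orbC// eq_sym. Qed.

(** Column j of lift_rot Z b involves only z_1, ..., z_j: below the diagonal it is
    the component of S z_j orthogonal to them, whatever basis of their orthogonal
    complement completes Z.  Hence changing the last columns of Z leaves it
    alone. *)
Lemma lift_rot_stable k Z H b (i j : 'I_n) : orthogonal_mx H -> trivial_below k H ->
  (j < k)%N -> lift_rot (Z *m H) b i j = lift_rot Z b i j.
Proof.
move=> oH tH jk; rewrite /lift_rot -(rot_comp Z H) -mulmxA.
rewrite 2!mxE; apply: eq_bigr => a _; congr (_ * _).
set M := rot Z b.
have tHT := trivial_below_tr tH.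
have rotE l : rot H M l j = if (j < l)%N then (H^T *m symm M) l j else M l j.
  rewrite mxE; have [lj|jl|lj] := ltngtP l j.
  - rewrite (trivial_below_mulr _ _ tH)// (trivial_below_mull _ _ tHT) ?(ltn_trans lj)//.
    by rewrite /M /rot mxE ltnNge (ltnW lj)/= lj -rot_asym.
  - by rewrite (trivial_below_mulr _ _ tH).
  - rewrite (val_inj lj) (trivial_below_mulr _ _ tH)// (trivial_below_mull _ _ tHT)//.
    by rewrite mxE ltnn mulrAC divff// mul1r.
have [ja|aj] := ltnP j a; last first.
  have ak : (a < k)%N by apply: leq_ltn_trans jk.
  by rewrite (trivial_below_mull _ _ tH)// rotE ltnNge aj.
transitivity ((H *m (H^T *m symm M)) a j).
  rewrite 2!mxE; apply: eq_bigr => l _; rewrite rotE.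
  case: ltnP => // lj; rewrite tH ?(leq_ltn_trans lj) ?orbT//.
  by rewrite (_ : (a == l) = false) ?mul0r// -val_eqE/= gtn_eqF// (leq_ltn_trans lj).
by rewrite mulmxA orthogonal_mxC// mul1mx mxE ja.
Qed.

Lemma symm_unlift_col Z c (j : 'I_n) : orthogonal_mx Z ->
  symm (unlift_rot Z c) *m col j Z = Z *m col j (symm (Z^T *m c)).
Proof.
move=> oZ; rewrite rot_symm trmxK -!mulmxA colE; congr (_ *m _).
by rewrite (mulmxA Z^T) oZ mul1mx -colE.
Qed.

Lemma col_symm_local c c' (j : 'I_n) :
  (forall i l : 'I_n, (l <= j)%N -> c i l = c' i l) -> col j (symm c) = col j (symm c').
Proof.
move=> cc'; apply/colP => i; rewrite !mxE.
have [ij|ji|ij] := ltngtP i j; rewrite ?cc'//; first exact: ltnW.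
by rewrite ij.
Qed.

(** The products S z_j can be read off the first j columns of lift_rot: the entries
    of S in column j below the diagonal come from column j, and those above it,
    by symmetry, from the earlier columns. *)
Lemma symm_unlift_local Z c c' (j : 'I_n) : orthogonal_mx Z ->
  (forall i l : 'I_n, (l <= j)%N -> c i l = c' i l) ->
  symm (unlift_rot Z c) *m col j Z = symm (unlift_rot Z c') *m col j Z.
Proof.
move=> oZ cc'; rewrite !symm_unlift_col//; congr (_ *m _).
apply: col_symm_local => i l lj; rewrite !mxE.
by apply: eq_bigr => a _; rewrite cc'.
Qed.

End SymmetricSplitting.

(** * Orthonormal bases by Householder reflections *)

Section Householder.
Context {R : realType} {n : nat}.
Implicit Types (u v x : 'cV[R]_n) (Z : 'M[R]_n).

Definition tail_col (k : nat) u : 'cV[R]_n :=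
  \col_i (if (i < k)%N then 0 else u i 0).

Definition unit_col (k : nat) : 'cV[R]_n := \col_i (i == k :> nat)%:R.

(** The reflection along this direction keeps the first k coordinates of u and
    turns the rest into a multiple of the next coordinate vector.  Unlike a
    normalized Gram-Schmidt step it makes sense, and is measurable, also when the
    rest vanishes: the direction is then 0 and the reflection is the identity. *)
Definition householder_dir k u : 'cV[R]_n :=
  tail_col k u - Num.sqrt (mxdot (tail_col k u) (tail_col k u)) *: unit_col k.

Definition householder k u : 'M[R]_n :=
  let v := householder_dir k u in 1%:M - (2 / mxdot v v) *: (v *m v^T).

Lemma mul_col_row v x : v *m v^T *m x = mxdot v x *: v.
Proof.
rewrite -mulmxA [v^T *m x]mx11_scalar mul_mx_scalar; congr (_ *: _).
by rewrite mxdot_tr trace_mx11.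
Qed.

Lemma householderE k u x :
  householder k u *m x = reflection (householder_dir k u) x.
Proof.
rewrite /householder mulmxBl mul1mx -scalemxAl mul_col_row scalerA.
by rewrite /reflection mulrAC.
Qed.

Lemma householder_tr k u : (householder k u)^T = householder k u.
Proof. by rewrite /householder linearB/= trmx1 linearZ/= trmx_mul trmxK. Qed.

Lemma householder_orthogonal k u : orthogonal_mx (householder k u).
Proof.
have iso := reflection_isometry (householder_dir k u).
set H := householder k u; apply/matrixP => i j.
have -> : (H^T *m H) i j = mxdot (col i H) (col j H).
  by rewrite mxE; apply: eq_bigr => l _; rewrite big_ord1 !mxE.
by rewrite !colE !householderE linear_isometry_dot// mxdot_delta !mxE eqxx andbT eq_sym.
Qed.

Lemma householder_trivial k u : trivial_below k (householder k u).
Proof.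
move=> i l il; rewrite !mxE big_ord1 !mxE.
have tr0 (a : 'I_n) : (a < k)%N ->
    (if (a < k)%N then 0 else u a 0) -
    Num.sqrt (mxdot (tail_col k u) (tail_col k u)) * (a == k :> nat)%:R = 0.
  by move=> ak; rewrite ak ltn_eqF// mulr0 subr0.
by case/orP: il => /tr0 ->; rewrite ?mul0r !mulr0 subr0.
Qed.

Lemma householder_zero k u (i : 'I_n) : (k < i)%N -> (householder k u *m u) i 0 = 0.
Proof.
move=> ki; have kn := ltn_trans ki (ltn_ord i).
set r := tail_col k u; pose w := Num.sqrt (mxdot r r) *: unit_col k.
have uE : u = (u - r) + r by rewrite subrK.
have e1 : mxdot (unit_col k) (unit_col k) = 1 :> R.
  have -> : unit_col k = delta_mx (Ordinal kn) 0.
    by apply/colP => j; rewrite !mxE eqxx andbT -val_eqE.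
  by rewrite mxdot_delta mxE !eqxx.
have rw : mxdot r r = mxdot w w.
  by rewrite mxdotZl mxdotZr e1 mulr1 -expr2 sqr_sqrtr// mxdot_ge0.
have d0 : mxdot (householder_dir k u) (u - r) = 0.
  apply: big1 => j _; apply: big1 => l _; rewrite !mxE (ord1 l).
  by case: ltnP => // jk; rewrite ?subrr ?mulr0// ltn_eqF// mulr0 subr0 mul0r.
rewrite {2}uE mulmxDr !householderE {1}/reflection d0 mulr0 mul0r scale0r subr0.
rewrite /householder_dir -/r -/w reflection_send// !mxE.
by rewrite gtn_eqF// mulr0 addr0 ltnNge (ltnW ki)/= subrr.
Qed.

(** The columns of basis y k are an orthonormal basis of the whole space; the first
    k of them play the role of the Gram-Schmidt vectors of y 0, ..., y k.-1. *)
Fixpoint basis (y : nat -> 'cV[R]_n) (k : nat) : 'M[R]_n :=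
  if k is j.+1 then
    let Z := basis y j in Z *m householder j (Z^T *m y j)
  else 1%:M.

Lemma orthogonal_mx1 : orthogonal_mx (1%:M : 'M[R]_n).
Proof. by rewrite /orthogonal_mx trmx1 mul1mx. Qed.

Lemma basis_orthogonal y k : orthogonal_mx (basis y k).
Proof.
elim: k => [|k IH] /=; first exact: orthogonal_mx1.
exact: orthogonal_mxM IH (householder_orthogonal _ _).
Qed.

Lemma basis_col y k m (i j : 'I_n) : (j < k)%N -> (k <= m)%N ->
  basis y m i j = basis y k i j.
Proof.
move=> jk /subnK <-; elim: (m - k)%N => [//|d IH].
rewrite addSn /= (trivial_below_mulr _ _ (@householder_trivial _ _))//.
by rewrite (leq_trans jk)// leq_addl.
Qed.

(** Each reflection is built to place y i in the span of the first i + 1 columns,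
    and the later ones fix these columns. *)
Lemma basis_span y k i (j : 'I_n) : (i < k)%N -> (i < j)%N ->
  ((basis y k)^T *m y i) j 0 = 0.
Proof.
move=> ik; rewrite -(subnK ik); elim: (k - i.+1)%N j => [|d IH] j ij.
  rewrite add0n /= trmx_mul -mulmxA householder_tr.
  exact: householder_zero.
rewrite addSn /= trmx_mul -mulmxA householder_tr.
have [jd|dj] := ltnP j (d + i.+1).
  by rewrite (trivial_below_mull _ _ (@householder_trivial _ _))// IH.
rewrite mxE big1// => l _.
have [il|li] := ltnP i l; first by rewrite IH// mulr0.
rewrite householder_trivial.
  by rewrite (_ : (j == l) = false) ?mul0r// -val_eqE/= gtn_eqF// (leq_ltn_trans li).
by rewrite (leq_ltn_trans li) ?orbT// addnS ltnS leq_addl.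
Qed.

Lemma basis_spanE y k i : (i < k)%N ->
  y i = \sum_(j : 'I_n | (j <= i)%N) ((basis y k)^T *m y i) j 0 *: col j (basis y k).
Proof.
move=> ik; have oZ := basis_orthogonal y k; set Z := basis y k in oZ *.
rewrite -{1}[y i]mul1mx -(orthogonal_mxC oZ) -mulmxA.
apply/colP => a; rewrite mxE summxE [RHS]big_mkcond; apply: eq_bigr => j _ /=.
by case: leqP => ij; [rewrite !mxE mulrC|rewrite basis_span// mulr0].
Qed.

End Householder.

(** * The iteration as a function of the initial vector and the noise *)

Section CanonicalAMP.
Context {R : realType} {n : nat} (lambda : R) (vstar : 'cV[R]_n) (eta : nat -> R -> R).
Implicit Types (W b c : 'M[R]_n) (x : 'cV[R]_n).

(** The pair (eta_t(x_t), x_{t+1}); it starts at (0, x_1), where the zero stands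
    for eta_0(x_0). *)
Fixpoint amp_state W x (t : nat) : 'cV[R]_n * 'cV[R]_n :=
  if t is s.+1 then
    let p := amp_state W x s in
    let y := map_mx (eta s.+1) p.2 in
    (y, spiked lambda vstar W *m y
        - avgv (map_mx (Defs.deriv0 (eta s.+1)) p.2) *: p.1)
  else (0, x).

Definition amp_dir W x (k : nat) : 'cV[R]_n := map_mx (eta k.+1) (amp_state W x k).2.

(** The iteration applies the noise only to vectors in the span of the basis
    columns found so far. *)
Lemma amp_state_local W W' x k :
  (forall j : 'I_n, (j < k)%N ->
    W *m col j (basis (amp_dir W x) k) = W' *m col j (basis (amp_dir W x) k)) ->
  forall i, (i <= k)%N -> amp_state W' x i = amp_state W x i.
Proof.
move=> WW'; elim=> [//|i IH] ik /=; rewrite IH ?(ltnW ik)//.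
have -> // : spiked lambda vstar W' *m map_mx (eta i.+1) (amp_state W x i).2 =
  spiked lambda vstar W *m map_mx (eta i.+1) (amp_state W x i).2.
rewrite /spiked !mulmxDl; congr (_ + _).
rewrite -/(amp_dir W x i) (basis_spanE (amp_dir W x) ik) !mulmx_sumr.
apply: eq_bigr => j ji; rewrite -!scalemxAr WW'//.
exact: leq_ltn_trans ji ik.
Qed.

Lemma amp_dir_local W W' x k :
  (forall j : 'I_n, (j < k)%N ->
    W *m col j (basis (amp_dir W x) k) = W' *m col j (basis (amp_dir W x) k)) ->
  forall i, (i <= k)%N -> amp_dir W' x i = amp_dir W x i.
Proof. by move=> WW' i ik; rewrite /amp_dir (amp_state_local WW'). Qed.

Definition amp_basis x b k := basis (amp_dir (symm b) x) k.

(** Its columns of index less than k (counted from 0) are phi_1, ..., phi_k; the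
    others are provisional and will change when further directions come in. *)
Definition amp_phi (k : nat) x b := lift_rot (amp_basis x b k) b.

Definition trunc_cols (k : nat) c : 'M[R]_n :=
  \matrix_(i, j) (if (j < k)%N then c i j else 0).

(** The same basis recovered from the matrix c of the phi_k instead of the noise:
    to find the next direction, undo lift_rot on the columns known so far, filled
    up with zeros, and run the iteration on the resulting noise.  That noise is
    not the true one but agrees with it on the directions already used. *)
Fixpoint rebuilt_basis x c (k : nat) : 'M[R]_n :=
  if k is j.+1 then
    let Z := rebuilt_basis x c j in
    Z *m householder j
      (Z^T *m amp_dir (symm (unlift_rot Z (trunc_cols j c))) x j)
  else 1%:M.

Lemma rebuilt_basis_orthogonal x c k : orthogonal_mx (rebuilt_basis x c k).
Proof.
elim: k => [|k IH] /=; first exact: orthogonal_mx1.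
exact: orthogonal_mxM IH (householder_orthogonal _ _).
Qed.

Lemma rebuilt_basis_local x c c' k :
  (forall (i j : 'I_n), (j.+1 < k)%N -> c i j = c' i j) ->
  rebuilt_basis x c k = rebuilt_basis x c' k.
Proof.
elim: k => [//|k IH] cc'; rewrite /= IH; last first.
  by move=> i j jk; apply: cc'; exact: ltn_trans jk _.
rewrite (_ : trunc_cols k c = trunc_cols k c')//.
by apply/matrixP => i j; rewrite !mxE; case: ifP => // jk; rewrite cc'.
Qed.

Lemma amp_phi_col x b k m (i j : 'I_n) : (j < k)%N -> (k <= m)%N ->
  amp_phi m x b i j = amp_phi k x b i j.
Proof.
move=> jk /subnK <-; elim: (m - k)%N => [//|d IH].
rewrite addSn -IH /amp_phi /amp_basis /=.
apply: lift_rot_stable (householder_orthogonal _ _) (@householder_trivial _ _ _ _) _.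
by rewrite (leq_trans jk)// leq_addl.
Qed.

Lemma rebuilt_basisE x b m k : (k <= m)%N ->
  rebuilt_basis x (amp_phi m x b) k = amp_basis x b k.
Proof.
elim: k => [//|k IH] km; rewrite /= IH; last exact: ltnW.
rewrite /amp_basis/= -/(amp_basis x b k); congr (_ *m householder _ (_ *m _)).
apply: (amp_dir_local (k := k)) => // j jk.
rewrite -/(amp_basis x b k).
have oZ : orthogonal_mx (amp_basis x b k) := basis_orthogonal _ _.
rewrite (@symm_unlift_local _ _ _ _ (amp_phi k x b)) ?lift_rotK//.
move=> i l lj; rewrite mxE (leq_ltn_trans lj jk).
by rewrite (@amp_phi_col _ _ k)// ?(ltnW km)// (leq_ltn_trans lj).
Qed.

(** The change from k to k + 1 directions, with c the matrix that determines the
    isometry and c0 the matrix it acts on.  The two are separate arguments because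
    the invariance of the Gaussian law needs linearity in c0 for fixed c. *)
Definition phi_step (k : nat) x c c0 :=
  lift_rot (rebuilt_basis x c k.+1) (unlift_rot (rebuilt_basis x c k) c0).

Lemma amp_phi0 x b : amp_phi 0 x b = b.
Proof. by rewrite /amp_phi /amp_basis /= /lift_rot rot1 mul1mx. Qed.

Lemma amp_phiS k x b :
  amp_phi k.+1 x b = phi_step k x (amp_phi k x b) (amp_phi k x b).
Proof.
have e : rebuilt_basis x (amp_phi k x b) k.+1 = amp_basis x b k.+1.
  rewrite -(rebuilt_basisE x b (leqnn k.+1)).
  apply: rebuilt_basis_local => i j; rewrite ltnS => jk.
  by apply/esym/amp_phi_col.
rewrite /phi_step e (rebuilt_basisE x b (leqnn k)).
have -> : unlift_rot (amp_basis x b k) (amp_phi k x b) = b.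
  exact: (lift_rotK (basis_orthogonal _ _)).
exact: erefl.
Qed.

Lemma phi_step_isometry k x c : linear_isometry (phi_step k x c).
Proof.
exact: linear_isometry_comp (lift_rot_isometry (rebuilt_basis_orthogonal _ _ _))
  (unlift_rot_isometry (rebuilt_basis_orthogonal _ _ _)).
Qed.

Lemma phi_step_local k x c c' :
  (forall i j : 'I_n, (j < k)%N -> c i j = c' i j) ->
  phi_step k x c = phi_step k x c'.
Proof.
move=> cc'; rewrite /phi_step (@rebuilt_basis_local x c c' k.+1); last exact: cc'.
rewrite (@rebuilt_basis_local x c c' k) => [//|i j jk].
by apply: cc'; exact: ltn_trans jk.
Qed.

Lemma phi_step_fix k x c c0 (i j : 'I_n) : (j < k)%N ->
  phi_step k x c c0 i j = c0 i j.
Proof.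
move=> jk; rewrite /phi_step /=.
rewrite (lift_rot_stable _ _ _ (householder_orthogonal _ _) (@householder_trivial _ _ _ _))//.
by rewrite unlift_rotK//; exact: rebuilt_basis_orthogonal.
Qed.

(** Replaces column m by its coordinates in the basis that earlier columns
    determine. *)
Definition coord_step (m : nat) x c c0 : 'M[R]_n :=
  \matrix_(i, j) (if j == m :> nat then ((rebuilt_basis x c m.+1)^T *m c0) i j else c0 i j).

Lemma coord_stepE m x c c0 (i j : 'I_n) :
  coord_step m x c c0 i j =
  if j == m :> nat then ((rebuilt_basis x c m.+1)^T *m c0) i j else c0 i j.
Proof. by rewrite [LHS]mxE. Qed.

Lemma coord_step_isometry m x c : linear_isometry (coord_step m x c).
Proof.
have oZ := orthogonal_mx_tr (rebuilt_basis_orthogonal x c m.+1).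
split=> [a u v|v].
  rewrite /coord_step mulmxDr -scalemxAr.
  apply/matrixP => i j; move: (_ *m u) (_ *m v) => M1 M2; rewrite !mxE.
  by case: ifP.
rewrite /mxdot exchange_big [RHS]exchange_big; apply: eq_bigr => j _ /=.
have [jm|jm] := boolP (j == m :> nat); last first.
  by apply: eq_bigr => i _; rewrite !mxE (negbTE jm).
have colsq (a : 'M[R]_n) : mxdot (col j a) (col j a) = \sum_i a i j * a i j.
  by apply: eq_bigr => i _; rewrite big_ord1 !mxE.
rewrite -[RHS]colsq -(mxdot_mull (col j v) (col j v) oZ).
rewrite (_ : _ *m col j v = col j ((rebuilt_basis x c m.+1)^T *m v)); last first.
  by rewrite !colE mulmxA.
by rewrite colsq; apply: eq_bigr => i _; rewrite mxE jm.
Qed.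

Lemma coord_step_local m x c c' :
  (forall i j : 'I_n, (j != m :> nat) -> c i j = c' i j) ->
  coord_step m x c = coord_step m x c'.
Proof.
move=> cc'; have e : rebuilt_basis x c m.+1 = rebuilt_basis x c' m.+1.
  apply: rebuilt_basis_local => i j; rewrite ltnS => jm.
  by apply: cc'; rewrite ltn_eqF.
by rewrite /coord_step e.
Qed.

Lemma coord_step_fix m x c c0 (i j : 'I_n) : j != m :> nat ->
  coord_step m x c c0 i j = c0 i j.
Proof. by move=> /negbTE jm; rewrite coord_stepE jm. Qed.

(** The columns of index at least m have been replaced.  Going from the last column
    to the first keeps available, at each step, the earlier columns from which the
    basis is rebuilt. *)
Definition amp_coord_from (m : nat) x c : 'M[R]_n :=
  \matrix_(i, j) (if (m <= j)%N then ((rebuilt_basis x c j.+1)^T *m c) i j else c i j).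

Lemma mulmx_eq_col (p q r : nat) (A : 'M[R]_(p, q)) (B B' : 'M[R]_(q, r)) i j :
  (forall l, B l j = B' l j) -> (A *m B) i j = (A *m B') i j.
Proof. by move=> BB'; rewrite !mxE; apply: eq_bigr => l _; rewrite BB'. Qed.

Lemma amp_coord_fromE m x c (i j : 'I_n) :
  amp_coord_from m x c i j =
  if (m <= j)%N then ((rebuilt_basis x c j.+1)^T *m c) i j else c i j.
Proof. by rewrite [LHS]mxE. Qed.

Lemma amp_coord_fromS m x c :
  amp_coord_from m x c =
  coord_step m x (amp_coord_from m.+1 x c) (amp_coord_from m.+1 x c).
Proof.
set d := amp_coord_from m.+1 x c.
have h (i j : 'I_n) : (j <= m)%N -> d i j = c i j.
  by move=> jm; rewrite amp_coord_fromE ltnNge jm.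
have e : rebuilt_basis x d m.+1 = rebuilt_basis x c m.+1.
  by apply: rebuilt_basis_local => i j; rewrite ltnS => /ltnW; exact: h.
apply/matrixP => i j; rewrite amp_coord_fromE /coord_step e [RHS]mxE.
have [mj|jm|mj] := ltngtP m j.
- by rewrite amp_coord_fromE mj.
- exact/esym/h/ltnW.
- rewrite -mj; apply: mulmx_eq_col => l.
  by apply/esym/h; rewrite -mj.
Qed.

Definition amp_coord x c := amp_coord_from 0 x c.

(** Column k is expanded in the basis with k + 1 directions, not in the final one;
    the two bases share the vectors of index i <= k, so only these entries are the
    inner products <z_i, phi_k>. *)
Lemma amp_coordE x b (i k : 'I_n) : (i <= k)%N ->
  amp_coord x (amp_phi n x b) i k = ((amp_basis x b n)^T *m amp_phi n x b) i k.
Proof.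
move=> ik; rewrite amp_coord_fromE leq0n (rebuilt_basisE _ _ (ltn_ord k)).
have e l : amp_basis x b k.+1 l i = amp_basis x b n l i.
  exact/esym/(basis_col _ _ (_ : i < k.+1)%N (ltn_ord k)).
move: (amp_basis x b k.+1) (amp_basis x b n) e (amp_phi n x b) => Z Z' e c.
by rewrite !mxE; apply: eq_bigr => l _; rewrite !mxE e.
Qed.

End CanonicalAMP.

(** * Measurability *)

Section MeasurableReal.
Context {R : realType}.
Implicit Type f : R -> R.

Lemma finite_closed (F : set R) : finite_set F -> closed F.
Proof.
by move=> fF; apply: (accessible_finite_set_closed.1 _ _ fF);
  apply: hausdorff_accessible; exact: Rhausdorff.
Qed.

Lemma finite_measurable (F : set R) : finite_set F -> measurable F.
Proof. by move=> fF; exact: (closed_measurable (finite_closed fF)). Qed.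

Lemma measurable_off_finite (F : set R) f : finite_set F ->
  measurable_fun (~` F) f -> measurable_fun setT f.
Proof.
move=> fF mf; have mF := finite_measurable fF.
rewrite -(setUv F); apply/measurable_funU => //; first exact: measurableC.
split=> // _ Y mY; apply: finite_measurable.
by apply: sub_finite_set fF; exact: subIsetl.
Qed.

Lemma continuous_off_finite (F : set R) f : finite_set F ->
  (forall x, ~ F x -> {for x, continuous f}) -> measurable_fun setT f.
Proof.
move=> fF cf; apply: (measurable_off_finite fF).
apply: open_continuous_measurable_fun.
  by apply: closed_openC; exact: finite_closed.
by move=> x; rewrite inE => Fx; exact: cf.
Qed.

Lemma measurable_inv : measurable_fun setT (@GRing.inv R).
Proof.
apply: (@continuous_off_finite [set 0]); first exact: finite_set1.
by move=> x /= /eqP x0; exact: inv_continuous.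
Qed.

Lemma measurable_sqrt : measurable_fun setT (@Num.sqrt R).
Proof. by apply: continuous_measurable_fun; exact: sqrt_continuous. Qed.

Lemma measurable_denoiser f : differentiable_but_finitely f -> measurable_fun setT f.
Proof.
move=> df; apply: (continuous_off_finite df) => x /contrapT dfx.
exact/differentiable_continuous/derivable1_diffP.
Qed.

Lemma cvg_harmonic_dnbhs : (@harmonic R) @ \oo --> 0^'.
Proof.
move=> A; rewrite /dnbhs /within/= => A0.
have h : \forall n \near \oo, (@harmonic R) n != 0 -> A ((@harmonic R) n).
  exact: (@cvg_harmonic R _ A0).
change (\forall n \near \oo, A ((@harmonic R) n)).
by apply: filterS h => n; apply; rewrite gt_eqF// invr_gt0 ltr0n.
Qed.

(** Off a finite set the derivative is the pointwise limit of the difference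
    quotients with steps 1, 1/2, 1/3, ... *)
Lemma measurable_deriv0 f : differentiable_but_finitely f ->
  measurable_fun setT (Defs.deriv0 f).
Proof.
move=> df; apply: (measurable_off_finite df).
have mf := measurable_denoiser df.
pose h (m : nat) (x : R) : R := (harmonic m)^-1 * (f (harmonic m + x) - f x).
apply: (@measurable_fun_cvg _ _ R _ h).
  move=> m; apply: measurable_funTS; apply: measurable_funM => //.
  apply: measurable_funB => //.
  by apply: (measurableT_comp mf); exact: measurable_funD.
move=> x /= /contrapT dfx; rewrite /Defs.deriv0 (asboolT dfx).
have : (fun h => h^-1 *: (f (h + x) - f x)) @ 0^' --> derive1 f x.
  rewrite /derive1; move: dfx; rewrite /derivable.
  set d := (fun _ : R => _); set d' := (fun _ : R => _) => dfx.
  suff <- : d = d' by [].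
  by rewrite funeqE => r; rewrite /d /d' /= [r%:A]mulr1.
by move=> cf; exact: (cvg_comp _ _ cvg_harmonic_dnbhs cf).
Qed.

End MeasurableReal.

Section MeasurableMatrix.
Context {R : realType} {d} {T : measurableType d}.

Lemma measurable_entry p q (f : T -> 'M[R]_(p, q)) i j :
  measurable_fun setT f -> measurable_fun setT (fun x => f x i j).
Proof. by move=> mf; move: i j; apply/measurable_mxP. Qed.

Lemma measurable_addmx p q (f g : T -> 'M[R]_(p, q)) :
  measurable_fun setT f -> measurable_fun setT g ->
  measurable_fun setT (fun x => f x + g x).
Proof.
move=> mf mg; apply/measurable_mxP => i j; under eq_fun do rewrite mxE.
by apply: measurable_funD; exact: measurable_entry.
Qed.

Lemma measurable_oppmx p q (f : T -> 'M[R]_(p, q)) :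
  measurable_fun setT f -> measurable_fun setT (fun x => - f x).
Proof.
move=> mf; apply/measurable_mxP => i j; under eq_fun do rewrite mxE.
by apply: measurable_funN; exact: measurable_entry.
Qed.

Lemma measurable_submx p q (f g : T -> 'M[R]_(p, q)) :
  measurable_fun setT f -> measurable_fun setT g ->
  measurable_fun setT (fun x => f x - g x).
Proof. by move=> mf mg; apply: measurable_addmx => //; exact: measurable_oppmx. Qed.

Lemma measurable_mulmx p q r (f : T -> 'M[R]_(p, q)) (g : T -> 'M[R]_(q, r)) :
  measurable_fun setT f -> measurable_fun setT g ->
  measurable_fun setT (fun x => f x *m g x).
Proof.
move=> mf mg; apply/measurable_mxP => i j; under eq_fun do rewrite mxE.
apply: measurable_sum => l.
by apply: measurable_funM; exact: measurable_entry.
Qed.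

Lemma measurable_scalemx p q (a : T -> R) (f : T -> 'M[R]_(p, q)) :
  measurable_fun setT a -> measurable_fun setT f ->
  measurable_fun setT (fun x => a x *: f x).
Proof.
move=> ma mf; apply/measurable_mxP => i j; under eq_fun do rewrite mxE.
by apply: measurable_funM => //; exact: measurable_entry.
Qed.

Lemma measurable_trmx p q (f : T -> 'M[R]_(p, q)) :
  measurable_fun setT f -> measurable_fun setT (fun x => (f x)^T).
Proof.
move=> mf; apply/measurable_mxP => i j; under eq_fun do rewrite mxE.
exact: measurable_entry.
Qed.

Lemma measurable_map_mx p q (h : R -> R) (f : T -> 'M[R]_(p, q)) :
  measurable_fun setT h -> measurable_fun setT f ->
  measurable_fun setT (fun x => map_mx h (f x)).
Proof.
move=> mh mf; apply/measurable_mxP => i j; under eq_fun do rewrite mxE.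
exact: (measurableT_comp mh (measurable_entry _ _ mf)).
Qed.

Lemma measurable_mxdot p q (f g : T -> 'M[R]_(p, q)) :
  measurable_fun setT f -> measurable_fun setT g ->
  measurable_fun setT (fun x => mxdot (f x) (g x)).
Proof.
move=> mf mg; apply: measurable_sum => i; apply: measurable_sum => j.
by apply: measurable_funM; exact: measurable_entry.
Qed.

Lemma measurable_avgv n (f : T -> 'cV[R]_n) :
  measurable_fun setT f -> measurable_fun setT (fun x => avgv (f x)).
Proof.
move=> mf; apply: measurable_funM => //; apply: measurable_sum => i.
exact: measurable_entry.
Qed.

Variable n : nat.
Implicit Type f : T -> 'M[R]_n.

Lemma measurable_symm f :
  measurable_fun setT f -> measurable_fun setT (fun x => symm (f x)).
Proof.
move=> mf; apply/measurable_mxP => i j; under eq_fun do rewrite mxE.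
case: (_ < _)%N; first exact: measurable_entry.
case: (_ < _)%N; first exact: measurable_entry.
by apply: measurable_funM => //; exact: measurable_entry.
Qed.

Lemma measurable_asym f :
  measurable_fun setT f -> measurable_fun setT (fun x => asym (f x)).
Proof.
move=> mf; apply/measurable_mxP => i j; under eq_fun do rewrite mxE.
case: (_ < _)%N; first by apply: measurable_funN; exact: measurable_entry.
by case: (_ < _)%N; [exact: (measurable_entry i j mf)|exact: measurable_cst].
Qed.

Lemma measurable_mix f g : measurable_fun setT f -> measurable_fun setT g ->
  measurable_fun setT (fun x => mix (f x) (g x)).
Proof.
move=> mf mg; apply/measurable_mxP => i j; under eq_fun do rewrite mxE.
case: (_ < _)%N; first exact: measurable_entry.
case: (_ < _)%N; first exact: measurable_entry.
by apply: measurable_funM => //; exact: measurable_entry.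
Qed.

Lemma measurable_rot f g : measurable_fun setT f -> measurable_fun setT g ->
  measurable_fun setT (fun x => rot (f x) (g x)).
Proof.
move=> mf mg; have mfT := measurable_trmx mf.
apply: measurable_mix; apply: measurable_mulmx => //; apply: measurable_mulmx => //.
  exact: measurable_symm.
exact: measurable_asym.
Qed.

Lemma measurable_lift_rot f g : measurable_fun setT f -> measurable_fun setT g ->
  measurable_fun setT (fun x => lift_rot (f x) (g x)).
Proof. by move=> mf mg; apply: measurable_mulmx => //; exact: measurable_rot. Qed.

Lemma measurable_unlift_rot f g : measurable_fun setT f -> measurable_fun setT g ->
  measurable_fun setT (fun x => unlift_rot (f x) (g x)).
Proof.
move=> mf mg; have mfT := measurable_trmx mf.
by apply: measurable_rot => //; exact: measurable_mulmx.
Qed.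

Lemma measurable_householder k (u : T -> 'cV[R]_n) : measurable_fun setT u ->
  measurable_fun setT (fun x => householder k (u x)).
Proof.
move=> mu.
have mt : measurable_fun setT (fun x => tail_col k (u x)).
  apply/measurable_mxP => i j; under eq_fun do rewrite mxE.
  by case: (_ < _)%N; [exact: measurable_cst|exact: (measurable_entry i 0 mu)].
have md : measurable_fun setT (fun x => householder_dir k (u x)).
  apply: measurable_submx => //; apply: measurable_scalemx => //.
  by apply: (measurableT_comp measurable_sqrt); exact: measurable_mxdot.
apply: measurable_submx => //; apply: measurable_scalemx => //.
  apply: measurable_funM => //; apply: (measurableT_comp measurable_inv).
  exact: measurable_mxdot.
by apply: measurable_mulmx => //; exact: measurable_trmx.
Qed.

Lemma measurable_basis (y : T -> nat -> 'cV[R]_n) k :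
  (forall i, measurable_fun setT (fun w => y w i)) ->
  measurable_fun setT (fun w => basis (y w) k).
Proof.
move=> my; elim: k => [|k IH] /=; first exact: measurable_cst.
apply: measurable_mulmx => //; apply: measurable_householder.
by apply: measurable_mulmx => //; exact: measurable_trmx.
Qed.

Section AMPmeasurable.
Variables (lambda : R) (vstar : 'cV[R]_n) (eta : nat -> R -> R).
Hypothesis deta : forall t, differentiable_but_finitely (eta t).
Variables (W : T -> 'M[R]_n) (x : T -> 'cV[R]_n).
Hypotheses (mW : measurable_fun setT W) (mx : measurable_fun setT x).

Lemma measurable_amp_state k :
  measurable_fun setT (fun w => (amp_state lambda vstar eta (W w) (x w) k).1) /\
  measurable_fun setT (fun w => (amp_state lambda vstar eta (W w) (x w) k).2).
Proof.
elim: k => [|k [IH1 IH2]] /=; first by split.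
have my : measurable_fun setT
    (fun w => map_mx (eta k.+1) (amp_state lambda vstar eta (W w) (x w) k).2).
  by apply: measurable_map_mx => //; exact: measurable_denoiser.
split=> //; apply: measurable_submx.
  by apply: measurable_mulmx => //; exact: measurable_addmx.
apply: measurable_scalemx => //; apply: measurable_avgv.
by apply: measurable_map_mx => //; exact: measurable_deriv0.
Qed.

Lemma measurable_amp_dir k :
  measurable_fun setT (fun w => amp_dir lambda vstar eta (W w) (x w) k).
Proof.
by apply: measurable_map_mx; [exact: measurable_denoiser|exact: (measurable_amp_state k).2].
Qed.

End AMPmeasurable.

Section PhiMeasurable.
Variables (lambda : R) (vstar : 'cV[R]_n) (eta : nat -> R -> R).
Hypothesis deta : forall t, differentiable_but_finitely (eta t).
Variables (b : T -> 'M[R]_n) (x : T -> 'cV[R]_n).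
Hypotheses (mb : measurable_fun setT b) (mx : measurable_fun setT x).

Lemma measurable_amp_phi k :
  measurable_fun setT (fun w => amp_phi lambda vstar eta k (x w) (b w)).
Proof.
apply: measurable_lift_rot => //; apply: measurable_basis => i.
by apply: measurable_amp_dir => //; exact: measurable_symm.
Qed.

Lemma measurable_rebuilt_basis k :
  measurable_fun setT (fun w => rebuilt_basis lambda vstar eta (x w) (b w) k).
Proof.
elim: k => [|k IH] /=; first exact: measurable_cst.
have mT := measurable_trmx IH.
apply: measurable_mulmx => //; apply: measurable_householder.
apply: measurable_mulmx => //; apply: measurable_amp_dir => //.
apply: measurable_symm; apply: measurable_unlift_rot => //.
apply/measurable_mxP => i j; under eq_fun do rewrite mxE.
by case: (_ < _)%N; [exact: (measurable_entry i j mb)|exact: measurable_cst].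
Qed.

Lemma measurable_amp_coord_from m :
  measurable_fun setT (fun w => amp_coord_from lambda vstar eta m (x w) (b w)).
Proof.
apply/measurable_mxP => i j; under eq_fun do rewrite amp_coord_fromE.
case: (_ <= _)%N; last exact: measurable_entry.
apply: measurable_entry; apply: measurable_mulmx => //.
exact/measurable_trmx/measurable_rebuilt_basis.
Qed.

Lemma measurable_phi_step k : measurable_fun setT
  (fun w => phi_step lambda vstar eta k (x w) (b w) (b w)).
Proof.
apply: measurable_lift_rot; first exact: measurable_rebuilt_basis.
by apply: measurable_unlift_rot => //; exact: measurable_rebuilt_basis.
Qed.

Lemma measurable_coord_step m : measurable_fun setT
  (fun w => coord_step lambda vstar eta m (x w) (b w) (b w)).
Proof.
apply/measurable_mxP => i j; under eq_fun do rewrite coord_stepE.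
case: (_ == _ :> nat); last exact: measurable_entry.
apply: measurable_entry; apply: measurable_mulmx => //.
exact/measurable_trmx/measurable_rebuilt_basis.
Qed.

End PhiMeasurable.
End MeasurableMatrix.

(** * The law of the phi_k and of their coordinates *)

Section Laws.
Context {R : realType} (s : R) (s0 : s != 0) {n : nat}.
Variables (lambda : R) (vstar : 'cV[R]_n) (eta : nat -> R -> R).
Hypothesis deta : forall t, differentiable_but_finitely (eta t).
Variable x : 'cV[R]_n.

Lemma amp_phi_law k : gaussian_preserving s (amp_phi lambda vstar eta k x).
Proof.
elim: k => [|k IH].
  move=> E mE; congr (_ _); apply/seteqP; split=> b /=; by rewrite amp_phi0.
rewrite (_ : amp_phi lambda vstar eta k.+1 x =
  (fun c => phi_step lambda vstar eta k x c c) \o amp_phi lambda vstar eta k x).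
  have mstep : measurable_fun setT (fun c : 'M[R]_n => phi_step lambda vstar eta k x c c).
    by apply: (measurable_phi_step _ _ deta) => //; exact: measurable_cst.
  apply: gaussian_preserving_comp; [exact: mstep| |exact: IH].
  apply: (adaptive_isometry_preserving s0 (A := fun i j => (j < k)%N)).
  - by move=> c; exact: phi_step_isometry.
  - by move=> c c' cc'; exact: phi_step_local.
  - by move=> c c' i j jk; exact: phi_step_fix.
  - exact: mstep.
by apply/funext => b; rewrite [LHS]amp_phiS.
Qed.

Lemma amp_coord_law m : gaussian_preserving s (amp_coord_from lambda vstar eta m x).
Proof.
suff P d : (n <= m + d)%N -> gaussian_preserving s (amp_coord_from lambda vstar eta m x).
  by apply: (P n); rewrite leq_addl.
elim: d m => [|d IH] m mdn.
  rewrite addn0 in mdn; move=> E mE; congr (_ _); apply/seteqP.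
  have e (c : 'M[R]_n) : amp_coord_from lambda vstar eta m x c = c.
    by apply/matrixP => i j; rewrite amp_coord_fromE leqNgt (leq_trans (ltn_ord j)).
  by split=> c /=; rewrite e.
rewrite (_ : amp_coord_from lambda vstar eta m x =
  (fun c => coord_step lambda vstar eta m x c c) \o
  amp_coord_from lambda vstar eta m.+1 x).
  have mstep : measurable_fun setT (fun c : 'M[R]_n => coord_step lambda vstar eta m x c c).
    by apply: (measurable_coord_step _ _ deta) => //; exact: measurable_cst.
  apply: gaussian_preserving_comp; [exact: mstep| |by apply: IH; rewrite addSnnS].
  apply: (adaptive_isometry_preserving s0 (A := fun i j => j != m :> nat)).
  - by move=> c; exact: coord_step_isometry.
  - by move=> c c' cc'; exact: coord_step_local.
  - by move=> c c' i j jk; exact: coord_step_fix.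
  - exact: mstep.
by apply/funext => b; rewrite [LHS]amp_coord_fromS.
Qed.

End Laws.

(** * Euclidean norms and grid nets *)

Section EuclideanNorm.
Context {R : realType} {p : nat}.
Implicit Types u v : 'cV[R]_p.

Lemma mxdot_col u v : mxdot u v = \sum_i u i 0 * v i 0.
Proof. by apply: eq_bigr => i _; rewrite big_ord1. Qed.

Lemma norm2E u : norm2 u = Num.sqrt (mxdot u u).
Proof. by rewrite /norm2 mxdot_col. Qed.

Lemma norm2_ge0 u : 0 <= norm2 u.
Proof. exact: sqrtr_ge0. Qed.

Lemma norm2_sqr u : norm2 u ^+ 2 = mxdot u u.
Proof. by rewrite norm2E sqr_sqrtr// mxdot_ge0. Qed.

Lemma norm2_eq0 u : norm2 u = 0 -> u = 0.
Proof. by move=> u0; apply: mxdot_eq0; rewrite -norm2_sqr u0 expr0n. Qed.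

Lemma norm2_scale a u : norm2 (a *: u) = `|a| * norm2 u.
Proof. by rewrite !norm2E mxdotZl mxdotZr mulrA -expr2 sqrtrM ?sqr_ge0// sqrtr_sqr. Qed.

Lemma mxdot_cauchy u v : `|mxdot u v| <= norm2 u * norm2 v.
Proof.
rewrite -ler_sqr ?nnegrE ?mulr_ge0 ?norm2_ge0// exprMn !norm2_sqr real_normK ?num_real//.
have [v0|v0] := eqVneq (mxdot v v) 0.
  by rewrite (mxdot_eq0 v0) -(scale0r 0) !mxdotZr !mul0r expr0n/= mulr0.
have vp : 0 < mxdot v v by rewrite lt_neqAle eq_sym v0 mxdot_ge0.
have := mxdot_ge0 (mxdot v v *: u - mxdot u v *: v).
rewrite !mxdotE (mxdotC v u) => h.
have : 0 <= mxdot v v * (mxdot u u * mxdot v v - mxdot u v ^+ 2).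
  by apply: le_trans h _; rewrite le_eqVlt; apply/orP; left; apply/eqP; ring.
by rewrite pmulr_rge0// subr_ge0.
Qed.

Lemma norm2_triangle u v : norm2 (u + v) <= norm2 u + norm2 v.
Proof.
rewrite -ler_sqr ?nnegrE ?addr_ge0 ?norm2_ge0// sqrrD !norm2_sqr.
rewrite mxdotDl !mxdotDr (mxdotC v u).
have := le_trans (ler_norm _) (mxdot_cauchy u v); lra.
Qed.

Lemma norm2_dist u v : `| norm2 (u + v) - norm2 u | <= norm2 v.
Proof.
have h1 := norm2_triangle u v.
have h2 := norm2_triangle (u + v) (-1 *: v).
rewrite norm2_scale normrN1 mul1r scaleN1r addrK in h2.
by rewrite ler_norml; apply/andP; split; lra.
Qed.

End EuclideanNorm.

Section Net.
Context {R : realType} {n : nat} (t L : nat) (tn : (t <= n)%N).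
Hypotheses (L0 : (0 < L)%N) (tL : (t ^ 2 <= L)%N).

(** Points of the grid of mesh 1 / L in the cube, extended by zero beyond the first
    t coordinates.  A grid that is finer than necessary costs only a factor
    log n in the union bound. *)
Definition net_point (f : {ffun 'I_t -> 'I_(2 * L).+1}) : 'cV[R]_n :=
  \col_i (if insub (i : nat) is Some k then (f k)%:R / L%:R - 1 else 0).

Definition supported (u : 'cV[R]_n) := forall i : 'I_n, (t <= i)%N -> u i 0 = 0.

Let LR : 0 < L%:R :> R. Proof. by rewrite ltr0n. Qed.

Let round (x : R) : R := (Num.floor (x * L%:R))%:~R / L%:R.

Let round_err x : 0 <= x - round x <= L%:R^-1.
Proof.
have /andP[h1 h2] := floor_itv (x * L%:R).
have e : x - round x = (x * L%:R - (Num.floor (x * L%:R))%:~R) / L%:R.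
  by rewrite mulrBl mulfK ?gt_eqF.
rewrite e; apply/andP; split; first by rewrite divr_ge0 ?subr_ge0// ltW.
rewrite ler_pdivrMr// mulVf ?gt_eqF//; move: h2; rewrite intrD; lra.
Qed.

Let round_abs x : `|x| <= 1 -> `|round x| <= 1.
Proof.
rewrite !ler_norml => /andP[h1 h2]; rewrite /round; apply/andP; split.
  rewrite ler_pdivlMr// mulN1r -[X in - X]/((L%:Z)%:~R) -intrN ler_int floor_ge_int.
  by rewrite intrN; have := ler_wpM2r (ltW LR) h1; rewrite mulN1r.
rewrite ler_pdivrMr// mul1r -[leRHS]/((L%:Z)%:~R) ler_int.
rewrite -(@ler_int R); apply: le_trans (floor_le _) _.
by have := ler_wpM2r (ltW LR) h2; rewrite mul1r.
Qed.

Let round_col (u : 'cV[R]_n) : 'cV[R]_n := \col_i round (u i 0).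

Let round0 : round 0 = 0.
Proof. by rewrite /round mul0r floor0 mul0r. Qed.

Let net_round u : supported u -> (forall i, `|u i 0| <= 1) ->
  exists f, net_point f = round_col u.
Proof.
move=> su u1.
exists [ffun k : 'I_t => inord (absz (Num.floor (u (widen_ord tn k) 0 * L%:R) + L%:Z))].
apply/colP => i; rewrite !mxE; case: insubP => [k kt ki|]; last first.
  by rewrite -leqNgt => ti; rewrite su// round0.
rewrite ffunE.
have -> : widen_ord tn k = i by apply/val_inj.
have := round_abs (u1 i); rewrite /round; set z := Num.floor _.
rewrite ler_norml ler_pdivlMr// ler_pdivrMr// mulN1r mul1r => /andP[h1 h2].
have z1 : (- L%:Z <= z)%R by rewrite -(@ler_int R) intrN.
have z2 : (z <= L%:Z)%R by rewrite -(@ler_int R).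
rewrite inordK; last by lia.
rewrite -[X in X / _]/((Posz (absz (z + L%:Z)))%:~R) gez0_abs; last by lia.
by rewrite intrD mulrDl divff ?gt_eqF// addrK.
Qed.

Variables (N : 'M[R]_n) (r : R).
Hypothesis r0 : 0 <= r.
Hypothesis net_le : forall f g, `|mxdot (net_point f) (N *m net_point g)|
  <= 2 * r * norm2 (net_point f) * norm2 (net_point g).

Let B (u v : 'cV[R]_n) := mxdot u (N *m v).

Let B_entry (a b : 'I_n) : (a < t)%N -> (b < t)%N -> `|N a b| <= 2 * r.
Proof.
move=> at_ bt.
have delta_net (i : 'I_n) : (i < t)%N -> exists f, net_point f = delta_mx i 0.
  move=> it; have [||f hf] := @net_round (delta_mx i 0).
  - by move=> j tj; rewrite mxE (_ : (j == i) = false)// -val_eqE/= gtn_eqF// (leq_trans it).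
  - by move=> j; rewrite mxE; case: (_ && _); rewrite ?normr1 ?normr0.
  exists f; rewrite hf; apply/colP => j; rewrite !mxE; case: (_ && _); rewrite ?round0//.
  by rewrite /round mul1r -[X in Num.floor X]/((L%:Z)%:~R) intrKfloor divff// gt_eqF.
have [f hf] := delta_net _ at_; have [g hg] := delta_net _ bt.
have := net_le f g; rewrite hf hg mxdotC mxdot_delta -colE mxE.
have n1 (i : 'I_n) : norm2 (delta_mx i 0 : 'cV[R]_n) = 1.
  by rewrite norm2E mxdot_delta mxE !eqxx sqrtr1.
by rewrite !n1 !mulr1.
Qed.

Let B_sum u v : B u v = \sum_a \sum_b u a 0 * N a b * v b 0.
Proof.
rewrite /B mxdot_col; apply: eq_bigr => a _; rewrite mxE mulr_sumr.
by apply: eq_bigr => b _; rewrite mulrA.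
Qed.

Let B_le u v (x y : R) : 0 <= x -> 0 <= y -> supported u -> supported v ->
  (forall i, `|u i 0| <= x) -> (forall i, `|v i 0| <= y) ->
  `|B u v| <= 2 * r * (t%:R * x) * (t%:R * y).
Proof.
move=> x0 y0 su sv ux vy.
have cnt (z : R) : \sum_(a < n | (a < t)%N) z = t%:R * z.
  by rewrite (big_ord_narrow tn) sumr_const card_ord mulr_natl.
rewrite B_sum; apply: le_trans (ler_norm_sum _ _ _) _.
rewrite (bigID (fun a : 'I_n => (a < t)%N))/= [X in _ + X]big1 ?addr0; last first.
  move=> a; rewrite -leqNgt => ta; rewrite big1 ?normr0// => b _.
  by rewrite su// !mul0r.
apply: (@le_trans _ _ (\sum_(a < n | (a < t)%N) (2 * r * x * (t%:R * y)))); last first.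
  by rewrite cnt le_eqVlt; apply/orP; left; apply/eqP; ring.
apply: ler_sum => a at_; apply: le_trans (ler_norm_sum _ _ _) _.
rewrite (bigID (fun b : 'I_n => (b < t)%N))/= [X in _ + X]big1 ?addr0; last first.
  by move=> b; rewrite -leqNgt => tb; rewrite sv// mulr0 normr0.
apply: (@le_trans _ _ (\sum_(b < n | (b < t)%N) (2 * r * x * y))); last first.
  by rewrite cnt le_eqVlt; apply/orP; left; apply/eqP; ring.
apply: ler_sum => b bt; rewrite !normrM.
apply: ler_pM => //; rewrite ?mulr_ge0//.
by rewrite mulrC ler_pM// B_entry.
Qed.

Let unit_case u v : supported u -> supported v -> norm2 u = 1 -> norm2 v = 1 ->
  `|B u v| <= 12 * r.
Proof.
move=> su sv u1 v1.
have abs1 (w : 'cV[R]_n) i : norm2 w = 1 -> `|w i 0| <= 1.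
  move=> w1; have := mxdot_cauchy w (delta_mx i 0).
  rewrite mxdot_delta w1 mul1r norm2E mxdot_delta mxE !eqxx sqrtr1 //.
have [[f hf] [g hg]] : (exists f, net_point f = round_col u) /\
    (exists g, net_point g = round_col v).
  by split; apply: net_round => // i; exact: abs1.
have Li0 : 0 <= L%:R^-1 :> R by rewrite invr_ge0 ltW.
have err0 (w : 'cV[R]_n) i : `|(w - round_col w) i 0| <= L%:R^-1.
  by rewrite !mxE; have /andP[h1 h2] := round_err (w i 0); rewrite ger0_norm.
have serr w : supported w -> supported (w - round_col w).
  by move=> sw i ti; rewrite !mxE sw// round0 subr0.
have sround w : supported w -> supported (round_col w).
  by move=> sw i ti; rewrite !mxE sw// round0.
have tL' : (t%:R * t%:R) * L%:R^-1 <= 1 :> R.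
  by rewrite ler_pdivrMr// mul1r -natrM ler_nat; apply: leq_trans tL; rewrite -mulnn.
have L1 : L%:R^-1 <= 1 :> R by rewrite invf_le1// ler1n.
have tLi : t%:R * L%:R^-1 <= 1 :> R.
  rewrite ler_pdivrMr// mul1r ler_nat; apply: leq_trans tL.
  by rewrite expnS expn1; case: (t) => // k; rewrite leq_pmulr.
have round2 w : supported w -> norm2 w = 1 -> norm2 (round_col w) <= 2.
  move=> sw w1; have -> : round_col w = w + -1 *: (w - round_col w).
    by rewrite scaleN1r opprB addrC subrK.
  apply: le_trans (norm2_triangle _ _) _.
  rewrite norm2_scale normrN1 mul1r w1 -[leRHS]/(1 + 1) lerD2l.
  rewrite -[leRHS]sqrtr1 norm2E ler_sqrt// mxdot_col.
  rewrite (bigID (fun a : 'I_n => (a < t)%N))/= [X in _ + X]big1 ?addr0; last first.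
    by move=> a; rewrite -leqNgt => ta; rewrite serr// mulr0.
  apply: (@le_trans _ _ (\sum_(a < n | (a < t)%N) L%:R^-1)); last first.
    by rewrite (big_ord_narrow tn) sumr_const card_ord -[leLHS]mulr_natl.
  apply: ler_sum => a _; rewrite -expr2 -real_normK ?num_real// expr2.
  rewrite -[leRHS]mulr1; apply: ler_pM => //.
  exact: le_trans (err0 _ _) L1.
have -> : B u v = B (round_col u) (round_col v)
    + (B (round_col u) (v - round_col v) + B (u - round_col u) v).
  by rewrite /B !mulmxBr !mxdotDr !mxdotDl !mxdotNr !mxdotNl; ring.
apply: le_trans (ler_normD _ _) _.
have h1 : `|B (round_col u) (round_col v)| <= 8 * r.
  rewrite -hf -hg; apply: le_trans (net_le _ _) _; rewrite hf hg.
  have := round2 _ su u1; have := round2 _ sv v1.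
  have := norm2_ge0 (round_col u); have := norm2_ge0 (round_col v).
  move: (norm2 _) (norm2 _) => a b a0 b0 a2 b2.
  have ab : b * a <= 2 * 2 by apply: ler_pM.
  by rewrite -mulrA (mulrC 2) (mulrC 8) -!mulrA ler_wpM2l//; lra.
have h2 : `|B (round_col u) (v - round_col v)| <= 2 * r.
  have := @B_le (round_col u) (v - round_col v) 1 L%:R^-1 ler01 Li0.
  move=> /(_ (sround _ su) (serr _ sv)).
  move=> /(_ _ (err0 v)) h.
  apply: le_trans (h _) _.
    by move=> i; rewrite mxE; apply: round_abs; exact: abs1.
  rewrite mulr1 -[leRHS]mulr1 -!mulrA ler_wpM2l// ler_wpM2l// mulrA//.
have h3 : `|B (u - round_col u) v| <= 2 * r.
  have := @B_le (u - round_col u) v L%:R^-1 1 Li0 ler01.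
  move=> /(_ (serr _ su) sv (err0 u) (fun i => abs1 v i v1)) h.
  apply: le_trans h _.
  rewrite mulr1 -[leRHS]mulr1 -!mulrA ler_wpM2l// ler_wpM2l// (mulrC _ t%:R) mulrA//.
by apply: le_trans (lerD h1 (le_trans (ler_normD _ _) (lerD h2 h3))) _; lra.
Qed.

(** Round u and v down to grid points.  The main part is controlled by the bound on
    the net, of norm at most 2 on each side.  The coordinate vectors are in the
    net, so every entry of N is at most 2 r, and as L >= t^2 the rounding errors
    contribute at most 2 r each: 8 r + 2 r + 2 r in total. *)
Lemma net_bilinear u v : supported u -> supported v ->
  `|mxdot u (N *m v)| <= 12 * r * norm2 u * norm2 v.
Proof.
move=> su sv.
have [u0|u0] := eqVneq (norm2 u) 0.
  by rewrite u0 (norm2_eq0 u0) -(scale0r 0) mxdotZl mul0r normr0 mulr0 mul0r.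
have [v0|v0] := eqVneq (norm2 v) 0.
  by rewrite v0 (norm2_eq0 v0) mulmx0 -(scale0r 0) mxdotZr mul0r normr0 mulr0.
have sZ a w : supported w -> supported (a *: w).
  by move=> sw i ti; rewrite mxE sw// mulr0.
have nZ (w : 'cV[R]_n) : norm2 w != 0 -> norm2 ((norm2 w)^-1 *: w) = 1.
  by move=> w0; rewrite norm2_scale ger0_norm ?invr_ge0 ?norm2_ge0// mulVf.
have := unit_case (sZ _ _ su) (sZ _ _ sv) (nZ _ u0) (nZ _ v0).
rewrite /B -scalemxAr mxdotZl mxdotZr !normrM !normfV.
rewrite !(ger0_norm (norm2_ge0 _)) mulrA -invfM mulrC.
rewrite ler_pdivrMr ?mulr_gt0 ?lt_neqAle ?norm2_ge0 ?andbT ?(eq_sym 0)//.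
by rewrite -mulrA.
Qed.

End Net.

(** * Concentration of bilinear forms in a Gaussian matrix *)

Section UnionBound.
Context {d} {T : measurableType d} {R : realType} (P : probability T R).

Lemma union_bound (I : finType) (A : I -> set T) (e : R) :
  (forall i, measurable (A i)) -> (forall i, (P (A i) <= e%:E)%E) ->
  (P [set x | exists i, A i x] <= (#|I|%:R * e)%:E)%E.
Proof.
move=> mA Ae.
have mU (r : seq I) : measurable [set x | exists2 i, i \in r & A i x].
  elim: r => [|i r IH].
    by rewrite (_ : [set x | _] = set0)//; apply/seteqP; split => x //= [].
  rewrite (_ : [set x | _] = A i `|` [set x | exists2 i, i \in r & A i x]).
    exact: measurableU.
  apply/seteqP; split => x /=.
    move=> [j]; rewrite inE => /orP[/eqP->|jr] Aj; first by left.
    by right; exists j.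
  by move=> [Ai|[j jr Aj]]; [exists i|exists j] => //; rewrite inE ?eqxx ?jr ?orbT.
have H (r : seq I) : (P [set x | exists2 i, i \in r & A i x] <= ((size r)%:R * e)%:E)%E.
  elim: r => [|i r IH].
    rewrite (_ : [set x | _] = set0) ?measure0 ?mul0r//.
    by apply/seteqP; split => x //= [].
  rewrite (_ : [set x | _] = A i `|` [set x | exists2 i, i \in r & A i x]); last first.
    apply/seteqP; split => x /=.
      move=> [j]; rewrite inE => /orP[/eqP->|jr] Aj; first by left.
      by right; exists j.
    by move=> [Ai|[j jr Aj]]; [exists i|exists j] => //; rewrite inE ?eqxx ?jr ?orbT.
  apply: le_trans (measureU2 _ _ _) _ => //.
  by rewrite /= -natr1 mulrDl mul1r addrC EFinD leeD.
have := H (enum I); rewrite -cardE; apply: le_trans.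
rewrite le_eqVlt; apply/orP; left; apply/eqP; congr (P _).
by apply/seteqP; split => x /= [i] => [Ai|_ Ai]; exists i; rewrite ?mem_enum.
Qed.

End UnionBound.

Section Concentration.
Context {R : realType} {n : nat}.
Implicit Types (Psi : 'M[R]_n) (u v : 'cV[R]_n).

(** Matrices whose (a, b) entry combines the (a, b) and (b, a) entries of one
    Gaussian matrix.  The error matrix of the residual has this shape: it is
    symmetric up to bounded factors, so it is not a matrix of independent
    entries. *)
Definition overlay (C1 C2 : 'M[R]_n) Psi : 'M[R]_n :=
  \matrix_(a, b) (C1 a b * Psi a b + C2 b a * Psi b a).

Definition overlay_coef (C1 C2 : 'M[R]_n) u v : 'M[R]_n :=
  \matrix_(a, b) (C1 a b * u a 0 * v b 0 + C2 a b * v a 0 * u b 0).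

Lemma overlay_mxdot (C1 C2 : 'M[R]_n) Psi u v :
  mxdot u (overlay C1 C2 Psi *m v) = mxdot (overlay_coef C1 C2 u v) Psi.
Proof.
transitivity (\sum_a \sum_b (C1 a b * u a 0 * v b 0 * Psi a b)
   + \sum_a \sum_b (C2 b a * v b 0 * u a 0 * Psi b a)).
  rewrite mxdot_col -big_split; apply: eq_bigr => a _.
  rewrite mxE mulr_sumr -big_split; apply: eq_bigr => b _.
  by rewrite mxE /=; ring.
rewrite [X in _ + X]exchange_big /mxdot -big_split; apply: eq_bigr => a _.
by rewrite -big_split; apply: eq_bigr => b _; rewrite mxE/=; ring.
Qed.

Lemma overlay_coef_le (C1 C2 : 'M[R]_n) u v :
  (forall a b, `|C1 a b| <= 1) -> (forall a b, `|C2 a b| <= 1) ->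
  mxdot (overlay_coef C1 C2 u v) (overlay_coef C1 C2 u v)
    <= 4 * (mxdot u u * mxdot v v).
Proof.
move=> c1 c2.
have sq (c x : R) : `|c| <= 1 -> (c * x) ^+ 2 <= x ^+ 2.
  move=> c1'; rewrite exprMn -[leRHS]mul1r ler_wpM2r ?sqr_ge0//.
  by rewrite -real_normK ?num_real// exprn_ile1.
apply: (@le_trans _ _ (\sum_a \sum_b 2 * (u a 0 ^+ 2 * v b 0 ^+ 2)
  + \sum_a \sum_b 2 * (v a 0 ^+ 2 * u b 0 ^+ 2))).
  rewrite -big_split; apply: ler_sum => a _; rewrite -big_split; apply: ler_sum => b _.
  rewrite mxE/= -expr2.
  have h1 := sq _ (u a 0 * v b 0) (c1 a b).
  have h2 := sq _ (v a 0 * u b 0) (c2 a b).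
  have h3 := sqr_ge0 (C1 a b * (u a 0 * v b 0) - C2 a b * (v a 0 * u b 0)).
  rewrite -!exprMn -[C1 a b * _ * _]mulrA -[C2 a b * _ * _]mulrA; move: h1 h2 h3.
  move: (C1 a b * (u a 0 * v b 0)) (C2 a b * (v a 0 * u b 0)) (u a 0 * v b 0) (v a 0 * u b 0) => x y z w.
  by rewrite sqrrB sqrrD => ? ? ?; lra.
(* (s + s')^2 <= 2 s^2 + 2 s'^2 above, so the sums factor. *)
have E (x y : 'cV[R]_n) : \sum_a \sum_b 2 * (x a 0 ^+ 2 * y b 0 ^+ 2)
    = 2 * (mxdot x x * mxdot y y).
  rewrite !mxdot_col mulr_suml mulr_sumr; apply: eq_bigr => a _.
  by rewrite mulrA mulr_sumr; apply: eq_bigr => b _; ring.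
rewrite !E (mulrC (mxdot v v)); lra.
Qed.

(** There are at most n^(8t) pairs of net points for L = n^2, and with
    r = 8 sqrt(t log n / n) each pair fails with probability at most 2 n^(-24t).
    The constant 96 is 12 times 8. *)
Lemma gaussian_concentration (t : nat) (C1 C2 : 'M[R]_n) : (0 < t < n)%N ->
  (forall a b, `|C1 a b| <= 1) -> (forall a b, `|C2 a b| <= 1) ->
  exists G : set 'M[R]_n, [/\ measurable G,
    ((1 - 2 / n%:R ^+ 11)%:E <= gaussian_mx (Num.sqrt (1 / n%:R)) n n G)%E &
    forall Psi, G Psi -> forall u v, supported t u -> supported t v ->
      `|mxdot u (overlay C1 C2 Psi *m v)|
        <= 96 * Num.sqrt (t%:R * ln n%:R / n%:R) * norm2 u * norm2 v].
Proof.
move=> /andP[t0 tn] c1 c2.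
have n0 : (0 < n)%N by exact: leq_trans tn.
have n2 : (2 <= n)%N by exact: leq_trans tn.
have nR : 0 < n%:R :> R by rewrite ltr0n.
pose L := (n ^ 2)%N.
have L0 : (0 < L)%N by rewrite expn_gt0 n0.
have tL : (t ^ 2 <= L)%N by rewrite leq_exp2r// ltnW.
pose pt := @net_point R n t L.
pose q := Num.sqrt (t%:R * ln n%:R / n%:R) : R.
have ln0 : 0 <= ln n%:R :> R by rewrite ln_ge0// ler1n.
have q2 : q ^+ 2 = t%:R * ln n%:R / n%:R.
  by rewrite sqr_sqrtr// divr_ge0// mulr_ge0.
have q0 : 0 <= q by exact: sqrtr_ge0.
(* net_bilinear turns a bound 2 r on the net into 12 r = 96 q. *)
pose r := 8 * q.
have r0 : 0 <= r by rewrite mulr_ge0.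
pose s : R := Num.sqrt (1 / n%:R).
have s0 : 0 < s by rewrite sqrtr_gt0 divr_gt0.
have s2 : s ^+ 2 = n%:R^-1 by rewrite sqr_sqrtr ?divr_ge0// mul1r.
pose F := {ffun 'I_t -> 'I_(2 * L).+1}.
pose a (fg : F * F) := overlay_coef C1 C2 (pt fg.1) (pt fg.2).
pose bad (fg : F * F) := [set c | r ^+ 2 * mxdot (a fg) (a fg) < mxdot (a fg) c ^+ 2].
have mbad fg : measurable (bad fg).
  have mf : measurable_fun setT (fun c : 'M[R]_n => mxdot (a fg) c ^+ 2).
    apply: measurable_funX; apply: measurable_mxdot; [exact: measurable_cst|exact: measurable_id].
  rewrite (_ : bad fg = (fun c : 'M[R]_n => mxdot (a fg) c ^+ 2) @^-1`
      `](r ^+ 2 * mxdot (a fg) (a fg)), +oo[%classic).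
    by apply: (measurable_preimage mf); exact: measurable_itv.
  by apply/seteqP; split => c /=; rewrite in_itv/= andbT.
have mB : measurable [set c | exists fg, bad fg c].
  rewrite (_ : [set c | _] = ~` [set c | forall fg, (~` bad fg) c]).
    by apply: measurableC; apply: measurable_forall_fin => fg; exact: measurableC.
  apply/seteqP; split => c /=; first by move=> [fg h] /(_ fg).
  by move=> /existsNP[fg /contrapT h]; exists fg.
exists (~` [set c | exists fg, bad fg c]); split.
- exact: measurableC.
- rewrite probability_setC// EFinB leeB//.
  apply: le_trans (union_bound mbad (fun fg => gaussian_tail s0 (a fg) r0)) _.
  rewrite lee_fin.
  have -> : - (3 * r ^+ 2) / (8 * s ^+ 2) = - ((24 * t)%:R * ln n%:R).
    by rewrite s2 /r exprMn q2 natrM; field; rewrite gt_eqF.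
  rewrite expRN expRM_natl lnK ?posrE//.
  rewrite card_prod card_ffun !card_ord.
  have cnt : (((2 * L).+1 ^ t) * ((2 * L).+1 ^ t) <= n ^ (8 * t))%N.
    rewrite -expnMn (expnM n 8) leq_exp2r// (expnM n 2 4) -/L.
    have : (4 <= L)%N by rewrite -(leq_exp2r _ _ (isT : 0 < 2)%N) in n2.
    by rewrite !expnS expn0; nia.
  set c := (_ * _)%N in cnt *.
  have cR : c%:R <= n%:R ^+ (8 * t) :> R by rewrite -natrX ler_nat.
  have n1 : 1 <= n%:R :> R by rewrite ler1n.
  apply: (@le_trans _ _ (n%:R ^+ (8 * t) * (2 * (n%:R ^+ (24 * t))^-1))).
    by rewrite ler_wpM2r// mulr_ge0// invr_ge0 exprn_ge0// ltW.
  rewrite mulrCA ler_wpM2l// ler_pdivrMr ?exprn_gt0// mulrC ler_pdivlMr ?exprn_gt0//.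
  by rewrite -exprD ler_weXn2l//; lia.
move=> Psi good u v su sv.
have -> : 96 * Num.sqrt (t%:R * ln n%:R / n%:R) = 12 * r by rewrite /r -/q; ring.
apply: (net_bilinear (ltnW tn) L0 tL r0) => // f g.
rewrite overlay_mxdot.
have : mxdot (a (f, g)) Psi ^+ 2 <= r ^+ 2 * mxdot (a (f, g)) (a (f, g)).
  by rewrite leNgt; apply/negP => h; apply: good; exists (f, g).
move=> h; rewrite -ler_sqr ?nnegrE; last 2 first.
  exact: normr_ge0.
  by rewrite !mulr_ge0 ?norm2_ge0.
rewrite real_normK ?num_real//; apply: le_trans h _.
apply: le_trans (ler_wpM2l (sqr_ge0 _) (overlay_coef_le _ _ c1 c2)) _.
by rewrite -!norm2_sqr le_eqVlt; apply/orP; left; apply/eqP; ring.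
Qed.

End Concentration.

(** * Independence of the columns of a Gaussian matrix *)

Section SigmaMx.
Context {d} {T : measurableType d} {R : realType} {p q : nat}.
Implicit Type X : T -> 'M[R]_(p, q).

Lemma sigma_mx_preimage X A : sigma_mx X A -> exists2 E, measurable E & A = X @^-1` E.
Proof.
move=> sA.
have : preimage_set_system setT X measurable A.
  apply: (@smallest_sub _ _ _ (preimage_set_system setT X measurable) _ _ A sA).
    exact/sigma_algebra_preimage/sigma_algebra_measurable.
  move=> B [[i j] _ /= [C mC <-]]; rewrite setTI.
  exists [set M | C (M i j)]; last by rewrite setTI.
  exact: (measurable_preimage (measurable_mx_entry i j)).
by move=> [E mE <-]; exists E; rewrite // setTI.
Qed.

Lemma preimage_sigma_mx X E : measurable E -> sigma_mx X (X @^-1` E).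
Proof.
move=> mE.
have : preimage_set_system setT X (@mx_boxes R p q).-sigma.-measurable (X @^-1` E).
  by exists E => //; rewrite setTI.
rewrite -g_sigma_preimageE; apply: smallest_sub; first exact: smallest_sigma_algebra.
move=> _ [_ [B mB <-] <-]; rewrite setTI.
have -> : X @^-1` mx_box B =
    \bigcap_(ij in [set: 'I_p * 'I_q]) [set w | B ij.1 ij.2 (X w ij.1 ij.2)].
  by apply/seteqP; split => [w h [i j] _|w h i j]; [exact: h|exact: (h (i, j))].
pose G := \bigcup_(ij : 'I_p * 'I_q) sigma_rv (fun w => X w ij.1 ij.2).
apply: (@fin_bigcap_measurable _ (g_sigma_algebraType G)).
  exact: finite_finset.
move=> [i j] _; apply: sub_sigma_algebra; exists (i, j) => //=.
by exists (B i j); [exact: mB|rewrite setTI].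
Qed.

End SigmaMx.

Section ColumnIndependence.
Context {R : realType} (s : R) {p q : nat}.
Notation gauss := (gaussian_mx s p q).
Local Open Scope ereal_scope.

Let mcol (j : 'I_q) : measurable_fun setT (fun c : 'M[R]_(p, q) => col j c).
Proof.
by apply/measurable_mxP => i k; under eq_fun do rewrite mxE; exact: measurable_mx_entry.
Qed.

(** Known for boxes.  The box constraint is lifted one column at a time: with the
    other columns constrained to D, both sides are finite measures in the set that
    constrains column M, equal on boxes. *)
Lemma gaussian_columns (D : 'I_q -> set 'cV[R]_p) : (forall j, measurable (D j)) ->
  gauss [set c | forall j, D j (col j c)] = \prod_j gauss [set c | D j (col j c)].
Proof.
move=> mD.
have mS (D' : 'I_q -> set 'cV[R]_p) (Q : pred 'I_q) : (forall j, measurable (D' j)) ->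
    measurable [set c | forall j, Q j -> D' j (col j c)].
  move=> mD'; rewrite (_ : [set c | _] =
      [set c | forall j, (if Q j then D' j else setT) (col j c)]).
    apply: measurable_forall_fin => j; apply: (measurable_preimage (mcol j)).
    by case: ifP.
  apply/seteqP; split => c /= h j; have := h j; first by case: ifP => // _; apply.
  by case: ifP.
suff H (m : nat) (D' : 'I_q -> set 'cV[R]_p) : (forall j, measurable (D' j)) ->
    (forall j : 'I_q, (m <= j)%N -> mx_boxes (D' j)) ->
    gauss [set c | forall j, D' j (col j c)] = \prod_j gauss [set c | D' j (col j c)].
  by apply: (H q) => // j; rewrite leqNgt ltn_ord.
elim: m D' => [|m IH] D' mD' bD'.
  have /choice[B /all_and2[mB DB]] : forall j : 'I_q, exists B : 'I_p -> 'I_1 -> set R,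
      (forall i k, measurable (B i k)) /\ mx_box B = D' j.
    by move=> j; have [B mB e] := bD' j isT; exists B.
  pose B' i j := B j i 0%R.
  rewrite (_ : [set c | _] = mx_box B'); last first.
    apply/seteqP; split => [c h i j|c h j].
      by have := h j; rewrite -DB => /(_ i 0%R); rewrite mxE.
    by rewrite -DB => i k; have := h i j; rewrite mxE (ord1 k).
  rewrite gaussian_mx_box; last by move=> i j; exact: mB.
  rewrite -(pair_big xpredT xpredT (fun i j => normal_prob 0 s (B' i j)))/= exchange_big.
  apply: eq_bigr => j _ /=.
  pose B1 i k := if k == j then B' i k else setT.
  rewrite (_ : [set c | _] = mx_box B1); last first.
    apply/seteqP; split => [c h i k|c h].
      by rewrite /B1; case: eqP => // ->; have := h; rewrite -DB => /(_ i 0%R); rewrite mxE.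
    by rewrite /= -DB => i k; have := h i j; rewrite mxE (ord1 k) /B1 eqxx.
  rewrite gaussian_mx_box; last by move=> i k; rewrite /B1; case: ifP => // _; exact: mB.
  rewrite -(pair_big xpredT xpredT (fun i k => normal_prob 0 s (B1 i k)))/=.
  apply: eq_bigr => i _; rewrite (bigD1 j)//= /B1 eqxx big1 ?mule1// => k /negbTE ->.
  by rewrite probability_setT.
have [mq|qm] := ltnP m q; last first.
  by apply: IH => // j mj; have := leq_trans qm mj; rewrite leqNgt ltn_ord.
pose M := Ordinal mq.
pose O := [set c : 'M[R]_(p, q) | forall j, j != M -> D' j (col j c)].
have mO : measurable O by exact: (mS D' (fun j => j != M) mD').
pose rest := \prod_(j | j != M) gauss [set c | D' j (col j c)].
have rest_ge0 : 0 <= rest by apply: prode_ge0 => j _.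
have rest_fin : rest \is a fin_num.
  apply: (big_ind (fun x => x \is a fin_num)) => // [x y|j _]; first exact: fin_numM.
  apply: fin_num_measure; exact: (measurable_preimage (mcol j)).
pose k : {nonneg R} := NngNum (fine_ge0 rest_ge0).
pose fcol : {mfun 'M[R]_(p, q) >-> 'cV[R]_p} :=
  HB.pack (fun c : 'M[R]_(p, q) => col M c) (isMeasurableFun.Build _ _ _ _ _ (mcol M)).
have key E : measurable E -> gauss ([set c | E (col M c)] `&` O) =
    rest * gauss [set c | E (col M c)].
  move=> mE.
  have := @mx_measure_unique R p 1 (pushforward (mrestr gauss mO) fcol)
    (mscale k (pushforward gauss fcol)).
  move=> /(_ (mcol M) (mcol M)) uniq; have := uniq _ _ E mE; rewrite /pushforward/= /mscale/= /mrestr/= fineK//; apply.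
    apply: le_lt_trans (probability_le1 _ _) (ltry 1).
    by rewrite preimage_setT setTI.
  move=> B mB.
  pose D1 j := if j == M then mx_box B else D' j.
  have mD1 j : measurable (D1 j) by rewrite /D1; case: ifP => // _; exact: measurable_mx_box.
  have := IH D1 mD1.
  have DM : D1 M = mx_box B by rewrite /D1 eqxx.
  rewrite (bigD1 M)//= DM muleC => h.
  have e : [set c | forall j, D1 j (col j c)] = [set c | mx_box B (col M c)] `&` O.
    apply/seteqP; split => [c hc|c [h1 h2] j].
      split; first by have := hc M; rewrite DM.
      by move=> j jM; have := hc j; rewrite /D1 (negbTE jM).
    by rewrite /D1; case: eqP => [->//|/eqP jM]; exact: h2.
  rewrite e in h; apply: etrans (h _) _.
    move=> j; rewrite /D1; case: eqP => [_ _|/eqP jM mj]; first by exists B.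
    by apply: bD'; rewrite ltn_neqAle mj andbT; apply: contra jM => /eqP mj'; apply/eqP/val_inj.
  by congr (_ * _); apply: eq_bigr => j jM; rewrite /D1 (negbTE jM).
rewrite (bigD1 M)//= muleC -/rest -key//; congr (_ _); apply/seteqP; split => [c h|c [h1 h2] j].
  by split=> // j _.
by have [->//|jM] := eqVneq j M; exact: h2.
Qed.

End ColumnIndependence.

Section GaussianColumns.
Context {d} {T : measurableType d} {R : realType} {n : nat}.
Variables (mu : probability T R) (s2 : R) (Phi : T -> 'M[R]_n).
Hypothesis mPhi : measurable_fun setT Phi.
Hypothesis lawPhi : forall E, measurable E ->
  mu (Phi @^-1` E) = gaussian_mx (Num.sqrt s2) n n E.

(** Shifted by one: phi_k is column k - 1. *)
Definition nth_col (k : nat) (c : 'M[R]_n) : 'cV[R]_n :=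
  if insub k.-1 is Some j then col j c else 0.

Lemma big_fset_fintype (I : finType) (J : {fset I}) (F : I -> \bar R) :
  (\prod_(k <- J) F k = \prod_k (if k \in J then F k else 1))%E.
Proof.
rewrite -big_mkcond -[RHS]big_filter; apply: perm_big.
apply: uniq_perm; rewrite ?filter_uniq ?index_enum_uniq ?fset_uniq// => k.
by rewrite mem_filter mem_index_enum andbT.
Qed.

Lemma isotropic_column (j : 'I_n) :
  isotropic_gaussian mu (fun w => col j (Phi w)) s2.
Proof.
have colE w i : col j (Phi w) i 0 = Phi w i j by rewrite mxE.
split=> [i _|J A _ JA].
  split; first by under eq_fun do rewrite colE; move: i j {colE}; apply/measurable_mxP.
  move=> B mB; rewrite -(gaussian_entry (Num.sqrt s2) i j mB) -lawPhi.
    by congr (_ _); apply/seteqP; split => w /=; rewrite colE.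
  exact: (measurable_preimage (measurable_mx_entry i j)).
have /choice[B hB] : forall i : 'I_n, exists B : set R, i \in J ->
    measurable B /\ A i = (fun w => Phi w i j) @^-1` B.
  move=> i; case: (boolP (i \in J)) => iJ; last by exists set0.
  have [B mB AB] := JA i iJ; exists B => _; split=> //.
  by rewrite -AB setTI; apply/seteqP; split => w /=; rewrite colE.
pose B1 i k := if (k == j) && (i \in J) then B i else setT.
have mB1 i k : measurable (B1 i k).
  by rewrite /B1; case: ifP => // /andP[_ /hB[]].
transitivity (mu (Phi @^-1` mx_box B1)).
  congr (_ _); apply/seteqP; split => [w h i k|w h i iJ].
    by rewrite /B1; case: ifP => // /andP[/eqP-> iJ]; have := h i iJ; rewrite (hB i iJ).2.
  by rewrite (hB i iJ).2 /=; have := h i j; rewrite /B1 eqxx iJ.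
rewrite lawPhi; last exact: measurable_mx_box.
rewrite gaussian_mx_box// -(pair_big xpredT xpredT
  (fun i k => normal_prob 0 (Num.sqrt s2) (B1 i k)))/= big_fset_fintype.
apply: eq_bigr => i _; rewrite (bigD1 j)//= big1 ?mule1; last first.
  by move=> k /negbTE kj; rewrite /B1 kj probability_setT.
rewrite /B1 eqxx/=; case: ifPn => iJ; last by rewrite probability_setT.
rewrite (hB i iJ).2 -(gaussian_entry (Num.sqrt s2) i j (hB i iJ).1) -lawPhi//.
exact: (measurable_preimage (measurable_mx_entry i j) (hB i iJ).1).
Qed.

Lemma independent_columns :
  mutually_independent mu [set k | (1 <= k < n)%N]
    (fun k => sigma_mx (fun w => nth_col k (Phi w))).
Proof.
move=> J A JD JA.
have /choice[E hE] : forall k : nat, exists E : set 'cV[R]_n, k \in J ->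
    measurable E /\ A k = (fun w => nth_col k (Phi w)) @^-1` E.
  move=> k; case: (boolP (k \in J)) => kJ; last by exists set0.
  by have [E mE AE] := sigma_mx_preimage (JA k kJ); exists E.
pose D (j : 'I_n) := if j.+1 \in J then E j.+1 else setT.
have mD j : measurable (D j) by rewrite /D; case: ifP => // /hE[].
have mcol (j : 'I_n) : measurable_fun setT (fun c : 'M[R]_n => col j c).
  by apply/measurable_mxP => i k; under eq_fun do rewrite mxE; exact: measurable_mx_entry.
have colE (j : 'I_n) (c : 'M[R]_n) : nth_col j.+1 c = col j c by rewrite /nth_col /= valK.
have predJ k : k \in J -> exists j : 'I_n, k = j.+1.
  move=> kJ; have /andP[k1 kn] : (1 <= k < n)%N := JD k kJ.
  have k1n : (k.-1 < n)%N by rewrite prednK// ltnW.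
  by exists (Ordinal k1n); rewrite /= prednK.
transitivity (mu (Phi @^-1` [set c | forall j, D j (col j c)])).
  congr (_ _); apply/seteqP; split => [w h j|w h k kJ].
    rewrite /D; case: ifP => // jJ; have := h _ jJ.
    by rewrite (hE _ jJ).2 /= colE.
  have [j kj] := predJ k kJ; rewrite kj in kJ *; rewrite (hE _ kJ).2 /= colE.
  by have := h j; rewrite /D kJ.
rewrite lawPhi; last first.
  by apply: measurable_forall_fin => j; exact: (measurable_preimage (mcol j)).
rewrite gaussian_columns//.
transitivity (\prod_(j < n | j.+1 \in J) mu (A j.+1))%E.
  rewrite [RHS]big_mkcond; apply: eq_bigr => j _; rewrite /D.
  case: ifPn => jJ; last first.
    by rewrite (_ : [set c | _] = setT) ?probability_setT//; apply/seteqP; split.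
  rewrite -lawPhi; last exact: (measurable_preimage (mcol j) (hE _ jJ).1).
  by rewrite (hE _ jJ).2; congr (_ _); apply/seteqP; split => w /=; rewrite colE.
rewrite -big_filter.
rewrite -(big_map (fun j : 'I_n => j.+1) xpredT (fun k => mu (A k))).
apply: perm_big; apply: uniq_perm.
- by rewrite map_inj_uniq ?filter_uniq ?index_enum_uniq// => i j [] /val_inj.
- exact: fset_uniq.
move=> k; apply/mapP/idP => [[j]|kJ]; first by rewrite mem_filter => /andP[jJ _] ->.
by have [j kj] := predJ k kJ; exists j; rewrite // mem_filter -kj kJ mem_index_enum.
Qed.

End GaussianColumns.

(** * The joint law of the initial vector and the noise *)

Lemma big_fset_seq (K : choiceType) (R : realType) (J : {fset K}) (s : seq K) (F : K -> \bar R) :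
  uniq s -> (forall k, (k \in J) = (k \in s)) ->
  (\prod_(k <- J) F k = \prod_(k <- s) F k)%E.
Proof. by move=> us Js; apply: perm_big; apply: uniq_perm => //; exact: fset_uniq. Qed.

Lemma measurable_scaled {R : realType} (c : R) (B : set R) :
  measurable B -> measurable [set y | B (c * y)].
Proof. by move=> mB; exact: (measurable_preimage (@mulrl_measurable R setT c) mB). Qed.

Section JointLaw.
Context {d} {T : measurableType d} {R : realType} {n : nat} (n0 : (0 < n)%N).
Variables (P : probability T R) (W : T -> 'M[R]_n) (x : T -> 'cV[R]_n).
Hypotheses (wW : wigner P W) (mx : random_mx x).
Hypothesis ind : independent2 P (sigma_mx x) (sigma_mx W).
Notation Tup := ((n * n).-tuple R).
Let Q : probability Tup R := gaussian_tuple 1 (n * n).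
Notation s := (Num.sqrt (1 / n%:R) : R).
Local Open Scope ereal_scope.

Lemma wigner_sym w : (W w)^T = W w. Proof. by have [h _] := wW. Qed.

Let nR : (0 < n%:R :> R)%R. Proof. by rewrite ltr0n. Qed.
Let s0 : (0 < s)%R. Proof. by rewrite sqrtr_gt0 divr_gt0. Qed.
(** Chosen so that symm (seed wg) is W (symm_seed); above the diagonal the standard normal coordinates of the tuple are scaled to
    variance 1 / n. *)
Definition seed (wg : T * Tup) : 'M[R]_n := \matrix_(i, j)
  (if (j < i)%N then W wg.1 i j
   else if (i < j)%N then s * tnth wg.2 (mxvec_index i j)
   else W wg.1 i i / Num.sqrt 2)%R.

Lemma symm_seed wg : symm (seed wg) = W wg.1.
Proof.
apply/matrixP => i j; rewrite !mxE ltnn.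
have WT a b : W wg.1 a b = W wg.1 b a by rewrite -{1}(wigner_sym wg.1) mxE.
have [ij|ji|ij] := ltngtP i j => //.
by rewrite (val_inj ij) mulrC divfK// gt_eqF.
Qed.

Let low (ij : 'I_n * 'I_n) := (ij.2 <= ij.1)%N.

Lemma wigner_measurable_low ij : low ij -> measurable_fun setT (fun w => W w ij.1 ij.2).
Proof. by have [_ [h _]] := wW => /h[]. Qed.

Lemma wigner_measurable : measurable_fun setT W.
Proof.
apply/measurable_mxP => i j; have [ji|ij] := leqP j i.
  exact: (@wigner_measurable_low (i, j)).
rewrite (_ : (fun w => W w i j) = (fun w => W w j i)).
  by apply: (@wigner_measurable_low (j, i)); exact: ltnW.
by apply/funext => w; rewrite -{1}(wigner_sym w) mxE.
Qed.

Lemma x_measurable : measurable_fun setT x.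
Proof. by apply/measurable_mxP => i j; exact: mx. Qed.

Lemma measurable_seed : measurable_fun setT seed.
Proof.
have mW1 i j : measurable_fun setT (fun wg : T * Tup => W wg.1 i j).
  exact: (measurableT_comp (measurable_entry i j wigner_measurable) measurable_fst).
apply/measurable_mxP => i j; under eq_fun do rewrite mxE.
case: (ltngtP i j) => _.
- apply: measurable_funM => //.
  exact: (measurableT_comp (measurable_tnth _) measurable_snd).
- exact: mW1.
- by apply: measurable_funM => //; exact: mW1.
Qed.

Let scaled (B : 'I_n -> 'I_n -> set R) (ij : 'I_n * 'I_n) : set R :=
  if ij.1 == ij.2 then [set y | B ij.1 ij.2 ((Num.sqrt 2)^-1 * y)%R] else B ij.1 ij.2.

Let wigner_box (B : 'I_n -> 'I_n -> set R) : (forall i j, measurable (B i j)) ->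
  P [set w | forall ij, low ij -> scaled B ij (W w ij.1 ij.2)] =
  \prod_(ij | low ij) normal_prob 0 s (B ij.1 ij.2).
Proof.
move=> mB.
have msc ij : measurable (scaled B ij).
  rewrite /scaled; case: ifP => // _.
  exact: measurable_scaled.
pose J := [fset ij in [seq ij <- index_enum ('I_n * 'I_n)%type | low ij]]%fset.
have JE ij : (ij \in J) = low ij by rewrite !inE mem_filter mem_index_enum andbT.
have [_ [nW iW]] := wW.
have := iW J (fun ij => (fun w => W w ij.1 ij.2) @^-1` scaled B ij).
move=> h; rewrite (_ : [set w | _] = \bigcap_(k in [set` J])
    ((fun w => W w k.1 k.2) @^-1` scaled B k)); last first.
  apply/seteqP; split => [w hw k /= kJ|w hw k kl].
    by apply: hw; rewrite -JE.
  by apply: hw => /=; rewrite JE.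
rewrite h; first last.
- by move=> k _; exists (scaled B k) => //; rewrite setTI.
- by move=> k /=; rewrite JE.
rewrite (@big_fset_seq _ _ _ [seq ij <- index_enum ('I_n * 'I_n)%type | low ij]); first last.
- by move=> k; rewrite JE mem_filter mem_index_enum andbT.
- by rewrite filter_uniq// index_enum_uniq.
rewrite big_filter; apply: eq_bigr => ij kl; have [_ nWij] := nW ij kl.
rewrite (nWij _ (msc ij)) /scaled; case: ifP => [/eqP ij12|_]; last exact: erefl.
rewrite normal_prob_scale; [|by rewrite invr_gt0|by rewrite sqrtr_gt0 divr_gt0|exact: mB].
apply: (congr1 (fun a => normal_prob 0 a (B ij.1 ij.2))); rewrite mul1r.
rewrite -[X in (X * _)%R]sqrtrV// -sqrtrM ?invr_ge0//; congr Num.sqrt.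
by field; rewrite gt_eqF.
Qed.

Let noise_box (B : 'I_n -> 'I_n -> set R) : (forall i j, measurable (B i j)) ->
  Q [set g | forall i j : 'I_n, (i < j)%N -> B i j (s * tnth g (mxvec_index i j))%R] =
  \prod_(ij | ~~ low ij) normal_prob 0 s (B ij.1 ij.2).
Proof.
move=> mB.
have [f fK Kf] := curry_mxvec_bij n n.
pose D (k : 'I_(n * n)) : set R :=
  if ((f k).1 < (f k).2)%N then [set y | B (f k).1 (f k).2 (s * y)%R] else setT.
have mD k : measurable (D k).
  rewrite /D; case: ifP => // _.
  exact: measurable_scaled.
rewrite (_ : [set g | _] = [set g | forall k, D k (tnth g k)]); last first.
  apply/seteqP; split => [g h k|g h i j ij].
    rewrite /D; case: ifP => // lt; have := h _ _ lt.
    by rewrite -[mxvec_index _ _]/(uncurry (@mxvec_index n n) ((f k).1, (f k).2))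
      -surjective_pairing Kf.
  by have := h (mxvec_index i j); rewrite /D (fK (i, j))//= ij.
rewrite /Q gaussian_tuple_box// (reindex (uncurry (@mxvec_index n n))) /=; last first.
  by exists f => y _; rewrite ?fK ?Kf.
rewrite [RHS]big_mkcond; apply: eq_bigr => -[i j] _ /=.
rewrite /D (fK (i, j))//= /low /= -ltnNge.
case: ifP => _; last by rewrite probability_setT.
by rewrite normal_prob_scale; [rewrite mulr1|exact: s0|exact: ltr01|exact: mB].
Qed.

Let seed_law_at A B : measurable A -> measurable B ->
  (P \x Q) ([set wg | A (x wg.1)] `&` [set wg | B (seed wg)]) =
  P [set w | A (x w)] * gaussian_mx s n n B.
Proof.
move=> mA mB.
have mxA : measurable [set w | A (x w)] := measurable_preimage x_measurable mA.
have mA1 : measurable [set wg : T * Tup | A (x wg.1)].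
  exact: (measurable_preimage (measurableT_comp x_measurable measurable_fst)).
pose fseed : {mfun (T * Tup)%type >-> 'M[R]_n} :=
  HB.pack seed (isMeasurableFun.Build _ _ _ _ _ measurable_seed).
have p0 : 0 <= P [set w | A (x w)] by [].
pose k : {nonneg R} := NngNum (fine_ge0 p0).
have pfin : P [set w | A (x w)] \is a fin_num by exact: fin_num_measure.
have := @mx_measure_unique R n n (pushforward (mrestr (P \x Q) mA1) fseed)
    (mscale k (gaussian_mx s n n)).
move=> /(_ measurable_seed) uniq; have := uniq _ _ B mB.
rewrite /pushforward/= /mscale/= /mrestr/= fineK// setIC; apply.
  apply: le_lt_trans (probability_le1 _ _) (ltry 1).
  by rewrite preimage_setT setTI.
move=> {uniq} {}B {}mB.
pose A1 := [set w | A (x w)] `&` [set w | forall ij, low ij -> scaled B ij (W w ij.1 ij.2)].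
pose A2 := [set g : Tup | forall i j : 'I_n, (i < j)%N -> B i j (s * tnth g (mxvec_index i j))%R].
have msc ij : measurable (scaled B ij).
  rewrite /scaled; case: ifP => // _.
  exact: measurable_scaled.
have mWE : measurable [set M : 'M[R]_n | forall ij, low ij -> scaled B ij (M ij.1 ij.2)].
  rewrite (_ : [set M | _] =
      [set M : 'M[R]_n | forall ij, (if low ij then scaled B ij else setT) (M ij.1 ij.2)]).
    apply: measurable_forall_fin => ij.
    by apply: (measurable_preimage (measurable_mx_entry ij.1 ij.2)); case: ifP.
  apply/seteqP; split => M /= h ij; have := h ij; first by case: ifP => // _; apply.
  by case: ifP.
have mA1' : measurable A1.
  by apply: measurableI => //; exact: (measurable_preimage wigner_measurable mWE).
have mA2 : measurable A2.
  rewrite (_ : A2 = [set g : Tup | forall ij : 'I_n * 'I_n,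
     (if (ij.1 < ij.2)%N then [set y | B ij.1 ij.2 (s * y)%R] else setT)
       (tnth g (mxvec_index ij.1 ij.2))]).
    apply: measurable_forall_fin => ij.
    apply: (measurable_preimage (measurable_tnth _)); case: ifP => // _.
    exact: measurable_scaled.
  apply/seteqP; split => [g h [i j]/=|g h i j ij]; first by case: ifP => //; exact: h.
  by have := h (i, j); rewrite /= ij.
transitivity ((P \x Q) (A1 `*` A2)).
  apply: (congr1 (P \x Q)); apply/seteqP; split => [[w g] [/= hB hA]|[w g] [/= [hA hW] hg]].
    split; first split => //.
      move=> [i j]; rewrite /low /scaled/= => ji; have := hB i j; rewrite mxE/=.
      case: eqP => [->|/eqP ij]; first by rewrite ltnn mulrC.
      by rewrite ltn_neqAle ji andbT eq_sym ij.
    by move=> i j ij; have := hB i j; rewrite mxE/= ij ltnNge (ltnW ij).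
  split=> // i j; rewrite mxE/=.
  have [ij|ji|ij] := ltngtP i j; first exact: hg.
    by have := hW (i, j) (ltnW ji); rewrite /scaled/= -val_eqE/= gtn_eqF.
  rewrite (val_inj ij) mulrC.
  by have := hW (j, j); rewrite /low /scaled/= leqnn eqxx => /(_ isT).
rewrite product_probabilityE// noise_box//.
have -> : P A1 = P [set w | A (x w)] * \prod_(ij | low ij) normal_prob 0 s (B ij.1 ij.2).
  rewrite -wigner_box//; apply: ind; first exact: preimage_sigma_mx.
  exact: (preimage_sigma_mx (X := W) mWE).
rewrite -muleA; congr (_ * _); apply/esym; apply: etrans (gaussian_mx_box s mB) _.
exact: (bigID low).
Qed.

(** The pair (x_1, seed) has a product law, so a statement that holds for each
    fixed value of x_1 integrates to the probability space. *)
Lemma seed_preserving (f : 'cV[R]_n -> 'M[R]_n -> 'M[R]_n) E :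
  measurable_fun setT (fun p : 'cV[R]_n * 'M[R]_n => f p.1 p.2) ->
  (forall y, gaussian_preserving s (f y)) -> measurable E ->
  (P \x Q) [set wg | E (f (x wg.1) (seed wg))] = gaussian_mx s n n E.
Proof.
move=> mf pf mE.
pose fx : {mfun T >-> 'cV[R]_n} :=
  HB.pack x (isMeasurableFun.Build _ _ _ _ _ x_measurable).
pose h (wg : T * Tup) : 'cV[R]_n * 'M[R]_n := (x wg.1, seed wg).
have mh : measurable_fun setT h.
  apply: measurable_fun_pair; last exact: measurable_seed.
  exact: (measurableT_comp x_measurable measurable_fst).
pose fh : {mfun (T * Tup)%type >-> ('cV[R]_n * 'M[R]_n)%type} :=
  HB.pack h (isMeasurableFun.Build _ _ _ _ _ mh).
pose D := [set p : 'cV[R]_n * 'M[R]_n | E (f p.1 p.2)].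
have mD : measurable D := measurable_preimage mf mE.
pose nu : probability 'cV[R]_n R := distribution P fx.
transitivity ((nu \x gaussian_mx s n n) D).
  have uniq := @product_measure_unique _ _ _ _ _ nu (gaussian_mx s n n) (distribution (P \x Q) fh).
  apply/esym; apply: (uniq _ D mD) => A B mA mB.
  exact: seed_law_at.
rewrite /product_measure1/=.
transitivity (\int[nu]_y (cst (gaussian_mx s n n E) y)).
  apply: eq_integral => y _ /=; rewrite -[RHS](pf y E mE).
  by congr (_ _); apply/seteqP; split => b; rewrite /xsection/= inE.
rewrite integral_cst//; transitivity (gaussian_mx s n n E * 1); last by rewrite mule1.
by apply: (congr1 (mule _)); exact: (probability_setT nu).
Qed.

End JointLaw.

(** * The residual *)

Section Narrow.
Context {R : realType} {n : nat}.

Definition narrow (t : nat) (u : 'cV[R]_n) : 'cV[R]_t :=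
  \col_k (if insub (k : nat) is Some i then u i 0 else 0).

Lemma narrowE t (tn : (t <= n)%N) (u : 'cV[R]_n) k : narrow t u k 0 = u (widen_ord tn k) 0.
Proof.
rewrite mxE; case: insubP => [i _ ik|]; last by rewrite (leq_trans (ltn_ord k)).
by congr (u _ 0); exact/val_inj.
Qed.

Lemma sum_narrow (V : nmodType) t (F : 'I_n -> V) (tn : (t <= n)%N) :
  (forall i : 'I_n, (t <= i)%N -> F i = 0) ->
  \sum_(k < t) F (widen_ord tn k) = \sum_i F i.
Proof.
move=> F0; rewrite [RHS](bigID (fun i : 'I_n => (i < t)%N))/= [X in _ + X]big1 ?addr0.
  by rewrite (big_ord_narrow tn).
by move=> i; rewrite -leqNgt; exact: F0.
Qed.

Lemma norm2_narrow t (tn : (t <= n)%N) (u : 'cV[R]_n) : supported t u ->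
  norm2 (narrow t u) = norm2 u.
Proof.
move=> su; rewrite /norm2 -(sum_narrow (F := fun i => u i 0 ^+ 2) tn).
  by congr Num.sqrt; apply: eq_bigr => k _; rewrite narrowE.
by move=> i ti; rewrite su// expr0n.
Qed.

Lemma comb_narrow t (tn : (t <= n)%N) (u : 'cV[R]_n) (c : 'M[R]_n) : supported t u ->
  comb (narrow t u) (fun k => nth_col k c) = c *m u.
Proof.
move=> su.
transitivity (\sum_i u i 0 *: col i c).
  rewrite -(sum_narrow (F := fun i => u i 0 *: col i c) tn); last first.
    by move=> i ti; rewrite su// scale0r.
  apply: eq_bigr => k _; rewrite narrowE; congr (_ *: _).
  by rewrite /nth_col /= (_ : insub _ = Some (widen_ord tn k))// -[RHS]valK.
apply/colP => a; rewrite summxE mxE; apply: eq_bigr => i _.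
by rewrite !mxE mulrC.
Qed.

(** A unit vector along a; any unit vector serves when a = 0.  In dimension 0 there
    is no unit vector and both sides of the equation are 0. *)
Lemma dual_vector (p : nat) (a : 'cV[R]_p) :
  exists mu : 'cV[R]_p, ((0 < p)%N -> norm2 mu = 1) /\ mxdot mu a = norm2 a.
Proof.
have [a0|a0] := eqVneq (norm2 a) 0.
  case: p a a0 => [|p] a a0.
    by exists 0; split=> //; rewrite a0 mxdot_col big_ord0.
  exists (delta_mx 0 0); split.
    by move=> _; rewrite norm2E mxdot_delta mxE !eqxx sqrtr1.
  by rewrite mxdotC mxdot_delta a0 (norm2_eq0 a0) mxE.
exists ((norm2 a)^-1 *: a); split.
  by move=> _; rewrite norm2_scale ger0_norm ?invr_ge0 ?norm2_ge0// mulVf.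
by rewrite mxdotZl -norm2_sqr expr2 mulKf.
Qed.

End Narrow.

(** The terms with v cancel: delta and Delta split one inner product at
    eta_t(v_t). *)
Lemma amp_main_termE (R : realType) (n m : nat) (f : R -> R)
    (phi : nat -> 'cV[R]_n) (mu b : 'cV[R]_m) (y v : 'cV[R]_n) :
  amp_main_term f phi mu b y v = mxdot mu (\col_k
    (dotv (phi k.+1) (map_mx f y) - avgv (map_mx (Defs.deriv0 f) y) * b k 0)).
Proof.
have combE (z : 'cV[R]_n) : dotv (comb mu phi) z = \sum_k mu k 0 * dotv (phi k.+1) z.
  rewrite /dotv /comb; under eq_bigr do rewrite summxE mulr_suml.
  rewrite exchange_big; apply: eq_bigr => k _; rewrite mulr_sumr.
  by apply: eq_bigr => i _; rewrite mxE mulrA.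
have dotvB (u z z' : 'cV[R]_n) : dotv u (z - z') = dotv u z - dotv u z'.
  by rewrite /dotv -sumrB; apply: eq_bigr => i _; rewrite !mxE mulrBr.
have avgvB (z z' : 'cV[R]_n) : avgv (z - z') = avgv z - avgv z'.
  rewrite /avgv -mulrBl -sumrB; congr (_ / _); apply: eq_bigr => i _.
  by rewrite !mxE.
rewrite /amp_main_term /amp_Delta combE avgvB [dotv mu b]/dotv mulr_sumr -sumrB -big_split/=.
by rewrite mxdot_col; apply: eq_bigr => k _; rewrite dotvB mxE/=; ring.
Qed.

Section Residual.
Context {R : realType} {n : nat} (lambda : R) (vstar : 'cV[R]_n) (eta : nat -> R -> R).
Variables (x : 'cV[R]_n) (b : 'M[R]_n) (t : nat).
Hypotheses (t0 : (0 < t)%N) (tn : (t <= n)%N).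
Notation state := (amp_state lambda vstar eta (symm b) x).
Notation Z := (amp_basis lambda vstar eta x b n).
Notation Phi := (amp_phi lambda vstar eta n x b).

Lemma amp_coords_supported k : (k <= n)%N -> supported k (Z^T *m (state k).1).
Proof.
case: k => [|k] kn i ki; first by rewrite /= mulmx0 mxE.
exact: (basis_span (amp_dir lambda vstar eta (symm b) x) kn ki).
Qed.

(** The coefficients of the error matrix.  In coordinates, W y_t minus the sum of
    the beta^k phi_k has matrix symm G - G with G_ik = <z_i, phi_k>; it vanishes
    below the diagonal, is G_ki - G_ik above it and (sqrt 2 - 1) G_ii on it.
    Subtracting <phi_i, y_t>, whose coefficients are G_ki, in the rows i < t
    (counted from 1) leaves entries of G on and above the diagonal only.  Row t
    keeps just its diagonal entry, as beta has no coordinates beyond t. *)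
Definition overlay_fst : 'M[R]_n := \matrix_(a, c)
  (if (a < c)%N then (if (c < t)%N then -1 else 0)
   else if a == c :> nat then
     (if (a.+1 < t)%N then Num.sqrt 2 - 2
      else if a.+1 == t :> nat then Num.sqrt 2 - 1 else 0)
   else 0).

Definition overlay_snd : 'M[R]_n := \matrix_(a, c)
  (if (a < c)%N && (c.+1 < t)%N then -1 else 0).

Let sqrt2_bound : 1 <= Num.sqrt 2 :> R /\ Num.sqrt 2 <= 2 :> R.
Proof.
split; first by rewrite -[leLHS]sqrtr1 ler_sqrt// ler1n.
rewrite -[leRHS]ger0_norm// -sqrtr_sqr ler_sqrt ?sqr_ge0//.
by rewrite -natrX ler_nat.
Qed.

Lemma overlay_fst_le a c : `|overlay_fst a c| <= 1.
Proof.
have [h1 h2] := sqrt2_bound.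
rewrite mxE; do ![case: ifP => _]; rewrite ?normrN1 ?normr0// ler_norml; lra.
Qed.

Lemma overlay_snd_le a c : `|overlay_snd a c| <= 1.
Proof. by rewrite mxE; case: ifP => _; rewrite ?normrN1 ?normr0. Qed.

Variables (Psi : 'M[R]_n) (d : R).
Hypothesis PsiE : forall i k : 'I_n, (i <= k)%N -> Psi i k = (Z^T *m Phi) i k.

Notation y := (state t).1.
Notation beta := (Z^T *m (state t).1).
Notation a := (Z^T *m (state t.-1).1).

Definition bulk_coords : 'cV[R]_n :=
  \col_i (if (i < t.-1)%N then (Phi^T *m y) i 0 - d * a i 0 else 0).

Definition residual_error : 'cV[R]_n := overlay overlay_fst overlay_snd Psi *m beta.

Lemma residual_coords :
  Z^T *m (symm b *m y - d *: (state t.-1).1 - Phi *m beta) = bulk_coords + residual_error.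
Proof.
have oZ : orthogonal_mx Z := basis_orthogonal _ _.
have sb := amp_coords_supported tn.
have sa := amp_coords_supported (leq_trans (leq_pred t) tn).
have ZZy : Z *m beta = y by rewrite mulmxA orthogonal_mxC// mul1mx.
have SG : Z^T *m symm b *m Z = symm (Z^T *m Phi).
  have -> : Z^T *m Phi = rot Z b.
    transitivity (Z^T *m (Z *m rot Z b)); first exact: erefl.
    by rewrite mulmxA oZ mul1mx.
  by rewrite rot_symm.
have e1 : Z^T *m (symm b *m y) = symm (Z^T *m Phi) *m beta.
  by rewrite -SG -!mulmxA (mulmxA Z) orthogonal_mxC// mul1mx.
have e2 (c : 'M[R]_n) : c^T *m y = (Z^T *m c)^T *m beta.
  by rewrite (trmx_mul Z^T c) trmxK -(mulmxA c^T) ZZy.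
rewrite !mulmxBr e1 (mulmxA Z^T Phi) -scalemxAr /bulk_coords (e2 Phi) /residual_error.
move: (Z^T *m Phi) PsiE beta sb a sa => G PG bt sbt av sav.
apply/colP => i.
have entry (M : 'M[R]_n) : (M *m bt) i 0 = \sum_j M i j * bt j 0 by rewrite mxE.
transitivity ((symm G *m bt) i 0 - d * av i 0 - (G *m bt) i 0).
  by move: (symm G *m bt) (G *m bt) => u1 u2; rewrite !mxE.
rewrite [RHS]mxE [X in _ = X + _]mxE !entry.
have -> : (\sum_j symm G i j * bt j 0) - d * av i 0 - \sum_j G i j * bt j 0
   = \sum_j (symm G i j - G i j) * bt j 0 - d * av i 0.
  by rewrite addrAC -sumrB; congr (_ - _); apply: eq_bigr => j _; rewrite mulrBl.
have e : \sum_j (symm G i j - G i j) * bt j 0 =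
   \sum_j (if (i < t.-1)%N then G j i else 0) * bt j 0
   + \sum_j overlay overlay_fst overlay_snd Psi i j * bt j 0.
  rewrite -big_split; apply: eq_bigr => j _ /=; rewrite -mulrDl.
  have [tj|jt] := leqP t j; first by rewrite sbt// !mulr0.
  congr (_ * _); rewrite !mxE.
  have [ij|ji|ij] := ltngtP i j.
  - rewrite jt (_ : (i < t.-1)%N); last by rewrite -ltnS prednK// (leq_ltn_trans ij).
    by rewrite /= PG ?(ltnW ij)//; ring.
  - rewrite /= subrr; case: ifPn => it.
      have -> : (i.+1 < t)%N by lia.
      by rewrite (PG _ _ (ltnW ji)); ring.
    have -> : (i.+1 < t)%N = false by lia.
    by ring.
  - rewrite (val_inj ij) (PG _ _ (leqnn j)) /=; case: ifPn => it.
      have -> : (j.+1 < t)%N by lia.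
      by ring.
    have -> : (j.+1 < t)%N = false by lia.
    have -> : (j.+1 == t) by lia.
    by ring.
rewrite e; case: ifPn => it.
  by under [in RHS]eq_bigr do rewrite mxE; ring.
rewrite sav; last by rewrite leqNgt.
by rewrite big1 ?mulr0 ?add0r ?subr0// => j _; rewrite mul0r.
Qed.

Lemma residual_error_supported : supported t residual_error.
Proof.
move=> i ti; rewrite mxE big1// => j _; rewrite !mxE.
have h1 : (i.+1 < t)%N = false by lia.
have h2 : (i.+1 == t) = false by lia.
rewrite h1 h2 andbF mul0r addr0.
case: ifP => ij; last by case: ifP => _; rewrite ?mul0r.
by rewrite (_ : (j < t)%N = false) ?mul0r//; lia.
Qed.

Lemma residual_norm (r : R) : 0 <= r ->
  (forall u v, supported t u -> supported t v ->
    `|mxdot u (overlay overlay_fst overlay_snd Psi *m v)| <= r * norm2 u * norm2 v) ->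
  `|norm2 (symm b *m y - d *: (state t.-1).1 - Phi *m beta) - norm2 bulk_coords|
    <= r * norm2 beta.
Proof.
move=> r0 bound.
have oZ : orthogonal_mx Z^T := orthogonal_mx_tr (basis_orthogonal _ _).
rewrite (_ : norm2 (_ - _) = norm2 (bulk_coords + residual_error)); last first.
  by rewrite -residual_coords !norm2E mxdot_mull.
apply: le_trans (norm2_dist _ _) _.
have [e0|e0] := eqVneq (norm2 residual_error) 0.
  by rewrite e0 mulr_ge0// norm2_ge0.
have ep : 0 < norm2 residual_error by rewrite lt_neqAle eq_sym e0 norm2_ge0.
rewrite -(ler_pM2r ep) -expr2 norm2_sqr.
apply: le_trans (ler_norm _) _.
have := bound _ _ residual_error_supported (amp_coords_supported tn).
by rewrite -/residual_error => /le_trans; apply; rewrite mulrAC.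
Qed.

End Residual.

(** * The decomposition *)

Lemma amp_stateE (R : realType) (n : nat) (lambda : R) (vstar : 'cV[R]_n)
    (W : 'M[R]_n) (eta : nat -> R -> R) (x : nat -> 'cV[R]_n) :
  map_mx (eta 0%N) (x 0%N) = 0 -> amp_recursion (spiked lambda vstar W) eta x ->
  forall t, amp_state lambda vstar eta W (x 1%N) t = (map_mx (eta t) (x t), x t.+1).
Proof.
move=> eta0 rec; elim=> [|t IH] /=; first by rewrite eta0.
by rewrite IH /= (rec t.+1).
Qed.

Lemma gaussian_tuple_independent (R : realType) (m : nat) :
  independent_normals (gaussian_tuple (1 : R) m) [set: 'I_m]
    (fun i g => tnth g i) (fun=> 1).
Proof.
have box (J : {fset 'I_m}) (B : 'I_m -> set R) : (forall i, measurable (B i)) ->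
    gaussian_tuple 1 m [set g | forall i, i \in J -> B i (tnth g i)] =
    (\prod_(i <- J) normal_prob 0 1 (B i))%E.
  move=> mB; pose B1 i := if i \in J then B i else setT.
  have mB1 i : measurable (B1 i) by rewrite /B1; case: ifP.
  rewrite big_fset_fintype (_ : [set g | _] = [set g | forall i, B1 i (tnth g i)]).
    rewrite gaussian_tuple_box//; apply: eq_bigr => i _; rewrite /B1.
    by case: ifP => // _; rewrite probability_setT.
  apply/seteqP; split => g h i; first by rewrite /B1; case: ifP => //; exact: h.
  by move=> iJ; have := h i; rewrite /B1 iJ.
have law i (B : set R) : measurable B ->
    gaussian_tuple 1 m [set g | B (tnth g i)] = normal_prob 0 1 B.
  move=> mB; have := box [fset i]%fset (fun=> B) (fun=> mB).
  rewrite big_seq_fset1 => <-; congr (_ _); apply/seteqP; split => g /=.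
    by move=> h j; rewrite inE => /eqP ->.
  by apply; rewrite inE.
split=> [i _|J A _ JA].
  split; first exact: measurable_tnth.
  by move=> B mB; rewrite sqrtr1; exact: law.
have /choice[B hB] : forall i : 'I_m, exists B : set R, measurable B /\
    (i \in J -> A i = [set g | B (tnth g i)]).
  move=> i; case: (boolP (i \in J)) => iJ; last by exists set0.
  have [B mB AB] := JA i iJ; exists B; split=> // _.
  by rewrite -AB setTI.
transitivity (gaussian_tuple 1 m [set g | forall i, i \in J -> B i (tnth g i)]).
  congr (_ _); apply/seteqP; split => [g h i iJ|g h i /= iJ].
    by have := h i iJ; rewrite (hB i).2.
  by rewrite (hB i).2//; exact: h.
rewrite box => [|i]; last exact: (hB i).1.
apply: eq_big_seq => i iJ; rewrite (hB i).2// law//; exact: (hB i).1.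
Qed.

Theorem theorem1 (R : realType) :
  exists C1 C2 : R, 0 < C1 /\ 0 < C2 /\
  forall (n : nat) (d : measure_display) (Omega : measurableType d)
    (P : probability Omega R)
    (lambda : R) (vstar : 'cV[R]_n) (W : Omega -> 'M[R]_n)
    (eta : nat -> R -> R) (x : nat -> Omega -> 'cV[R]_n),
  0 < lambda ->
  norm2 vstar = 1 ->
  wigner P W ->
  (forall t, differentiable_but_finitely (eta t)) ->
  (forall w, map_mx (eta 0%N) (x 0%N w) = 0) ->
  random_mx (x 1%N) ->
  independent2 P (sigma_mx (x 1%N)) (sigma_mx W) ->
  (forall w, amp_recursion (spiked lambda vstar (W w)) eta (x ^~ w)) ->
  exists (m : nat) (Q : probability (m.-tuple R) R),
  independent_normals Q [set: 'I_m] (fun i g => tnth g i) (fun=> 1) /\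
  exists (phi : nat -> Omega * m.-tuple R -> 'cV[R]_n)
    (beta : forall t : nat, Omega * m.-tuple R -> 'cV[R]_t)
    (xi : nat -> Omega * m.-tuple R -> 'cV[R]_n),
  [/\ forall k, (1 <= k < n)%N ->
        isotropic_gaussian (P \x Q)%E (phi k) (1 / n%:R),
      mutually_independent (P \x Q)%E [set k | (1 <= k < n)%N]
        (fun k => sigma_mx (phi k)),
      forall t, (1 <= t < n)%N -> random_mx (beta t) /\ random_mx (xi t) &
      forall t, (1 <= t < n)%N ->
      [/\ forall w, x t.+1 w.1 =
            amp_alpha lambda vstar eta (x ^~ w.1) t.+1 *: vstar
            + comb (beta t w) (phi ^~ w) + xi t w,
          forall w, norm2 (beta t w) = norm2 (map_mx (eta t) (x t w.1)) &
          exists E : set (Omega * m.-tuple R),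
          [/\ measurable E,
              ((1 - C1 / n%:R ^+ 11)%:E <= (P \x Q) E)%E &
              forall w, E w ->
              exists mu : 'cV[R]_t.-1,
                (* a unit vector exists in R^(t-1) only for t >= 2 *)
                ((1 < t)%N -> norm2 mu = 1) /\
                `| norm2 (xi t w)
                   - amp_main_term (eta t) (phi ^~ w) mu (beta t.-1 w) (x t w.1)
                       (amp_v lambda vstar eta (x ^~ w.1) (phi ^~ w) t
                          (beta t.-1 w)) |
                <= C2 * (Num.sqrt (t%:R * ln n%:R / n%:R)
                         * norm2 (beta t w))]]].
Proof.
exists 2, 96; split=> //; split=> // n d Omega P lambda vstar W eta x.
move=> _ vstar1 wW deta eta0 rx1 ind rec.
have n0 : (0 < n)%N.
  case: n vstar vstar1 {W wW x eta0 rx1 ind rec} => // vstar.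
  by rewrite /norm2 big_ord0 sqrtr0 => /esym/eqP; rewrite oner_eq0.
have xE w t : amp_state lambda vstar eta (W w) (x 1%N w) t = (map_mx (eta t) (x t w), x t.+1 w).
  exact: (amp_stateE (eta0 w) (rec w)).
exists (n * n)%N, (gaussian_tuple 1 (n * n)).
split; first exact: gaussian_tuple_independent.
set Q := gaussian_tuple 1 (n * n).
pose T := (Omega * (n * n).-tuple R)%type.
pose b : T -> 'M[R]_n := seed W.
have bW w : symm (b w) = W w.1 by exact: (symm_seed wW).
have mb : measurable_fun setT b by exact: (measurable_seed wW).
have mx1 : measurable_fun setT (fun w : T => x 1%N w.1).
  exact: (measurableT_comp (x_measurable rx1) measurable_fst).
have mW1 : measurable_fun setT (fun w : T => W w.1).
  exact: (measurableT_comp (wigner_measurable wW) measurable_fst).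
pose Phi (w : T) := amp_phi lambda vstar eta n (x 1%N w.1) (b w).
have mPhi : measurable_fun setT Phi by exact: measurable_amp_phi.
pose Z (w : T) := amp_basis lambda vstar eta (x 1%N w.1) (b w) n.
have mZ : measurable_fun setT Z.
  by apply: measurable_basis => i; apply: measurable_amp_dir => //; exact: measurable_symm.
pose Psi (w : T) := amp_coord lambda vstar eta (x 1%N w.1) (Phi w).
have mPsi : measurable_fun setT Psi by exact: measurable_amp_coord_from.
have s0 : Num.sqrt (1 / n%:R) != 0 :> R by rewrite gt_eqF// sqrtr_gt0 divr_gt0// ltr0n.
have lawPhi E : measurable E ->
    (P \x Q)%E (Phi @^-1` E) = gaussian_mx (Num.sqrt (1 / n%:R)) n n E.
  apply: (seed_preserving n0 wW rx1 ind (f := fun y b => amp_phi lambda vstar eta n y b)).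
    by apply: measurable_amp_phi.
  by move=> y; apply: amp_phi_law.
have lawPsi E : measurable E ->
    (P \x Q)%E (Psi @^-1` E) = gaussian_mx (Num.sqrt (1 / n%:R)) n n E.
  apply: (seed_preserving n0 wW rx1 ind
    (f := fun y b => amp_coord lambda vstar eta y (amp_phi lambda vstar eta n y b))).
    apply: measurable_amp_coord_from => //.
    by apply: measurable_amp_phi.
  move=> y; apply: (@gaussian_preserving_comp _ _ _ _ (amp_coord lambda vstar eta y)).
  - apply: (measurable_amp_coord_from _ _ deta); [exact: measurable_id|exact: measurable_cst].
  - exact: amp_coord_law.
  - exact: amp_phi_law.
pose y t (w : T) := map_mx (eta t) (x t w.1).
have yE t w : y t w = (amp_state lambda vstar eta (symm (b w)) (x 1%N w.1) t).1.
  by rewrite bW xE.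
have my t : measurable_fun setT (y t).
  rewrite (funext (yE t)).
  by apply: (measurable_amp_state _ _ deta _ _ t).1 => //; exact: measurable_symm.
have mx t : measurable_fun setT (fun w : T => x t.+1 w.1).
  rewrite (_ : (fun w : T => _) =
      (fun w : T => (amp_state lambda vstar eta (W w.1) (x 1%N w.1) t).2)).
    exact: (measurable_amp_state _ _ deta _ _ t).2.
  by apply/funext => w; rewrite xE.
pose phi k (w : T) := nth_col k (Phi w).
pose beta t (w : T) := narrow t ((Z w)^T *m y t w).
(* xi is what is left over, so the decomposition holds by definition and the
   work is in the norm of xi. *)
pose xi t (w : T) := x t.+1 w.1 - amp_alpha lambda vstar eta (x ^~ w.1) t.+1 *: vstar
  - comb (beta t w) (phi ^~ w).
have supp t w : (t <= n)%N -> supported t ((Z w)^T *m y t w).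
  by move=> tn; rewrite yE; exact: amp_coords_supported.
have combE t w : (t <= n)%N -> comb (beta t w) (phi ^~ w) = Phi w *m ((Z w)^T *m y t w).
  by move=> tn; apply: comb_narrow => //; exact: supp.
have nbeta t w : (t <= n)%N -> norm2 (beta t w) = norm2 (y t w).
  move=> tn; rewrite norm2_narrow//; last exact: supp.
  rewrite !norm2E mxdot_mull//.
  by apply/orthogonal_mx_tr/basis_orthogonal.
exists phi, beta, xi; split.
- move=> k /andP[k1 kn]; have k1n : (k.-1 < n)%N by rewrite prednK// ltnW.
  rewrite (_ : phi k = (fun w => col (Ordinal k1n) (Phi w))).
    exact: isotropic_column.
  apply/funext => w; rewrite /phi /nth_col.
  by rewrite (_ : insub _ = Some (Ordinal k1n))// -[RHS]valK.
- have := independent_columns lawPhi; exact.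
- move=> t /andP[t1 tn]; have mbt : measurable_fun setT (fun w => (Z w)^T *m y t w).
    by apply: measurable_mulmx => //; exact: measurable_trmx.
  split; apply/measurable_mxP.
    apply/measurable_mxP => i j; rewrite (ord1 j).
    under eq_fun do rewrite (narrowE (ltnW tn)).
    exact: measurable_entry.
  rewrite /xi; under eq_fun do rewrite (combE _ _ (ltnW tn)).
  apply: measurable_submx; last exact: measurable_mulmx.
  apply: measurable_submx => //; apply: measurable_scalemx => //.
  apply: measurable_funM => //; apply: measurable_sum => i.
  by apply: measurable_funM => //; exact: (measurable_entry i 0 (my t)).
move=> t /andP[t1 tn]; split.
- by move=> w; rewrite /xi addrC -[X in X + _]addrA -opprD subrK.
- by move=> w; exact: nbeta (ltnW tn).
have t1n : (0 < t < n)%N by rewrite t1.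
have [G [mG lawG boundG]] := gaussian_concentration t1n
  (@overlay_fst_le R n t) (@overlay_snd_le R n t).
exists (Psi @^-1` G); split.
- exact: measurable_preimage.
- by rewrite lawPsi.
move=> w Gw.
set q := Num.sqrt _.
pose dd := avgv (map_mx (Defs.deriv0 (eta t)) (x t w.1)).
have PsiE (i k : 'I_n) : (i <= k)%N -> Psi w i k = ((Z w)^T *m Phi w) i k.
  exact: amp_coordE.
have q0 : 0 <= 96 * q by rewrite mulr_ge0// sqrtr_ge0.
have := residual_norm (lambda := lambda) (vstar := vstar) (eta := eta) t1 (ltnW tn) dd PsiE q0 (boundG _ Gw).
move=> bound.
have xiE : xi t w = symm (b w) *m y t w - dd *: y t.-1 w - Phi w *m ((Z w)^T *m y t w).
  rewrite /xi (combE _ _ (ltnW tn)) (rec w.1 t t1) bW; congr (_ - _).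
  rewrite /spiked mulmxDl -scalemxAl mul_col_row scalerA /amp_alpha.
  rewrite -/(y t w) -/(y t.-1 w) -/dd (_ : dotv vstar _ = mxdot vstar (y t w)); last first.
    by rewrite mxdot_col.
  by rewrite addrAC; congr (_ - _); rewrite addrAC subrr add0r.
set A : 'cV[R]_t.-1 := \col_k (dotv (phi k.+1 w) (y t w) - dd * beta t.-1 w k 0).
have [mu [mu1 muA]] := dual_vector A.
exists mu; split; first by move=> tt; apply: mu1; rewrite -ltnS prednK.
rewrite amp_main_termE -/(y t w) -/dd -/A muA.
have tpn : (t.-1 <= n)%N := leq_trans (leq_pred t) (ltnW tn).
set bulk := bulk_coords _ _ _ _ _ _ _ in bound.
have AE : norm2 A = norm2 bulk.
  rewrite -(norm2_narrow tpn); last by move=> i ti; rewrite mxE ltnNge ti.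
  congr norm2; apply/colP => k; rewrite narrowE [LHS]mxE [RHS]mxE/= ltn_ord; congr (_ - _ * _).
    rewrite -yE [RHS]mxE; apply: eq_bigr => i _; congr (_ * _).
    rewrite /phi /nth_col /= (_ : insub _ = Some (widen_ord tpn k)); first by rewrite !mxE.
    by rewrite -[RHS]valK.
  by rewrite -yE /beta narrowE.
have nZ : norm2 ((Z w)^T *m y t w) = norm2 (beta t w).
  by rewrite (norm2_narrow (ltnW tn))//; apply: supp; exact: ltnW.
by rewrite AE xiE mulrA -nZ; move: bound; rewrite -!yE.
Qed.
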